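(* The algorithm CountMatchings (specified in the context) provides an FPTAS for the problem $\#M(3,3)$ of counting the number of matchings in $(3,3)$-graphs, and runs in time $$O\left(n^2(n/\epsilon)^{\log_{50/49}144}\right),$$ where $n=|E(H)|$ is the number of edges of the input $(3,3)$-graph $H$.
   Context: **Hypergraphs and the counting problem.** A hypergraph $H=(V,E)$ is a finite set of vertices $V$ together with a family $E$ of distinct nonempty subsets of $V$ called edges. It is $k$-uniform (a $k$-graph) if every edge has size $k$. The degree of a vertex is the number of edges containing it, and $\Delta(H)$ is the maximum degree. A $(k,r)$-graph is a $k$-graph $H$ with $\Delta(H)\le r$. A matching is a (possibly empty) set of disjoint edges, and $Z_M(H)$ is the number of matchings of $H$, including the empty one. $\#M(k,r)$ is the problem of counting the matchings in $(k,r)$-graphs. The intersection graph $L(H)$ has vertex set $E(H)$, with two vertices adjacent when the corresponding edges of $H$ intersect. **FPTAS.** A fully polynomial time approximation scheme (FPTAS) for a function $f$ on $\{0,1\}^*$ is a deterministic algorithm which for every pair $(\epsilon,x)$ with $\epsilon>0$ and $x\in\{0,1\}^*$ returns a number $y(x)$ such that $|y(x)-f(x)|\le\epsilon f(x)$, and runs in time polynomial in $1/\epsilon$ and $|x|$. **Graph notation.** For a graph $G$: $N_G(v)$ is the neighborhood of $v$, $N_G[v]=N_G(v)\cup\{v\}$, $G[A]$ is the subgraph induced by $A$, $G-A=G[V(G)\setminus A]$, $G-v=G-\{v\}$, $\alpha$ is the size of a largest independent set, and $\delta$ is the minimum degree. A set $K\subseteq V(G)$ is a block in $G$ if $\alpha(G[K])\le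 2$, $|K|\le 4$, and $\delta(G[K])\ge 1$ whenever $|K|=4$ (the empty set is a block). A block $K$ is simplicial in $G$ if for every $v\in K$ the set $N_G(v)\setminus K$ is a block in $G-K$. **The function $\Phi$.** For a graph $G$, a simplicial block $K$ in $G$ and an integer $t\ge 0$, put $\Phi_G(K,0)=\Phi_G(K,1)=1$ and $\Phi_G(\emptyset,t)=1$, and for $t\ge 2$, $K\ne\emptyset$, $$\Phi_G(K,t)^{-1}=1+\sum_{v\in K}\Phi_{G-K}(K_v,t-1)\Big(1+\tfrac12\sum_{u}\Phi_{G-K-K_v}(K_{uv},t-2)\Big),$$ where the inner sum is over all $u\in K$, $u\neq v$, not adjacent to $v$ in $G$, and $K_v=N_G(v)\setminus K$, $K_{uv}=N_G(u)\setminus(N_G(v)\cup K)$. **Subroutine CountIS$(G,K,t)$** ($G$ a connected induced subgraph of an intersection graph of a $(3,3)$-graph, $K$ a nonempty simplicial block in $G$): 1. Take a partition $V(G)=K_1\cup\dots\cup K_m$ with $K_1=K$ such that for every $i=2,\dots,m$ the set $K_i$ is a nonempty simplicial block in $G-\bigcup_{j<i}K_j$. (It is built step by step: if $R=V(G)\setminus\bigcup_{i\le s}K_i\neq\emptyset$, choose a vertex $v\in\bigcup_{i\le s}K_i$ having a neighbor in $R$ and set $K_{s+1}=N_G(v)\cap R$.) 2. Set $Z_I:=1$, $F:=G$. 3. For $i=1,\dots,m$: set $Z_I:=Z_I/\Phi_F(K_i,t)$, then $F:=F-K_i$. 4. Return $Z_I$. **Algorithm CountMatchings$(H,t)$** ($H$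 a connected $(3,3)$-graph): 1. Set $G:=L(H)$, $Z_M:=1$, $F:=G$. 2. While $F\ne\emptyset$: - pick $v\in V(F)$ such that $F-v$ is connected, and set $F^v:=F-N_F[v]$; - if $F^v=\emptyset$, set $Z_M:=Z_M+1$; - otherwise let $F^v_1,\dots,F^v_c$ be the connected components of $F^v$; for each $i$ find $u_i\in N_F(v)$ with $K_i:=N_F(u_i)\cap V(F^v_i)\ne\emptyset$ (this $K_i$ is a simplicial block in $F_i^v$), and set $Z_M:=Z_M+\prod_{i=1}^c\mathrm{CountIS}(F_i^v,K_i,t)$; - set $F:=F-v$. 3. Return $Z_M$. For a disconnected $H$ the problem is reduced to connected ones by multiplying the values over the connected components of $L(H)$. For a given $\epsilon>0$ the algorithm is run with $t=2\lceil\log(18n/\epsilon)/\log(50/49)\rceil$.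
   Formalization: For ε>1 the algorithm is run with ε replaced by 1 (with the stated t the guarantee fails for ε just below 18n when L(H) is a long path), and the O-bound is stated for 0<ε≤1 and n≥1; t is an input of the algorithm, so computing it from ε is not charged. *)

(* Defs.v *)
From HB Require Import structures.
From mathcomp Require Import all_boot all_order all_algebra.
From mathcomp Require Import reals exp.

Set Implicit Arguments.
Unset Strict Implicit.
Unset Printing Implicit Defensive.

Import Order.TTheory GRing.Theory Num.Theory.
Local Open Scope ring_scope.

Record hypergraph := Hypergraph {
  vertex : finType;
  edges : {set {set vertex}};
  edges_nonempty : set0 \notin edges }.

Definition degree (H : hypergraph) (v : vertex H) : nat :=
  #|[set e in edges H | v \in e]|.

Definition max_degree (H : hypergraph) : nat := (\max_(v : vertex H) degree v)%N.

Definition uniform (k : nat) (H : hypergraph) : Prop :=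
  forall e, e \in edges H -> #|e| = k.

Definition kr_graph (k r : nat) (H : hypergraph) : Prop :=
  uniform k H /\ (max_degree H <= r)%N.

Definition matchings (H : hypergraph) : {set {set {set vertex H}}} :=
  [set M : {set {set vertex H}} | (M \subset edges H) && trivIset M].

Definition Z_M (H : hypergraph) : nat := #|matchings H|.

(* Only the values of gadj on vset G are meaningful, so that an induced subgraph
   keeps gadj and shrinks vset. *)
Record graph (T : finType) := Graph {
  vset : {set T};
  gadj : rel T;
  gadj_sym : symmetric gadj;
  gadj_irr : irreflexive gadj }.

Section Graphs.
Variable T : finType.
Implicit Types (G F : graph T) (A K : {set T}) (v : T) (t : nat).

Definition induced G A : graph T :=
  Graph (vset G :&: A) (@gadj_sym T G) (@gadj_irr T G).

Definition gdel G A : graph T := induced G (~: A).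

Definition nbr G v : {set T} := [set u in vset G | gadj G v u].

Definition independent G A : bool :=
  (A \subset vset G) && [forall u in A, forall v in A, ~~ gadj G u v].

Definition alpha G : nat := (\max_(A : {set T} | independent G A) #|A|)%N.

(* The unit #|T| of the minimum bounds every degree from above; it is the value
   of min_degree only if G has no vertex. *)
Definition min_degree G : nat := \big[minn/#|T|]_(v in vset G) #|nbr G v|.

Definition block G K : bool :=
  [&& K \subset vset G, (alpha (induced G K) <= 2)%N, (#|K| <= 4)%N
    & (#|K| == 4%N) ==> (1 <= min_degree (induced G K))%N].

Definition simplicial_block G K : bool :=
  block G K && [forall v in K, block (gdel G K) (nbr G v :\: K)].

Fixpoint Phi t G K : rat :=
  match t with
  | (r.+1 as s).+1 =>
    if K == set0 then 1 else
    (1 + \sum_(v in K)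
           let Kv := nbr G v :\: K in
           Phi s (gdel G K) Kv *
           (1 + 2%:R^-1 *
              \sum_(u in K | (u != v) && ~~ gadj G v u)
                 Phi r (gdel (gdel G K) Kv) (nbr G u :\: (nbr G v :|: K))))^-1
  | _ => 1
  end.

Definition reachable G : rel T :=
  connect (fun x y => [&& x \in vset G, y \in vset G & gadj G x y]).

(* The graph without vertices is connected in this sense, as needed when the
   last vertex of F is picked. *)
Definition gconnected G : Prop := {in vset G &, forall x y, reachable G x y}.

Definition components G : {set {set T}} :=
  equivalence_partition (reachable G) (vset G).

(* p = [:: K_2; ...; K_m] exhausts V(G), each K_i being a nonempty simplicial
   block in what is left. *)
Fixpoint peeling G (p : seq {set T}) : bool :=
  if p is K :: p' then
    [&& K != set0, simplicial_block G K & peeling (gdel G K) p']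
  else vset G == set0.

Fixpoint divide_Phi t F (p : seq {set T}) (z : rat) : rat :=
  if p is K :: p' then divide_Phi t (gdel F K) p' (z / Phi t F K) else z.

Definition CountIS_run G K t (z : rat) : Prop :=
  exists2 p, peeling (gdel G K) p & z = divide_Phi t G (K :: p) 1.

(* The increment of Z_M for the vertex v; for F^v empty the product is 1. *)
Definition increment_run t F v (z : rat) : Prop :=
  let Fv := gdel F (v |: nbr F v) in
  exists2 zc : {set T} -> rat,
    forall C, C \in components Fv ->
      exists u, [/\ u \in nbr F v, nbr F u :&: C != set0 &
                    CountIS_run (induced Fv C) (nbr F u :&: C) t (zc C)]
  & z = \prod_(C in components Fv) zc C.

Inductive while_run t : graph T -> rat -> rat -> Prop :=
| while_stop F z : vset F = set0 -> while_run t F z z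
| while_step F v z a y :
    v \in vset F -> gconnected (gdel F [set v]) ->
    increment_run t F v a -> while_run t (gdel F [set v]) (z + a) y ->
    while_run t F z y.

End Graphs.

Section IntersectionGraph.
Variable H : hypergraph.

Definition meet_adj (e f : {set vertex H}) : bool := (e != f) && (e :&: f != set0).

Lemma meet_adj_sym : symmetric meet_adj.
Proof. by move=> e f; rewrite /meet_adj eq_sym finset.setIC. Qed.

Lemma meet_adj_irr : irreflexive meet_adj.
Proof. by move=> e; rewrite /meet_adj eqxx. Qed.

Definition intersection_graph : graph {set vertex H} :=
  Graph (edges H) meet_adj_sym meet_adj_irr.

(* The values over the components of L(H) are multiplied; if H is connected and has
   an edge there is a single component, L(H) itself. *)
Definition CountMatchings_run (t : nat) (y : rat) : Prop :=
  let L := intersection_graph in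
  exists2 yc : {set {set vertex H}} -> rat,
    forall C, C \in components L -> while_run t (induced L C) 1 (yc C)
  & y = \prod_(C in components L) yc C.

End IntersectionGraph.

(* ops counts elementary steps, an arithmetic operation on rationals being one
   step; bitops charges an arithmetic operation quadratically in the binary
   length of its operands and a comparison of labels linearly.

   All the functions below are written in the following discipline: the only
   free operations are constructors, pattern matching on constructors
   (including 0 and .+1) and branching on a computed boolean; every function
   call, recursive or not, passes through step or one of the two charged
   primitives lab_eq and arith. *)
Record costed (A : Type) := Costed { result : A; ops : nat; bitops : nat }.

Definition ret A (a : A) : costed A := Costed a 0 0.

Definition bind A B (m : costed A) (k : A -> costed B) : costed B :=
  let r := k (result m) in
  Costed (result r) (ops m + ops r) (bitops m + bitops r).

Definition step A (m : costed A) : costed A :=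
  Costed (result m) (ops m).+1 (bitops m).+1.

Notation "'let*' x ':=' m 'in' k" := (bind m (fun x => k))
  (at level 200, x name, m at level 100, k at level 200, right associativity).

Definition bitlen (m : nat) : nat := (trunc_log 2 m).+1.

Definition rat_bitlen (x : rat) : nat :=
  (bitlen `|numq x|%N + bitlen `|denq x|%N)%N.

Definition lab_eq (a b : nat) : costed bool := Costed (a == b) 1 (bitlen a + bitlen b).

Definition arith (op : rat -> rat -> rat) (x y : rat) : costed rat :=
  Costed (op x y) 1 ((rat_bitlen x + rat_bitlen y) ^ 2).

Definition radd : rat -> rat -> costed rat := arith +%R.
Definition rmul : rat -> rat -> costed rat := arith *%R.
Definition rdiv : rat -> rat -> costed rat := arith (fun x y => x / y).

Fixpoint lengthM A (s : seq A) : costed nat := step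
  match s with
  | [::] => ret 0%N
  | _ :: s' => let* n := lengthM s' in ret n.+1
  end.

Fixpoint appendM A (s1 s2 : seq A) : costed (seq A) := step
  match s1 with
  | [::] => ret s2
  | a :: s1' => let* s := appendM s1' s2 in ret (a :: s)
  end.

Fixpoint filterM A (p : A -> costed bool) (s : seq A) : costed (seq A) := step
  match s with
  | [::] => ret [::]
  | a :: s' =>
    let* b := p a in
    let* r := filterM p s' in
    ret (if b then a :: r else r)
  end.

Fixpoint findM A (p : A -> costed bool) (s : seq A) : costed (option A) := step
  match s with
  | [::] => ret None
  | a :: s' => let* b := p a in if b then ret (Some a) else findM p s'
  end.

Definition existsM A (p : A -> costed bool) (s : seq A) : costed bool := step
  (let* o := findM p s in ret (if o is Some _ then true else false)).

Definition notM A (p : A -> costed bool) (a : A) : costed bool := step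
  (let* b := p a in ret (~~ b)).

Definition andM A (p q : A -> costed bool) (a : A) : costed bool := step
  (let* b := p a in if b then q a else ret false).

Fixpoint foldM A (op : rat -> rat -> costed rat) (z : rat) (f : A -> costed rat)
    (s : seq A) : costed rat := step
  match s with
  | [::] => ret z
  | a :: s' => let* x := f a in let* y := foldM op z f s' in op x y
  end.

Definition sumM A : (A -> costed rat) -> seq A -> costed rat := foldM radd 0.
Definition prodM A : (A -> costed rat) -> seq A -> costed rat := foldM rmul 1.

(* An edge of H is the list of the labels of its vertices. A graph is the list of
   its vertices, which are edges of H, adjacency being decided from the labels. *)
Definition hedge := seq nat.

Fixpoint same (e f : hedge) : costed bool := step
  match e, f with
  | [::], [::] => ret true
  | a :: e', b :: f' => let* c := lab_eq a b in if c then same e' f' else ret false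
  | _, _ => ret false
  end.

Definition meets (e f : hedge) : costed bool := step
  (existsM (fun a => existsM (lab_eq a) f) e).

Definition adjacent (e : hedge) : hedge -> costed bool :=
  andM (notM (same e)) (meets e).

Definition nbrsM (F : seq hedge) (v : hedge) : costed (seq hedge) := step
  (filterM (adjacent v) F).

Definition minusM (F K : seq hedge) : costed (seq hedge) := step
  (filterM (notM (fun v => existsM (same v) K)) F).

Fixpoint PhiM (t : nat) (G K : seq hedge) : costed rat := step
  match t, K with
  | (r.+1 as s).+1, _ :: _ =>
    let* G1 := minusM G K in
    let* S := sumM (fun v =>
      let* Kv := nbrsM G1 v in
      let* G2 := minusM G1 Kv in
      let* U := filterM (andM (notM (same v)) (notM (adjacent v))) K in
      let* I := sumM (fun u => let* Kuv := nbrsM G2 u in PhiM r G2 Kuv) U in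
      let* h := rdiv I 2%:R in
      let* w := radd 1 h in
      let* x := PhiM s G1 Kv in
      rmul x w) K in
    let* d := radd 1 S in
    rdiv 1 d
  | _, _ => ret 1
  end.

(* In the functions below the first argument bounds the number of iterations of
   a while loop; the bound passed is the number of vertices still present, and
   each iteration removes at least one of them. *)

Fixpoint peelM (m : nat) (U R : seq hedge) : costed (seq (seq hedge)) := step
  match m, R with
  | m'.+1, _ :: _ =>
    let* o := findM (fun v => existsM (adjacent v) R) U in
    match o with
    | Some v =>
      let* K := nbrsM R v in
      let* R' := minusM R K in
      let* U' := appendM U K in
      let* p := peelM m' U' R' in
      ret (K :: p)
    | None => ret [::]
    end
  | _, _ => ret [::]
  end.

Fixpoint divide_PhiM (t : nat) (F : seq hedge) (p : seq (seq hedge)) (z : rat) :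
    costed rat := step
  match p with
  | [::] => ret z
  | K :: p' =>
    let* x := PhiM t F K in
    let* z' := rdiv z x in
    let* F' := minusM F K in
    divide_PhiM t F' p' z'
  end.

Definition CountIS (G K : seq hedge) (t : nat) : costed rat := step
  (let* R := minusM G K in
   let* m := lengthM R in
   let* p := peelM m K R in
   divide_PhiM t G (K :: p) 1).

(* Moves from R to S the vertices that can be reached from S. *)
Fixpoint growM (m : nat) (S R : seq hedge) : costed (seq hedge * seq hedge) := step
  match m with
  | 0%N => ret (S, R)
  | m'.+1 =>
    let* N := filterM (fun u => existsM (adjacent u) S) R in
    match N with
    | [::] => ret (S, R)
    | _ :: _ =>
      let* S' := appendM S N in
      let* R' := minusM R N in
      growM m' S' R'
    end
  end.

Definition connectedM (F : seq hedge) : costed bool := step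
  match F with
  | [::] => ret true
  | v :: R =>
    let* m := lengthM R in
    let* c := growM m [:: v] R in
    ret (if c.2 is [::] then true else false)
  end.

Fixpoint splitM (m : nat) (F : seq hedge) : costed (seq (seq hedge)) := step
  match m, F with
  | m'.+1, v :: R =>
    let* c := growM m' [:: v] R in
    let* s := splitM m' c.2 in
    ret (c.1 :: s)
  | _, _ => ret [::]
  end.

Definition componentsM (F : seq hedge) : costed (seq (seq hedge)) := step
  (let* m := lengthM F in splitM m F).

Definition incrementM (t : nat) (F : seq hedge) (v : hedge) : costed rat := step
  (let* N := nbrsM F v in
   let* Fv := minusM F (v :: N) in
   let* cs := componentsM Fv in
   prodM (fun C =>
     let* o := findM (fun u => existsM (adjacent u) C) N in
     match o with
     | Some u => let* K := nbrsM C u in CountIS C K t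
     | None => ret 1
     end) cs).

Fixpoint whileM (m t : nat) (F : seq hedge) (z : rat) : costed rat := step
  match m, F with
  | m'.+1, _ :: _ =>
    let* o := findM (fun v => let* F' := minusM F [:: v] in connectedM F') F in
    match o with
    | Some v =>
      let* a := incrementM t F v in
      let* z' := radd z a in
      let* F' := minusM F [:: v] in
      whileM m' t F' z'
    | None => ret z
    end
  | _, _ => ret z
  end.

Definition CountMatchings (x : seq hedge) (t : nat) : costed rat := step
  (let* cs := componentsM x in
   prodM (fun C => let* m := lengthM C in whileM m t C 1) cs).

(* x lists the edges of H in some order, each edge being given by the labels of
   its vertices in some order. *)
Definition encodes (x : seq hedge) (H : hypergraph) : Prop :=
  exists (lab : vertex H -> nat) (L : seq (seq (vertex H))),
    [/\ injective lab, x = map (map lab) L, all uniq L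
      & perm_eq [seq [set v in l] | l <- L] (enum (edges H))].

Definition input_size (x : seq hedge) : nat :=
  (\sum_(e <- x) (1 + \sum_(v <- e) (1 + bitlen v)))%N.

(* A is an FPTAS for f, where f is evaluated at the object i that the input x
   encodes. The running time is measured in bit operations. *)
Definition is_fptas (R : realType) (X I : Type) (enc : X -> I -> Prop)
    (size_of : X -> nat) (f : I -> nat) (A : R -> X -> costed rat) : Prop :=
  exists (c : R) (d : nat), forall (eps : R) (x : X) (i : I),
    0 < eps -> enc x i ->
      `|ratr (result (A eps x)) - (f i)%:R| <= eps * (f i)%:R
      /\ (bitops (A eps x))%:R <= c * (1 + (size_of x)%:R + eps^-1) ^+ d.

Definition is_fptas_for_M (R : realType) (k r : nat)
    (A : R -> seq hedge -> costed rat) : Prop :=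
  is_fptas (fun x H => kr_graph k r H /\ encodes x H) input_size Z_M A.

Definition log_base (R : realType) (b x : R) : R := ln x / ln b.

Definition depth (R : realType) (n : nat) (eps : R) : nat :=
  (2 * `|Num.ceil (log_base (50%:R / 49%:R) (18%:R * n%:R / eps))|)%N.

(* A precision eps > 1 is replaced by 1. With eps itself the guarantee would fail:
   for eps just below 18n the depth is 2, and if L(H) is a long path the returned
   value exceeds (1 + eps) Z_M. *)
Definition run_depth (R : realType) (n : nat) (eps : R) : nat :=
  depth n (Num.min eps 1).

(* Main.v *)
(** Matchings of H are independent sets of G = L(H). For a simplicial block K of an
    induced subgraph X, let P_X(K) = Z(X - K) / Z(X) be the probability that a uniform
    independent set of X avoids K. An independent set meets K in nothing, in one vertex or
    in two non-adjacent ones, so 1 / P_X(K) obeys the recurrence that defines Phi, with P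
    in place of Phi; and all blocks in that recurrence are simplicial again, because one of
    the three cliques that cover the neighbourhood of a vertex disappears when a neighbour
    loses all its other neighbours. Since |K| <= 4 and every vertex of K has at most two
    non-neighbours in K, one step of the recurrence turns a factor 1 + m between the values
    of x / (2 - x) at the arguments into a factor at most 1 + 49/50 m at the results (a
    polynomial inequality). An argument is one or two levels deeper, whence the error
    8 (49/50)^k at depth 2k + 2, and the counts follow by telescoping Z along a peeling and
    along the removal of vertices.

    The recursion tree for Phi has at most 4 children one level deeper and 8 two levels
    deeper, and 4 * 6 + 8 < 6^2, so a call at depth t costs O(n 6^t); the remaining powers
    of n are absorbed in 12^t because n <= (50/49)^(t/2). Numerators and denominators have binary
    length linear in the number of operations, which bounds the bit cost. *)

Require Import Defs.
From HB Require Import structures.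
From mathcomp Require Import all_boot all_order all_algebra.
From mathcomp Require Import reals exp.
From mathcomp Require Import ring lra zify.

Set Implicit Arguments.
Unset Strict Implicit.
Unset Printing Implicit Defensive.

Import Order.TTheory GRing.Theory Num.Theory.
Local Open Scope ring_scope.

(** * Blocks *)

(** Why [x / (2 - x)]: for [x = 1 / (1 + S)] it equals [1 / (1 + 2 * S)], so agreement up to [1 + m]
    becomes the linear condition [S - S' <= m * (1 / 2 + S')] on the sums. This splits over the at
    most four vertices of a block, each receiving [1 / 8] of the constant [1 / 2]; and as
    [f * (1 + (a + b) / 2)] is the mean of [f * (1 + a)] and [f * (1 + b)], the two non-neighbours
    of a vertex are treated one at a time. What remains is an inequality between two pairs of
    values, [branch_contraction]. The initial error [8] combines the crude bounds [S <= 8] and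
    [S <= 18 * S'].

    The algorithm leaves choices open, so its runs form a relation. Accuracy is proved for every
    run; the program is shown to produce one of them, which needs that its searches never fail: an
    edge leaves every proper nonempty part of a connected graph, and some vertex can be removed
    without disconnecting it. *)

Section Blocks.
Variables (T : finType) (L : graph T).
Implicit Types (X Y K Q A : {set T}) (u v w : T).

(** Every graph in a run is an induced subgraph of one fixed graph [L] and is named by its vertex
    set alone. [X] is not intersected with [vset L], so that successive deletions are plain set
    differences. *)
Definition subgraph X : graph T := Graph X (@gadj_sym T L) (@gadj_irr T L).

Lemma gdel_subgraph X K : gdel (subgraph X) K = subgraph (X :\: K).
Proof. by rewrite /gdel /induced /subgraph setDE. Qed.

Lemma induced_subgraph X K : K \subset X -> induced (subgraph X) K = subgraph K.
Proof. by move=> /setIidPr KX; rewrite /induced /subgraph /= KX. Qed.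

Lemma in_nbr X v u : (u \in nbr (subgraph X) v) = (u \in X) && gadj L v u.
Proof. by rewrite inE. Qed.

Lemma nbr_subgraphI X Y v : nbr (subgraph X) v :&: Y = nbr (subgraph (X :&: Y)) v.
Proof. by apply/setP=> u; rewrite !inE andbAC. Qed.

Lemma nbr_subgraphD X Y v : nbr (subgraph X) v :\: Y = nbr (subgraph (X :\: Y)) v.
Proof. by rewrite !setDE nbr_subgraphI. Qed.

Lemma gadjC u v : gadj L u v = gadj L v u.
Proof. exact: gadj_sym. Qed.

Lemma independentP X A :
  reflect (A \subset X /\ {in A &, forall u v, ~~ gadj L u v})
          (independent (subgraph X) A).
Proof.
apply: (iffP andP) => -[AX indA]; split=> //.
  by move=> u v uA vA; move/forall_inP: indA => /(_ u uA) /forall_inP /(_ v vA).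
by apply/forall_inP=> u uA; apply/forall_inP=> v vA; apply: indA.
Qed.

(** The part of [block] that depends on [K] only; the surrounding graph enters just through
    [K \subset X]. *)
Definition block_set K : bool :=
  [&& (alpha (subgraph K) <= 2)%N, (#|K| <= 4)%N
    & (#|K| == 4%N) ==> (1 <= min_degree (subgraph K))%N].

Lemma block_subgraph X K : block (subgraph X) K = (K \subset X) && block_set K.
Proof.
rewrite /block /=; case KX: (K \subset X) => //=.
by rewrite (induced_subgraph KX).
Qed.

Lemma simplicial_subgraph X K :
  simplicial_block (subgraph X) K =
  [&& K \subset X, block_set K & [forall v in K, block_set (nbr (subgraph X) v :\: K)]].
Proof.
rewrite /simplicial_block block_subgraph -andbA; congr [&& _, _ & _].
apply: eq_forallb_in => v vK; rewrite gdel_subgraph block_subgraph andb_idl // => _.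
by rewrite nbr_subgraphD; apply/subsetP=> u; rewrite in_nbr => /andP[].
Qed.

Lemma bigmin_le_seq (I : eqType) (r : seq I) (P : pred I) (F : I -> nat) m i :
  i \in r -> P i -> (\big[minn/m]_(j <- r | P j) F j <= F i)%N.
Proof.
elim: r => // a r IH; rewrite inE big_cons => /predU1P[<- ->|/IH{}IH Pi].
  exact: geq_minl.
by case: ifP => _; [rewrite geq_min IH ?orbT | exact: IH].
Qed.

Lemma block_set_alpha K A : block_set K -> A \subset K ->
  {in A &, forall u v, ~~ gadj L u v} -> (#|A| <= 2)%N.
Proof.
case/and3P=> alK _ _ AK indA; apply: leq_trans alK.
rewrite /alpha (bigD1 A) ?leq_maxl //.
exact/independentP.
Qed.

(** If [K] has at most three vertices, at most two differ from [v]; if it has four, the degree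
    condition makes one of the other three a neighbour of [v]. Hence the inner sum of the recurrence
    has at most two terms. *)
Lemma block_set_non_nbr K v : block_set K -> v \in K ->
  (#|[set u in K | (u != v) && ~~ gadj L v u]| <= 2)%N.
Proof.
move=> /and3P[_ K4 Kd] vK; set U := [set u in K | _].
have UKv : U \subset K :\ v.
  by apply/subsetP=> u; rewrite !inE => /and3P[-> -> _].
have := subset_leq_card UKv; have := cardsD1 v K; rewrite vK /= => cK.
case: (ltnP #|K| 4) => [|K4']; first by rewrite cK; lia.
have cK4 : #|K| = 4%N by lia.
move: Kd; rewrite cK4 eqxx /= => Kd.
have : (1 <= #|nbr (subgraph K) v|)%N.
  by apply: leq_trans Kd _; apply: bigmin_le_seq; rewrite ?mem_index_enum.
case/card_gt0P=> u; rewrite in_nbr => /andP[uK uv] _.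
have : U \proper K :\ v.
  apply/properP; split=> //; exists u; rewrite !inE ?uK ?uv ?andbF //=.
  by rewrite andbT; apply: contraTneq uv => ->; rewrite gadj_irr.
by move/proper_card; lia.
Qed.

(** A subset with four elements is all of [K], so the degree condition never has to pass to a proper
    subset. *)
Lemma block_set_sub K K' : K' \subset K -> block_set K -> block_set K'.
Proof.
move=> K'K /and3P[alK K4 Kd]; apply/and3P; split.
- apply: leq_trans alK; apply/bigmax_leqP => A /independentP[AK' indA].
  rewrite /alpha (bigD1 A) ?leq_maxl //.
  by apply/independentP; split=> //; apply: subset_trans AK' K'K.
- exact: leq_trans (subset_leq_card K'K) K4.
apply/implyP=> /eqP K'4; suff -> : K' = K by move: Kd; rewrite -(eqP (_ : #|K|
    == 4%N)) ?eqxx //; rewrite eqn_leq K4 -K'4 subset_leq_card.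
by apply/eqP; rewrite eqEcard K'K K'4.
Qed.

Definition small_clique Q : Prop :=
  (#|Q| <= 2)%N /\ {in Q &, forall u v, u != v -> gadj L u v}.

(** An independent set takes at most one vertex from each clique. If [K] has four vertices, the
    cliques are disjoint pairs exhausting [K], and each vertex has its partner as a neighbour. *)
Lemma block_set_two_cliques K Q1 Q2 :
  small_clique Q1 -> small_clique Q2 -> K \subset Q1 :|: Q2 -> block_set K.
Proof.
move=> [c1 cl1] [c2 cl2] KQ.
have K4 := subset_leq_card KQ; have cU := cardsU Q1 Q2.
have indQ Q A : {in Q &, forall u v, u != v -> gadj L u v} ->
    {in A &, forall u v, ~~ gadj L u v} -> (#|A :&: Q| <= 1)%N.
  move=> clQ indA; apply/card_le1_eqP => u v; rewrite !inE => /andP[uA uQ] /andP[vA vQ].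
  by apply/eqP; apply: contraNT (indA v u vA uA) => /clQ-> //.
apply/and3P; split.
- apply/bigmax_leqP => A /independentP[AK indA].
  have -> : A = (A :&: Q1) :|: (A :&: Q2).
    by rewrite -setIUr; apply/esym/setIidPl; apply: subset_trans AK KQ.
  by rewrite cardsU; have := indQ _ _ cl1 indA; have := indQ _ _ cl2 indA; lia.
- by lia.
apply/implyP=> /eqP cK.
have KE : K = Q1 :|: Q2 by apply/eqP; rewrite eqEcard KQ; lia.
have nbr1 v : v \in K -> (1 <= #|nbr (subgraph K) v|)%N.
  have aux Q : #|Q| = 2%N -> {in Q &, forall u v, u != v -> gadj L u v} -> Q \subset K ->
      v \in Q -> (1 <= #|nbr (subgraph K) v|)%N.
    move=> /eqP/cards2P[x [y [xy ->]]] cl QK vQ; apply/card_gt0P.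
    move: vQ; rewrite !inE => /orP[]/eqP->; [exists y|exists x].
      by rewrite in_nbr (subsetP QK) ?cl // !inE eqxx ?orbT.
    by rewrite in_nbr (subsetP QK) ?cl // 1?eq_sym // !inE eqxx ?orbT.
  rewrite {1}KE inE => /orP[]; apply: aux => //; try lia; rewrite KE;
    [exact: subsetUl | exact: subsetUr].
(* The default value [#|T|] of the minimum is positive too, since [T] contains the four vertices of
   [K]. *)
rewrite /min_degree; elim/big_ind: _ => [|x y|v /nbr1 //].
  by apply: leq_trans (max_card (mem K)); rewrite cK.
by rewrite leq_min => -> ->.
Qed.

(* In L(H), the neighbours of w = {p, q, r} that share p with v are adjacent to v;
   Q1 and Q2 are the other edges through q and through r. *)
Definition locally_two_cliques : Prop :=
  forall w v, w \in vset L -> v \in nbr L w ->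
  exists Q1 Q2, [/\ small_clique Q1, small_clique Q2
                  & nbr L w \subset (v |: nbr L v) :|: (Q1 :|: Q2)].

Hypothesis L2 : locally_two_cliques.

(* v lies in one of the three cliques covering the neighbourhood of w, and the rest of
   that clique is adjacent to v, hence outside X: only two cliques remain. *)
Lemma link_block v w X : X \subset vset L -> v \in vset L -> w \in vset L -> gadj L v w ->
  v \notin X -> nbr (subgraph X) v = set0 -> block_set (nbr (subgraph X) w).
Proof.
move=> XV vV wV vw vX nv0.
have vNw : v \in nbr L w by rewrite inE vV gadjC.
have [Q1 [Q2 [sQ1 sQ2 sub]]] := L2 wV vNw.
apply: (block_set_two_cliques sQ1 sQ2); apply/subsetP=> u; rewrite in_nbr => /andP[uX wu].
have := subsetP sub u; rewrite !inE (subsetP XV _ uX) wu /= => /(_ isT).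
case: eqP => [uv|_] /=; first by rewrite -uv uX in vX.
case vu: (gadj L v u) => //=.
by have := in_nbr X v u; rewrite nv0 inE uX vu.
Qed.

(** Deleting [Y] strips [v] of all its neighbours in [X], so [link_block] applies to every [u] in
    [Y]: for the neighbourhood of an outside vertex, being a block is enough to be simplicial. *)
Lemma link_simplicial v Y X : X \subset vset L -> v \in vset L ->
  v \notin X -> Y = nbr (subgraph X) v -> block_set Y ->
  simplicial_block (subgraph X) Y.
Proof.
move=> XV vV vX YE bY; rewrite simplicial_subgraph bY; apply/and3P; split=> //.
  by apply/subsetP=> u; rewrite YE in_nbr => /andP[].
apply/forall_inP=> u; rewrite YE in_nbr => /andP[uX vu].
rewrite nbr_subgraphD -YE; apply: (@link_block v) => //.
- by apply: subset_trans XV; apply: subsetDl.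
- exact: (subsetP XV).
- by rewrite inE (negPf vX) andbF.
by rewrite -nbr_subgraphD YE setDv.
Qed.

Lemma simplicial_nbr X K v : X \subset vset L -> simplicial_block (subgraph X) K ->
  v \in K -> simplicial_block (subgraph (X :\: K)) (nbr (subgraph X) v :\: K).
Proof.
move=> XV; rewrite simplicial_subgraph => /and3P[KX bK /forall_inP bn] vK.
apply: (@link_simplicial v).
- by apply: subset_trans XV; apply: subsetDl.
- exact: (subsetP XV _ (subsetP KX _ vK)).
- by rewrite inE vK.
- by rewrite nbr_subgraphD.
exact: bn.
Qed.

(** Here [u] is the outside vertex; what is left of its neighbourhood is a subset of the block
    [nbr (subgraph X) u :\: K]. *)
Lemma simplicial_nbr2 X K v u : X \subset vset L -> simplicial_block (subgraph X) K ->
  v \in K -> u \in K ->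
  simplicial_block (subgraph (X :\: K :\: (nbr (subgraph X) v :\: K)))
    (nbr (subgraph X) u :\: (nbr (subgraph X) v :|: K)).
Proof.
move=> XV; rewrite simplicial_subgraph => /and3P[KX bK /forall_inP bn] vK uK.
apply: (@link_simplicial u).
- by rewrite setDDl; apply: subset_trans XV; apply: subsetDl.
- exact: (subsetP XV _ (subsetP KX _ uK)).
- by rewrite !inE uK andbF.
- apply/setP=> x; rewrite !inE /=.
  by case: (x \in X); case: (x \in K); case: (gadj L u x); case: (gadj L v x).
apply: block_set_sub (bn _ uK).
by apply: setDS; apply: subsetUr.
Qed.

End Blocks.

(** * Contraction of the recurrence *)

Section Contraction.
Variable R : realFieldType.
Implicit Types a b c d w v m : R.

(** The coefficient of [t] in the difference of the two sides of [branch_poly]. The square absorbs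
    part of the negative term; the remaining cofactor of [w] has negative discriminant and is
    minimal at [335 / 456]. *)
Lemma branch_poly1 w v : 0 <= w -> 0 <= v ->
  0 <= 49 * (1 + v) ^+ 2 + 82 * w + 50 * w * v ^+ 2 + 833 * w ^+ 2
       + 1634 * w ^+ 2 * v + 2401 * w ^+ 2 * v ^+ 2 - 1468 * w * v :> R.
Proof.
move=> w0 v0.
have -> : 49 * (1 + v) ^+ 2 + 82 * w + 50 * w * v ^+ 2 + 833 * w ^+ 2
       + 1634 * w ^+ 2 * v + 2401 * w ^+ 2 * v ^+ 2 - 1468 * w * v
  = (7 * (1 + v) - (28 + 29 * v) * w) ^+ 2 + w * (474 - 670 * v + 456 * v ^+ 2)
    + w ^+ 2 * (49 + 10 * v + 1560 * v ^+ 2) by ring.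
have sq := sqr_ge0 (v - 335 / 456).
rewrite !addr_ge0 ?sqr_ge0 ?mulr_ge0 ?sqr_ge0 //; nra.
Qed.

(** The coefficient of [50 * t ^ 2] in the same difference. After two squares are split off, the
    cofactor of [w] is minimal at [1619 / 5610], and [v <= 1] keeps [1535 - 1089 * v] positive. *)
Lemma branch_poly2 w v : 0 <= w -> 0 <= v -> v <= 1 ->
  0 <= 49 * v + 49 * v ^+ 2 + 49 * w + 99 * w * v ^+ 2 + 833 * w ^+ 2
       + 2467 * w ^+ 2 * v + 4802 * w ^+ 2 * v ^+ 2 - 1420 * w * v :> R.
Proof.
move=> w0 v0 v1.
have -> : 49 * v + 49 * v ^+ 2 + 49 * w + 99 * w * v ^+ 2 + 833 * w ^+ 2
       + 2467 * w ^+ 2 * v + 4802 * w ^+ 2 * v ^+ 2 - 1420 * w * v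
  = (7 * v - 144 / 5 * w) ^+ 2 + v * (7 - (99 / 2 + 33 * v) * w) ^+ 2
    + w * (49 - 1619 / 5 * v + 561 * v ^+ 2)
    + w ^+ 2 * (89 / 25 + 67 / 4 * v + v ^+ 2 * (1535 - 1089 * v)) by field.
have sq := sqr_ge0 (v - 1619 / 5610).
have e1 : 0 <= 49 - 1619 / 5 * v + 561 * v ^+ 2.
  have -> : 49 - 1619 / 5 * v + 561 * v ^+ 2 =
    561 * (v - 1619 / 5610) ^+ 2 + (49 - 1619 / 5 * (1619 / 5) / 2244) by field.
  by lra.
have e2 : 0 <= v ^+ 2 * (1535 - 1089 * v) by rewrite mulr_ge0 ?sqr_ge0 //; lra.
have e3 : 0 <= 89 / 25 + 67 / 4 * v + v ^+ 2 * (1535 - 1089 * v) by lra.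
by rewrite !addr_ge0 ?sqr_ge0 // mulr_ge0 ?sqr_ge0.
Qed.

(* Here w and v are the images of b and d under x |-> x / (2 - x), and 1 + 50 t is the
   factor by which they are raised. *)
Lemma branch_poly w v t : 0 <= w -> 0 <= v -> v <= 1 -> 0 <= t ->
  16 * (1 + 50 * t) * w * (1 + 3 * (1 + 50 * t) * v) * ((1 + w) * (1 + v)) <=
  (49 * t * ((1 + w) * (1 + v)) + (1 + 49 * t) * (16 * w * (1 + 3 * v)))
    * ((1 + (1 + 50 * t) * w) * (1 + (1 + 50 * t) * v)).
Proof.
move=> w0 v0 v1 t0; rewrite -subr_ge0.
have p1 := branch_poly1 w0 v0; have p2 := branch_poly2 w0 v0 v1.
have p3 : 0 <= w * v * (49 + 49 * v + 833 * w + 2401 * w * v).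
  by rewrite !mulr_ge0 ?addr_ge0 ?mulr_ge0.
have t50 : 0 <= 50 * t by lra.
have := mulr_ge0 t0 (addr_ge0 (addr_ge0 p1 (mulr_ge0 t50 p2)) (mulr_ge0 (sqr_ge0 (50 * t)) p3)).
by congr (_ <= _); ring.
Qed.

(** The hypotheses bound [a] and [c] by the values [A] and [C] whose images under [x / (2 - x)] are
    [1 + m] times those of [b] and [d]. Since [x * (1 + y)] is monotone, it suffices to treat [A]
    and [C], and clearing denominators leaves [branch_poly] with [m = 50 * t]. *)
Lemma branch_contraction a b c d m : 0 <= m ->
  0 <= a <= 1 -> 0 <= b <= 1 -> 0 <= c <= 1 -> 0 <= d <= 1 ->
  a * (2 - b) <= (1 + m) * b * (2 - a) -> c * (2 - d) <= (1 + m) * d * (2 - c) ->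
  a * (1 + c) - b * (1 + d) <= 49 / 50 * m * (1 / 8 + b * (1 + d)).
Proof.
move=> m0 /andP[a0 a1] /andP[b0 b1] /andP[c0 c1] /andP[d0 d1] ab cd.
have wP (x : R) : 0 <= x -> x <= 1 -> [/\ 0 <= x / (2 - x), x / (2 - x) <= 1 &
    x = 2 * (x / (2 - x)) / (1 + x / (2 - x))].
  move=> x0 x1; have x2 : 0 < 2 - x by lra.
  split; [by rewrite divr_ge0 // ltW | by rewrite ler_pdivrMr //; lra | by field; lra].
have [w0 w1 bE] := wP b b0 b1; have [v0 v1 dE] := wP d d0 d1.
have t0 : 0 <= m / 50 by rewrite divr_ge0.
have := branch_poly w0 v0 v1 t0.
have -> : 50 * (m / 50) = m by field.
move: (b / (2 - b)) (d / (2 - d)) w0 w1 bE v0 v1 dE => w v w0 w1 bE v0 v1 dE bp.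
have raise (x y z : R) : 0 <= x -> x <= 1 -> 0 <= z -> z <= 1 -> y = 2 * z / (1 + z) ->
    x * (2 - y) <= (1 + m) * y * (2 - x) -> x <= 2 * ((1 + m) * z) / (1 + (1 + m) * z).
  move=> x0 x1 z0 z1 -> xy; have mz : 0 <= m * z by rewrite mulr_ge0.
  rewrite ler_pdivlMr; last by nra.
  have z1' : 0 < 1 + z by lra.
  move: xy; have -> : x * (2 - 2 * z / (1 + z)) = 2 * x / (1 + z) by field; lra.
  have -> : (1 + m) * (2 * z / (1 + z)) * (2 - x) = 2 * (1 + m) * z * (2 - x) / (1 + z).
    by field; lra.
  by rewrite ler_pM2r ?invr_gt0 //; nra.
have aB := raise _ _ _ a0 a1 w0 w1 bE ab; have cB := raise _ _ _ c0 c1 v0 v1 dE cd.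
have mw : 0 <= m * w by rewrite mulr_ge0.
have mv : 0 <= m * v by rewrite mulr_ge0.
set A := 2 * ((1 + m) * w) / _ in aB; set C := 2 * ((1 + m) * v) / _ in cB.
have le1 : a * (1 + c) <= A * (1 + C) by apply: ler_pM => //; lra.
suff : A * (1 + C) <= 49 / 50 * m / 8 + (1 + 49 / 50 * m) * (b * (1 + d)) by lra.
have -> : A * (1 + C) = 2 * (1 + m) * w * (1 + 3 * (1 + m) * v) / ((1 + (1 + m) * w) * (1 + (1 +
    m) * v)).
  rewrite /A /C; field; apply/andP; split; nra.
rewrite ler_pdivrMr; last by rewrite mulr_gt0 //; nra.
have -> : 49 / 50 * m / 8 + (1 + 49 / 50 * m) * (b * (1 + d)) =
  (49 / 50 * m / 8 * ((1 + w) * (1 + v)) + (1 + 49 / 50 * m) * (2 * w * (1 + 3 * v))) / ((1 + w)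
      * (1 + v)).
  rewrite bE dE; field; apply/andP; split; lra.
rewrite [leRHS]mulrAC ler_pdivlMr ?mulr_gt0 //; lra.
Qed.
End Contraction.

(** * One step of the recurrence, as a function of the values it receives *)

Section Avoid.
Variables (R : realFieldType) (T : finType) (L : graph T).
Implicit Types (X Y K A B : {set T}) (u v w : T) (f : T -> R) (g : T -> T -> R).
Local Notation subgraph := (subgraph L).
Local Notation block_set := (block_set L).

Definition branch K f g v : R :=
  f v * (1 + 2%:R^-1 * \sum_(u in K | (u != v) && ~~ gadj L v u) g v u).

(** The recursive values are abstracted into [f] (one level deeper) and [g] (two levels deeper), so
    that the exact probabilities and [Phi] are two instances of the same step and can be
    compared. *)
Definition avoid K f g : R := (1 + \sum_(v in K) branch K f g v)^-1.

Definition unit_valued K f g : Prop :=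
  (forall v, v \in K -> 0 <= f v <= 1) /\
  (forall u v, u \in K -> v \in K -> 0 <= g v u <= 1).

(* The values of x / (2 - x) at a and b differ by a factor at most 1 + m. In these
   coordinates the recurrence contracts; it does not for |a - b| or for ratios a / b. *)
Definition odds_close (m a b : R) : Prop :=
  a * (2 - b) <= (1 + m) * b * (2 - a) /\ b * (2 - a) <= (1 + m) * a * (2 - b).

Lemma card_le2P (A : {set T}) : (#|A| <= 2)%N ->
  [\/ A = set0, exists x, A = [set x] | exists x y, x != y /\ A = [set x; y]].
Proof.
move cA : #|A| => [|[|[|//]]] _.
- by constructor 1; apply: cards0_eq.
- by constructor 2; apply/cards1P; rewrite cA.
constructor 3; have /cards2P[x [y [xy ->]]] : #|A| == 2%N by rewrite cA.
by exists x, y.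
Qed.

Lemma mulrn_le4 (x y : R) n : (n <= 4)%N -> 0 <= x -> x *+ 4 <= y -> x *+ n <= y.
Proof. by move=> n4 x0; apply: le_trans; apply: ler_wpMn2l. Qed.

Lemma branch_bounds K f g v : block_set K -> unit_valued K f g -> v \in K ->
  f v <= branch K f g v <= 2 * f v.
Proof.
move=> bK [f01 g01] vK; have /andP[f0 f1] := f01 v vK.
have [s0 s2] : 0 <= \sum_(u in K | (u != v) && ~~ gadj L v u) g v u /\
    \sum_(u in K | (u != v) && ~~ gadj L v u) g v u <= 2.
  split; first by apply: sumr_ge0 => u /and3P[uK _ _]; case/andP: (g01 u v uK vK).
  apply: le_trans (_ : \sum_(u in K | (u != v) && ~~ gadj L v u) 1 <= _).
    by apply: ler_sum => u /and3P[uK _ _]; case/andP: (g01 u v uK vK).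
  have := block_set_non_nbr bK vK; set U := [set u in K | _] => cU.
  rewrite (eq_bigl (fun u => u \in U)) => [|u]; last by rewrite [in RHS]inE.
  by rewrite sumr_const ler_nat.
rewrite /branch; apply/andP; split.
  by rewrite ler_peMr //; lra.
by rewrite [leRHS]mulrC ler_wpM2l //; lra.
Qed.

Lemma sum_branch_ge0 K f g : block_set K -> unit_valued K f g ->
  0 <= \sum_(v in K) branch K f g v.
Proof.
move=> bK fg; apply: sumr_ge0 => v vK; have /andP[+ _] := branch_bounds bK fg vK.
by apply: le_trans; case: fg => /(_ v vK)/andP[].
Qed.

Lemma sum_branch_le8 K f g : block_set K -> unit_valued K f g ->
  \sum_(v in K) branch K f g v <= 8.
Proof.
move=> bK fg; apply: (@le_trans _ _ (\sum_(v in K) 2)).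
  apply: ler_sum => v vK; have /andP[_] := branch_bounds bK fg vK.
  by move/le_trans; apply; case: fg => /(_ v vK)/andP[_ f1] _; lra.
by rewrite sumr_const; case/and3P: bK => _ K4 _; apply: (mulrn_le4 K4); lra.
Qed.

Lemma avoid_bounds K f g : block_set K -> unit_valued K f g ->
  1 / 9 <= avoid K f g <= 1.
Proof.
move=> bK fg; have := sum_branch_ge0 bK fg; have := sum_branch_le8 bK fg.
rewrite /avoid; move: (\sum_(v in K) _) => S S8 S0; apply/andP; split.
  by rewrite div1r lef_pV2 ?posrE; lra.
by rewrite invf_le1; lra.
Qed.

(** At [1 / (1 + S)] the map [x / (2 - x)] takes the value [1 / (1 + 2 * S)]. Each hypothesis on the
    sums is therefore [1 + 2 * S <= (1 + m) * (1 + 2 * S')], or the same with [S] and [S']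
    exchanged. *)
Lemma odds_close_avoid m K f g f' g' : 0 <= m -> block_set K ->
  unit_valued K f g -> unit_valued K f' g' ->
  \sum_(v in K) branch K f g v - \sum_(v in K) branch K f' g' v <=
    m * (1 / 2 + \sum_(v in K) branch K f' g' v) ->
  \sum_(v in K) branch K f' g' v - \sum_(v in K) branch K f g v <=
    m * (1 / 2 + \sum_(v in K) branch K f g v) ->
  odds_close m (avoid K f g) (avoid K f' g').
Proof.
move=> m0 bK /(sum_branch_ge0 bK) + /(sum_branch_ge0 bK); rewrite /odds_close /avoid.
move: (\sum_(v in K) _) => S; move: (\sum_(v in K) _) => S' S0 S'0 SS' S'S.
have E (x y : R) : 0 <= x -> 0 <= y ->
    (1 + x)^-1 * (2 - (1 + y)^-1) = (1 + 2 * y) / ((1 + x) * (1 + y)).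
  by move=> x0 y0; field; apply/andP; split; lra.
have E' (x y : R) : 0 <= x -> 0 <= y ->
    (1 + m) * (1 + x)^-1 * (2 - (1 + y)^-1) = (1 + m) * (1 + 2 * y) / ((1 + y) * (1 + x)).
  by move=> x0 y0; field; apply/andP; split; lra.
rewrite !E // !E' //; split; rewrite ler_pM2r ?invr_gt0 ?mulr_gt0 //; lra.
Qed.

(** Both sides are affine in the inner values, so the inequality for two non-neighbours is the mean
    of the inequalities for each of them. *)
Lemma branch_average (F F' a b a' b' M : R) :
  F * (1 + a) - F' * (1 + a') <= M * (1 / 8 + F' * (1 + a')) ->
  F * (1 + b) - F' * (1 + b') <= M * (1 / 8 + F' * (1 + b')) ->
  F * (1 + 2%:R^-1 * (a + b)) - F' * (1 + 2%:R^-1 * (a' + b'))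
    <= M * (1 / 8 + F' * (1 + 2%:R^-1 * (a' + b'))).
Proof. lra. Qed.

Lemma branch_close m K f g f' g' v : 0 <= m -> block_set K -> v \in K ->
  unit_valued K f g -> unit_valued K f' g' ->
  odds_close m (f v) (f' v) ->
  (forall u, u \in K -> odds_close m (g v u) (g' v u)) ->
  branch K f g v - branch K f' g' v <= 49 / 50 * m * (1 / 8 + branch K f' g' v).
Proof.
move=> m0 bK vK [f01 g01] [f01' g01'] [fv _] gv.
rewrite /branch; have := block_set_non_nbr bK vK.
set U := [set u in K | _] => cU.
have UE h : \sum_(u in K | (u != v) && ~~ gadj L v u) h u = \sum_(u in U) h u :> R.
  by apply: eq_bigl => u; rewrite inE.
rewrite !UE.
have bc u : u \in U ->
   f v * (1 + g v u) - f' v * (1 + g' v u) <= 49 / 50 * m * (1 / 8 + f' v * (1 + g' v u)).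
  by rewrite inE => /andP[uK _]; apply: branch_contraction => //;
    [exact: f01 | exact: f01' | exact: g01 | exact: g01' | by case: (gv u uK)].
(* The case without non-neighbours: the inner value is [0] on both sides. A single non-neighbour is
   averaged with this case. *)
have bc0 : f v - f' v <= 49 / 50 * m * (1 / 8 + f' v).
  have := @branch_contraction _ (f v) (f' v) 0 0 m m0 (f01 v vK) (f01' v vK).
  by rewrite lexx ler01 => /(_ isT isT fv); lra.
have [UE0|[x UE1]|[x [y [xy UE2]]]] := card_le2P cU.
- by rewrite UE0 !big_set0 !mulr0 addr0 !mulr1.
- have := bc x; rewrite UE1 !big_set1 inE eqxx => /(_ isT) h.
  have := branch_average (a := g v x) (b := 0) (a' := g' v x) (b' := 0) h.
  by rewrite !addr0 !mulr1; apply.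
have := bc x; have := bc y; rewrite UE2 !inE !eqxx orbT => /(_ isT) h /(_ isT) h'.
have sum2 (F : T -> R) : \sum_(u in [set x; y]) F u = F x + F y.
  by rewrite big_setU1 ?inE //= big_set1.
rewrite !sum2; exact: (branch_average h' h).
Qed.

Lemma avoid_contraction m K f g f' g' : 0 <= m -> block_set K ->
  unit_valued K f g -> unit_valued K f' g' ->
  (forall v, v \in K -> odds_close m (f v) (f' v)) ->
  (forall u v, u \in K -> v \in K -> odds_close m (g v u) (g' v u)) ->
  odds_close (49 / 50 * m) (avoid K f g) (avoid K f' g').
Proof.
have half F G F' G' : 0 <= m -> block_set K ->
    unit_valued K F G -> unit_valued K F' G' ->
    (forall v, v \in K -> odds_close m (F v) (F' v)) ->
    (forall u v, u \in K -> v \in K -> odds_close m (G v u) (G' v u)) ->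
    \sum_(v in K) branch K F G v - \sum_(v in K) branch K F' G' v <=
      49 / 50 * m * (1 / 2 + \sum_(v in K) branch K F' G' v).
  move=> m0 bK fg fg' ff gg; rewrite -sumrB.
  apply: (@le_trans _ _ (\sum_(v in K) 49 / 50 * m * (1 / 8 + branch K F' G' v))).
    by apply: ler_sum => v vK; apply: branch_close => //; [exact: ff | move=> u uK; exact: gg].
  have t0 : 0 <= 49 / 50 * m by lra.
  rewrite -mulr_sumr ler_wpM2l // big_split /= lerD2r sumr_const.
  (* At most four copies of [1 / 8] fit into [1 / 2]. *)
  by case/and3P: bK => _ K4 _; apply: (mulrn_le4 K4); lra.
move=> m0 bK fg fg' ff gg; apply: odds_close_avoid => //; first by lra.
  exact: half.
by apply: half => //; [move=> v vK; case: (ff v vK) | move=> u v uK vK; case: (gg u v uK vK)].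
Qed.

(** The base of the induction. Every branch lies between [1 / 9] and [2], so the sums satisfy
    [S <= 18 * S']; the mean of this and [S <= 8] is [S <= 4 + 9 * S'], which is the required bound
    with [m = 8]. *)
Lemma avoid_close9 K f g f' g' : block_set K ->
  unit_valued K f g -> unit_valued K f' g' ->
  (forall v, v \in K -> 1 / 9 <= f v) -> (forall v, v \in K -> 1 / 9 <= f' v) ->
  odds_close 8 (avoid K f g) (avoid K f' g').
Proof.
move=> bK.
have half F G F' G' : unit_valued K F G -> unit_valued K F' G' ->
    (forall v, v \in K -> 1 / 9 <= F' v) ->
    \sum_(v in K) branch K F G v - \sum_(v in K) branch K F' G' v <=
      8 * (1 / 2 + \sum_(v in K) branch K F' G' v).
  move=> fg fg' f9; have le8 := sum_branch_le8 bK fg.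
  suff : \sum_(v in K) branch K F G v <= 18 * \sum_(v in K) branch K F' G' v by lra.
  rewrite mulr_sumr; apply: ler_sum => v vK.
  have /andP[_ h] := branch_bounds bK fg vK; have /andP[h' _] := branch_bounds bK fg' vK.
  by have := f9 v vK; case: fg => /(_ v vK)/andP[_ f1] _; lra.
by move=> fg fg' f9 f9'; apply: odds_close_avoid => //; apply: half.
Qed.

(** Passing from [x] to [x / (2 - x)] only magnifies ratios: if [a > b] then [2 - a < 2 - b], and
    the factor can be cancelled. *)
Lemma odds_close_ratio m a b : 0 <= m -> 0 < a <= 1 -> 0 < b <= 1 -> odds_close m a b ->
  a <= (1 + m) * b /\ b <= (1 + m) * a.
Proof.
move=> m0 /andP[a0 a1] /andP[b0 b1] [ab ba]; split; case: (lerP a b) => h; nra.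
Qed.

End Avoid.

(** * Counting independent sets *)

Section IndependentSets.
Variables (T : finType) (L : graph T).
Implicit Types (X Y K A B : {set T}) (u v w : T).
Local Notation subgraph := (subgraph L).

Definition indep_sets X : {set {set T}} := [set A | independent (subgraph X) A].
Definition nis X : nat := #|indep_sets X|.

Lemma indep_setsP X A :
  reflect (A \subset X /\ {in A &, forall u v, ~~ gadj L u v}) (A \in indep_sets X).
Proof. by rewrite inE; apply: independentP. Qed.

Lemma nis_gt0 X : (0 < nis X)%N.
Proof.
apply/card_gt0P; exists set0; apply/indep_setsP; split; first exact: sub0set.
by move=> u v; rewrite inE.
Qed.

Lemma nis0 : nis set0 = 1%N.
Proof.
rewrite /nis (_ : indep_sets set0 = [set set0]) ?cards1 //.
apply/setP=> A; rewrite inE [in RHS]inE; apply/independentP/eqP => [[]|->].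
  by rewrite subset0 => /eqP.
by split=> // u v; rewrite inE.
Qed.

(** Removing [K] from [A] and adding [B] to [C] are inverse bijections; [C] has to avoid the
    neighbours of [B]. *)
Lemma card_trace X K B : K \subset X -> B \subset K ->
  {in B &, forall u v, ~~ gadj L u v} ->
  #|[set A in indep_sets X | A :&: K == B]| =
  nis (X :\: K :\: [set u | [exists b in B, gadj L b u]]).
Proof.
move=> KX BK indB; set Y := _ :\: _.
have CK C : C \in indep_sets Y -> C :&: K = set0.
  case/indep_setsP=> CY _; apply/setP=> u; rewrite !inE; apply/negP=> /andP[uC uK].
  by have := subsetP CY u uC; rewrite !inE uK andbF.
have -> : [set A in indep_sets X | A :&: K == B] = [set C :|: B | C in indep_sets Y].
  apply/setP=> A; apply/idP/imsetP.
    rewrite inE => /andP[/indep_setsP[AX indA] /eqP AK].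
    have BA : B \subset A by rewrite -AK subsetIl.
    exists (A :\: K); last first.
      by rewrite -AK setUC -{1}(setID A K).
    apply/indep_setsP; split; last first.
      by move=> u v; rewrite !inE => /andP[_ uA] /andP[_ vA]; apply: indA.
    apply/subsetP=> u; rewrite !inE => /andP[uK uA].
    rewrite uK (subsetP AX) // !andbT; apply/exists_inP => -[b bB].
    by apply/negP; apply: indA => //; apply: (subsetP BA).
  move=> [C CI ->]; have CK0 := CK C CI; case/indep_setsP: CI => CY indC.
  have BC u v : u \in B -> v \in C -> ~~ gadj L u v.
    move=> uB /(subsetP CY); rewrite !inE => /andP[+ _].
    by apply: contra => uv; apply/exists_inP; exists u.
  rewrite inE setIUl CK0 set0U (setIidPl BK) eqxx andbT; apply/indep_setsP; split.
    rewrite subUset (subset_trans BK KX) andbT; apply: subset_trans CY _.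
    by rewrite /Y setDDl; apply: subsetDl.
  move=> u v; rewrite !inE => /orP[uC|uB] /orP[vC|vB]; first exact: indC.
  - by rewrite gadjC; apply: BC.
  - exact: BC.
  - exact: indB.
rewrite card_in_imset // => C D /CK CK0 /CK DK0 eqCD.
have aux E : E :&: K = set0 -> (E :|: B) :\: K = E.
  move=> EK; rewrite setDUl (_ : B :\: K = set0) ?setU0; last by apply/eqP; rewrite setD_eq0.
  by apply/setDidPl; rewrite -setI_eq0 EK.
by rewrite -(aux C) // eqCD aux.
Qed.

(** Independent sets are sorted by their trace on [K], which has at most two vertices. A trace
    [{v, u}] appears once from [v] and once from [u], whence the factor one half. *)
Lemma nis_split X K : K \subset X -> block_set L K ->
  (nis X)%:R = (nis (X :\: K))%:R
    + \sum_(v in K) ((nis (X :\: K :\: (nbr (subgraph X) v :\: K)))%:R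
        + 2%:R^-1 * \sum_(u in K | (u != v) && ~~ gadj L v u)
            (nis (X :\: K :\: (nbr (subgraph X) v :\: K)
                    :\: (nbr (subgraph X) u :\: (nbr (subgraph X) v :|: K))))%:R) :> rat.
Proof.
move=> KX bK.
have trace B : B \subset K -> {in B &, forall u v, ~~ gadj L u v} ->
    \sum_(A in indep_sets X) (A :&: K == B)%:R =
    (nis (X :\: K :\: [set u | [exists b in B, gadj L b u]]))%:R :> rat.
  move=> BK indB; rewrite -card_trace // -sum1_card natr_sum big_mkcond [RHS]big_mkcond /=.
  apply: eq_bigr => A _; rewrite [in RHS]inE.
  by case: (A \in _) => //=; case: (_ == _).
have trace0 : (nis (X :\: K))%:R = \sum_(A in indep_sets X) (A :&: K == set0)%:R :> rat.
  rewrite trace ?sub0set //; last by move=> u v; rewrite inE.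
  congr (nis _)%:R; apply/setP=> u; rewrite !inE.
  by case: exists_inP => // -[b]; rewrite inE.
have trace1 v : v \in K -> (nis (X :\: K :\: (nbr (subgraph X) v :\: K)))%:R =
    \sum_(A in indep_sets X) (A :&: K == [set v])%:R :> rat.
  move=> vK; rewrite trace ?sub1set //; last first.
    by move=> u w; rewrite !inE => /eqP-> /eqP->; rewrite gadj_irr.
  congr (nis _)%:R; apply/setP=> u; rewrite !inE /=.
  have -> : [exists b in [set v], gadj L b u] = gadj L v u.
    by apply/exists_inP/idP => [[b]|vu]; [rewrite inE => /eqP->|exists v; rewrite ?inE].
  by case: (u \in K); case: (u \in X); case: gadj.
have trace2 v u : v \in K -> u \in K -> ~~ gadj L v u ->
    (nis (X :\: K :\: (nbr (subgraph X) v :\: K)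
                    :\: (nbr (subgraph X) u :\: (nbr (subgraph X) v :|: K))))%:R =
    \sum_(A in indep_sets X) (A :&: K == [set v; u])%:R :> rat.
  move=> vK uK vu; rewrite trace; first last.
  - move=> x y; rewrite !inE => /orP[]/eqP-> /orP[]/eqP->; rewrite ?gadj_irr //.
    by rewrite gadjC.
  - by apply/subsetP=> x; rewrite !inE => /orP[]/eqP->.
  congr (nis _)%:R; apply/setP=> x; rewrite !inE /=.
  have -> : [exists b in [set v; u], gadj L b x] = gadj L v x || gadj L u x.
    apply/exists_inP/orP => [[b]|[vx|ux]]; first by rewrite !inE => /orP[]/eqP->; [left|right].
      by exists v; rewrite ?inE ?eqxx.
    by exists u; rewrite ?inE ?eqxx ?orbT.
  by case: (x \in K); case: (x \in X); case: gadj; case: gadj.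
have terms v : v \in K ->
    ((nis (X :\: K :\: (nbr (subgraph X) v :\: K)))%:R
        + 2%:R^-1 * \sum_(u in K | (u != v) && ~~ gadj L v u)
            (nis (X :\: K :\: (nbr (subgraph X) v :\: K)
                    :\: (nbr (subgraph X) u :\: (nbr (subgraph X) v :|: K))))%:R) =
    \sum_(A in indep_sets X) ((A :&: K == [set v])%:R
      + 2%:R^-1 * \sum_(u in K | (u != v) && ~~ gadj L v u) (A :&: K == [set v; u])%:R) :> rat.
  move=> vK; rewrite trace1 // big_split /= -mulr_sumr exchange_big /=.
  congr (_ + _ * _); apply: eq_bigr => u /and3P[uK _ vu]; exact: trace2.
rewrite (eq_bigr _ terms).
(* After the exchange of sums, each independent set [A] has to contribute exactly [1]; the cases are
   the three possible sizes of [A :&: K]. *)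
rewrite trace0 exchange_big /= -big_split /= /nis -sum1_card natr_sum.
apply: eq_bigr => A /indep_setsP[AX indA].
have : (#|A :&: K| <= 2)%N.
  apply: block_set_alpha bK _ _; first exact: subsetIr.
  by move=> u v; rewrite !inE => /andP[uA _] /andP[vA _]; apply: indA.
move cB : #|A :&: K| => [|[|[|//]]] _.
- have -> : A :&: K = set0 by apply/eqP; rewrite -cards_eq0 cB.
  rewrite eqxx big1 ?addr0 // => v vK.
  rewrite big1; last first.
    by move=> u _; case: eqP => // /setP/(_ v); rewrite !inE eqxx.
  by case: eqP => [/setP/(_ v)|]; rewrite ?inE ?eqxx // mulr0 addr0.
- have /cards1P[a BE] : #|A :&: K| == 1%N by rewrite cB.
  have aK : a \in K by apply: (subsetP (subsetIr A K)); rewrite BE inE.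
  rewrite BE (_ : ([set a] == set0) = false); last by apply/eqP=> /setP/(_ a);
      rewrite !inE eqxx.
  have no2 v : \sum_(u in K | (u != v) && ~~ gadj L v u) ([set a] == [set v; u])%:R = 0 :> rat.
    apply: big1 => u /and3P[_ uv _]; case: eqP => // E; case/eqP: uv.
    have /set1P-> : u \in [set a] by rewrite E !inE eqxx orbT.
    by have /set1P-> : v \in [set a] by rewrite E !inE eqxx.
  rewrite add0r (bigD1 a) //= no2 eqxx mulr0 addr0 big1 ?addr0 // => v /andP[vK va].
  rewrite no2 mulr0 addr0; case: eqP => // /set1_inj av; by rewrite av eqxx in va.
have /cards2P[a [b [ab BE]]] : #|A :&: K| == 2%N by rewrite cB.
have abK x : x \in [set a; b] -> x \in K by rewrite -BE inE => /andP[].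
have abA x : x \in [set a; b] -> x \in A by rewrite -BE inE => /andP[].
have aab : a \in [set a; b] by rewrite !inE eqxx.
have bab : b \in [set a; b] by rewrite !inE eqxx orbT.
have not1 v : ([set a; b] == [set v]) = false.
  by apply/eqP=> E; have := cards2 a b; rewrite E cards1 ab.
have pair x y : x != y -> [set x; y] = [set a; b] ->
    \sum_(u in K | (u != x) && ~~ gadj L x u) ([set a; b] == [set x; u])%:R = 1 :> rat.
  move=> xy E; have xab : x \in [set a; b] by rewrite -E !inE eqxx.
  have yab : y \in [set a; b] by rewrite -E !inE eqxx orbT.
  rewrite (bigD1 y) /=; last by rewrite abK // eq_sym xy indA ?abA.
  rewrite -E eqxx big1 ?addr0 // => u /andP[/and3P[_ ux _] uy].
  by case: eqP => // /setP/(_ u); rewrite !inE eqxx orbT (negPf ux) (negPf uy).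
rewrite BE (_ : ([set a; b] == set0) = false); last first.
  by apply/eqP=> /setP/(_ a); rewrite !inE eqxx.
rewrite add0r (bigD1 a) ?abK //= not1 (pair a b) // (bigD1 b) /=;
    last by rewrite abK // eq_sym ab.
have ba : b != a by rewrite eq_sym.
rewrite not1 (pair b a ba (finset.setUC _ _)) big1; first by rewrite !add0r addr0 mulr1; lra.
move=> v /andP[/andP[vK va] vb]; rewrite not1 add0r big1 ?mulr0 // => u _.
by case: eqP => // /setP/(_ v); rewrite !inE eqxx (negPf va) (negPf vb).
Qed.
End IndependentSets.

(** * Accuracy of a run *)

Section Components.
Variables (T : finType) (L : graph T).
Implicit Types (X Y K A B C : {set T}) (P : {set {set T}}) (u v w : T).
Local Notation subgraph := (subgraph L).

Lemma reachable_equivalence X : {in X & &, equivalence_rel (reachable (subgraph X))}.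
Proof.
move=> x y z _ _ _; split; first exact: connect0.
move=> xy; apply: (same_connect _ xy); apply: sym_connect_sym => a b /=.
by rewrite gadjC andbCA.
Qed.

Lemma components_partition X : partition (components (subgraph X)) X.
Proof. exact/equivalence_partitionP/reachable_equivalence. Qed.

Lemma reachable_edge X u v : u \in X -> v \in X -> gadj L u v -> reachable (subgraph X) u v.
Proof. by move=> uX vX uv; apply: connect1; rewrite /= uX vX. Qed.

Definition separated P : Prop :=
  forall A B u v, A \in P -> B \in P -> A != B -> u \in A -> v \in B -> ~~ gadj L u v.

Lemma components_separated X : separated (components (subgraph X)).
Proof.
move=> A B u v AP BP AB uA vB; apply: contra AB => uv.
have /and3P[/eqP covP tiP _] := components_partition X.
have uX : u \in X by rewrite -covP; apply/bigcupP; exists A.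
have vX : v \in X by rewrite -covP; apply/bigcupP; exists B.
rewrite -(def_pblock tiP AP uA) -(def_pblock tiP BP vB) eq_pblock ?covP //.
rewrite pblock_equivalence_partition //; first exact: reachable_edge.
exact: reachable_equivalence.
Qed.

Lemma nisU X Y : [disjoint X & Y] -> {in X & Y, forall u v, ~~ gadj L u v} ->
  nis L (X :|: Y) = (nis L X * nis L Y)%N.
Proof.
move=> XY noXY; rewrite /nis -cardsX.
have YX : [disjoint Y & X] by rewrite disjoint_sym.
have sub A B : A \subset X -> B \subset Y -> (A :|: B) :&: X = A /\ (A :|: B) :&: Y = B.
  move=> AX BY; split; rewrite setIUl.
    rewrite (setIidPl AX) (_ : B :&: X = set0) ?setU0 //.
    by apply/eqP; rewrite setI_eq0; apply: disjointWl YX.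
  rewrite (setIidPl BY) (_ : A :&: Y = set0) ?set0U //.
  by apply/eqP; rewrite setI_eq0; apply: disjointWl XY.
rewrite -[RHS](@card_in_imset _ _ (fun p => p.1 :|: p.2)); last first.
  move=> [A B] [A' B']; rewrite !in_setX /= => /andP[/indep_setsP[AX _] /indep_setsP[BY _]].
  move=> /andP[/indep_setsP[AX' _] /indep_setsP[BY' _]] /= E.
  have [E1 E2] := sub _ _ AX BY; have [E1' E2'] := sub _ _ AX' BY'.
  by congr (_, _); [rewrite -E1 E E1' | rewrite -E2 E E2'].
congr #|pred_of_set _|; apply/setP=> A; apply/idP/imsetP.
  move=> /indep_setsP[AXY indA]; exists (A :&: X, A :&: Y); last first.
    by rewrite -setIUr (setIidPl AXY).
  rewrite in_setX; apply/andP; split; apply/indep_setsP; split; rewrite ?subsetIr //.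
    by move=> u v; rewrite !inE => /andP[uA _] /andP[vA _]; apply: indA.
  by move=> u v; rewrite !inE => /andP[uA _] /andP[vA _]; apply: indA.
move=> [[B C]]; rewrite in_setX /= => /andP[/indep_setsP[BX indB] /indep_setsP[CY indC]] ->.
apply/indep_setsP; split; first exact: setUSS.
move=> u v; rewrite !inE => /orP[uB|uC] /orP[vB|vC].
- exact: indB.
- by apply: noXY; [exact: (subsetP BX) | exact: (subsetP CY)].
- by rewrite gadjC; apply: noXY; [exact: (subsetP BX) | exact: (subsetP CY)].
- exact: indC.
Qed.

Lemma nis_cover P : trivIset P -> separated P ->
  nis L (cover P) = (\prod_(C in P) nis L C)%N.
Proof.
move: {2}_.+1 (ltnSn #|P|) => n; elim: n P => // n IH P Pn tiP sepP.
have [->|[C CP]] := set_0Vmem P; first by rewrite /cover !big_set0 nis0.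
have sP : P :\ C \subset P by apply: subsetDl.
rewrite (big_setD1 C CP) /= -IH.
- rewrite -nisU; first by rewrite /cover (big_setD1 C CP).
    apply: bigcup_disjoint => B; rewrite !inE => /andP[BC BP].
    by apply: (trivIsetP tiP) => //; rewrite eq_sym.
  move=> u v uC /bigcupP[B]; rewrite !inE => /andP[BC BP] vB.
  by apply: sepP uC vB => //; rewrite eq_sym.
- by move: Pn; rewrite (cardsD1 C) CP.
- by apply: trivIsetS tiP.
by move=> A B u v AP BP; apply: sepP; apply: (subsetP sP).
Qed.

Lemma nis_components X : nis L X = (\prod_(C in components (subgraph X)) nis L C)%N.
Proof.
have /and3P[/eqP cov tiP _] := components_partition X.
by rewrite -{1}cov (nis_cover tiP) //; apply: components_separated.
Qed.

Lemma sum_card_components X : (\sum_(C in components (subgraph X)) #|C| = #|X|)%N.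
Proof. by rewrite (card_partition (components_partition X)). Qed.

Lemma component_sub X C : C \in components (subgraph X) -> C \subset X.
Proof.
move=> CP; have /and3P[/eqP <- _ _] := components_partition X.
exact: bigcup_sup.
Qed.

End Components.

Lemma ninth_unit (R : realFieldType) (x : R) : 1 / 9 <= x <= 1 -> 0 <= x <= 1.
Proof. by move=> /andP[a b]; rewrite b andbT; lra. Qed.

(** * Convergence of [Phi] to the avoidance probability, and the error of a whole run *)

Section Approximation.
Variables (T : finType) (L : graph T).
Hypothesis L2 : locally_two_cliques L.
Implicit Types (X Y K A B C : {set T}) (P : {set {set T}}) (u v w : T) (t k n : nat).
Local Notation subgraph := (subgraph L).
Local Notation V := (vset L).

Definition prob X K : rat := (nis L (X :\: K))%:R / (nis L X)%:R.

Lemma nisR_gt0 X : 0 < (nis L X)%:R :> rat.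
Proof. by rewrite ltr0n nis_gt0. Qed.

Lemma nis_le X Y : X \subset Y -> (nis L X <= nis L Y)%N.
Proof.
move=> XY; apply: subset_leq_card; apply/subsetP=> A /indep_setsP[AX indA].
by apply/indep_setsP; split=> //; apply: subset_trans AX XY.
Qed.

Lemma prob_bounds X K : 0 <= prob X K <= 1.
Proof.
rewrite divr_ge0 ?ler0n //= ler_pdivrMr ?nisR_gt0 // mul1r ler_nat.
by apply: nis_le; apply: subsetDl.
Qed.

Lemma prob_rec X K : K \subset X -> block_set L K ->
  prob X K = avoid L K
    (fun v => prob (X :\: K) (nbr (subgraph X) v :\: K))
    (fun v u => prob (X :\: K :\: (nbr (subgraph X) v :\: K))
                     (nbr (subgraph X) u :\: (nbr (subgraph X) v :|: K))).
Proof.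
move=> KX bK; rewrite /avoid /prob (nis_split KX bK).
have nz Y : (nis L Y)%:R != 0 :> rat by rewrite gt_eqF ?nisR_gt0.
rewrite -[LHS]invrK invf_div mulrDl divff //; congr (1 + _)^-1.
rewrite mulr_suml; apply: eq_bigr => v vK; rewrite /branch -mulr_suml.
by field; rewrite !nz.
Qed.

(** For empty [K] the sum is empty and the step returns [1], in agreement with the convention for
    [Phi]; so later inductions need no separate case. *)
Lemma Phi_rec t X K :
  Phi t.+2 (subgraph X) K = avoid L K
    (fun v => Phi t.+1 (subgraph (X :\: K)) (nbr (subgraph X) v :\: K))
    (fun v u => Phi t (subgraph (X :\: K :\: (nbr (subgraph X) v :\: K)))
                     (nbr (subgraph X) u :\: (nbr (subgraph X) v :|: K))).
Proof.
have [->|K0] := eqVneq K set0; first by rewrite /= eqxx /avoid big_set0 addr0 invr1.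
change (Phi t.+2 (subgraph X) K) with (if K == set0 then 1 else
  (1 + \sum_(v in K) Phi t.+1 (gdel (subgraph X) K) (nbr (subgraph X) v :\: K) *
     (1 + 2%:R^-1 * \sum_(u in K | (u != v) && ~~ gadj L v u)
        Phi t (gdel (gdel (subgraph X) K) (nbr (subgraph X) v :\: K))
              (nbr (subgraph X) u :\: (nbr (subgraph X) v :|: K))))^-1).
rewrite (negPf K0) gdel_subgraph /avoid; congr (1 + _)^-1.
by apply: eq_bigr => v vK; rewrite /branch gdel_subgraph.
Qed.

Lemma Phi_bounds t X K : X \subset V -> simplicial_block (subgraph X) K ->
  1 / 9 <= Phi t (subgraph X) K <= 1.
Proof.
elim/ltn_ind: t X K => -[|[|t]] IH X K XV sK; [by []|by []|].
rewrite Phi_rec; have sK' := sK; rewrite simplicial_subgraph in sK; case/and3P: sK => KX bK _.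
have XKV : X :\: K \subset V by apply: subset_trans XV; apply: subsetDl.
apply: avoid_bounds => //; split=> [v vK|u v uK vK].
  exact: ninth_unit (IH t.+1 (ltnSn _) _ _ XKV (simplicial_nbr L2 XV sK' vK)).
apply: ninth_unit (IH t (ltnW (ltnSn _)) _ _ _ (simplicial_nbr2 L2 XV sK' vK uK)).
by apply: subset_trans XKV; apply: subsetDl.
Qed.

Definition err k : rat := 8 * (49 / 50) ^+ k.

Lemma Phi_unit_valued t X K : X \subset V -> simplicial_block (subgraph X) K ->
  unit_valued K (fun v => Phi t.+1 (subgraph (X :\: K)) (nbr (subgraph X) v :\: K))
    (fun v u => Phi t (subgraph (X :\: K :\: (nbr (subgraph X) v :\: K)))
                     (nbr (subgraph X) u :\: (nbr (subgraph X) v :|: K))).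
Proof.
move=> XV sK; have XKV : X :\: K \subset V by apply: subset_trans XV; apply: subsetDl.
split=> [v vK|u v uK vK]; apply: ninth_unit; apply: Phi_bounds => //.
- exact: simplicial_nbr.
- by apply: subset_trans XKV; apply: subsetDl.
exact: simplicial_nbr2.
Qed.

Lemma prob_unit_valued X K :
  unit_valued K (fun v => prob (X :\: K) (nbr (subgraph X) v :\: K))
    (fun v u => prob (X :\: K :\: (nbr (subgraph X) v :\: K))
                     (nbr (subgraph X) u :\: (nbr (subgraph X) v :|: K))).
Proof. by split=> *; apply: prob_bounds. Qed.

Lemma prob_ge X K : K \subset X -> block_set L K -> 1 / 9 <= prob X K.
Proof.
move=> KX bK; rewrite prob_rec //; case/andP: (avoid_bounds bK (prob_unit_valued X K)).
by [].
Qed.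

Lemma err_ge0 k : 0 <= err k.
Proof. by apply: mulr_ge0; [lra | apply: exprn_ge0; lra]. Qed.

(** Each contraction is charged two levels, because some arguments of a step lie two levels deeper.
    The base case holds at every depth from [2] on: its arguments, even the truncated value [1], lie
    between [1 / 9] and [1]. *)
Lemma Phi_close k t X K : (k.*2 <= t)%N -> X \subset V ->
  simplicial_block (subgraph X) K -> odds_close (err k) (prob X K) (Phi t.+2 (subgraph X) K).
Proof.
elim: k t X K => [|k IH] t X K kt XV sK; rewrite Phi_rec;
  have := sK; rewrite simplicial_subgraph => /and3P[KX bK _]; rewrite (prob_rec KX bK);
  have fg := Phi_unit_valued t XV sK; have fg' := prob_unit_valued X K;
  have XKV : X :\: K \subset V by [apply: subset_trans XV; apply: subsetDl].
  rewrite /err expr0 mulr1; apply: (avoid_close9 bK fg' fg) => v vK.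
    have := simplicial_nbr L2 XV sK vK.
    by rewrite simplicial_subgraph => /and3P[sub bl _]; apply: prob_ge.
  by case/andP: (Phi_bounds t.+1 XKV (simplicial_nbr L2 XV sK vK)).
rewrite (_ : err k.+1 = 49 / 50 * err k); last by rewrite /err exprS mulrCA.
case: t kt fg => [|[|t]] kt fg; [discriminate kt | discriminate kt |].
rewrite doubleS !ltnS in kt.
apply: (avoid_contraction (err_ge0 k) bK fg' fg) => [v vK|u v uK vK].
  by apply: IH (simplicial_nbr L2 XV sK vK); [exact: leqW | exact: XKV].
apply: IH (simplicial_nbr2 L2 XV sK vK uK); first exact: kt.
by apply: subset_trans XKV; apply: subsetDl.
Qed.

Definition ratio_close (s a b : rat) : Prop := a <= s * b /\ b <= s * a.

Lemma Phi_ratio_close k t X K : (k.*2 <= t)%N -> X \subset V ->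
  simplicial_block (subgraph X) K ->
  ratio_close (1 + err k) (prob X K) (Phi t.+2 (subgraph X) K).
Proof.
move=> kt XV sK; have [a b] : 0 < prob X K <= 1 /\ 0 < Phi t.+2 (subgraph X) K <= 1.
  have := sK; rewrite simplicial_subgraph => /and3P[KX bK _].
  case/andP: (prob_bounds X K) => _ ->; case/andP: (Phi_bounds t.+2 XV sK) => + ->.
  by rewrite !andbT; split; [apply: lt_le_trans (prob_ge KX bK); lra | lra].
exact: odds_close_ratio (err_ge0 k) a b (Phi_close kt XV sK).
Qed.

Section RatioClose.
Variable r : rat.
Hypothesis r1 : 1 <= r.
Implicit Types a b c d : rat.

Lemma ratio_close_ge0 n a b : 0 < b -> ratio_close (r ^+ n) a b -> 0 < a.
Proof.
move=> b0 [_ ba]; have := lt_le_trans b0 ba.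
by rewrite pmulr_rgt0 // exprn_gt0 // (lt_le_trans ltr01).
Qed.

Lemma ratio_closeM m n a b c d : 0 < b -> 0 < d ->
  ratio_close (r ^+ m) a b -> ratio_close (r ^+ n) c d ->
      ratio_close (r ^+ (m + n)) (a * c) (b * d).
Proof.
move=> b0 d0 cab ccd; have a0 := ratio_close_ge0 b0 cab; have c0 := ratio_close_ge0 d0 ccd.
case: cab ccd => ab ba [cd dc]; split; rewrite exprD mulrACA ler_pM // ltW //.
Qed.

(** Unlike products, sums do not accumulate factors: the loop over the vertices is as accurate as
    its worst summand. *)
Lemma ratio_closeD n a b c d :
  ratio_close (r ^+ n) a b -> ratio_close (r ^+ n) c d -> ratio_close (r ^+ n) (a + c) (b + d).
Proof. by case=> ab ba [cd dc]; split; rewrite mulrDr lerD. Qed.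

Lemma ratio_close_refl n a : 0 <= a -> ratio_close (r ^+ n) a a.
Proof. by move=> a0; split; rewrite ler_peMl // exprn_ege1. Qed.

Lemma ratio_close_leq m n a b : (m <= n)%N -> 0 < b ->
  ratio_close (r ^+ m) a b -> ratio_close (r ^+ n) a b.
Proof.
move=> mn b0 cab; have a0 := ratio_close_ge0 b0 cab; case: cab => ab ba.
by split; [apply: le_trans ab _ | apply: le_trans ba _];
  rewrite ler_pM2r // ler_weXn2l.
Qed.

Lemma ratio_close_prod (I : finType) (Q : {set I}) (n : I -> nat) (F G : I -> rat) :
  (forall i, i \in Q -> 0 < G i /\ ratio_close (r ^+ n i) (F i) (G i)) ->
  0 < \prod_(i in Q) G i /\
  ratio_close (r ^+ (\sum_(i in Q) n i)) (\prod_(i in Q) F i) (\prod_(i in Q) G i).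
Proof.
move=> FG; apply: (big_rec3 (fun (g : rat) (m : nat) (f : rat) => 0 < g /\
    ratio_close (r ^+ m) f g)) => [|i g m f iQ [g0 cfg]].
  by split; [exact: ltr01 | apply: ratio_close_refl].
have [G0 cFG] := FG i iQ; split; first exact: mulr_gt0.
exact (ratio_closeM G0 g0 cFG cfg).
Qed.

Lemma divide_PhiE t (F : graph T) p z : divide_Phi t F p z = z * divide_Phi t F p 1.
Proof.
elim: p F z => [|K p IH] F z /=; first by rewrite mulr1.
by rewrite IH [in RHS]IH mul1r mulrA.
Qed.

End RatioClose.

(** The block on which [CountIS] starts is simplicial: [v] has no neighbour in [C], so [link_block]
    at [v] makes the neighbourhood of [u] in [C] a block, and [link_simplicial] at [u], which also
    lies outside [C], does the rest. *)
Lemma component_simplicial X v u C : X \subset V -> v \in X ->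
  C \subset X :\: (v |: nbr (subgraph X) v) -> u \in nbr (subgraph X) v ->
  simplicial_block (subgraph C) (nbr (subgraph C) u).
Proof.
move=> XV vX CY; rewrite in_nbr => /andP[uX vu].
have CV : C \subset V by apply: subset_trans CY (subset_trans (subsetDl _ _) XV).
apply: (link_simplicial L2 (v := u)) => //.
- exact: (subsetP XV).
- by apply/negP=> /(subsetP CY); rewrite !inE uX vu !orbT.
apply: (link_block L2 (v := v)) => //.
- exact: (subsetP XV).
- exact: (subsetP XV).
- by apply/negP=> /(subsetP CY); rewrite !inE eqxx.
apply/setP=> x; rewrite in_nbr inE; apply/negP=> /andP[/(subsetP CY)].
by rewrite !inE => /andP[+ xX] vx; rewrite xX vx orbT.
Qed.

Section Run.
Variables (t : nat) (r : rat).
Hypothesis r1 : 1 <= r.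
Hypothesis Phi_r : forall X K, X \subset V -> simplicial_block (subgraph X) K ->
  ratio_close r (prob X K) (Phi t (subgraph X) K).

(** The number of independent sets telescopes into the product of the inverse probabilities
    [(prob X K)^-1] along the peeling, so each block costs one factor [r]. *)
Lemma peeling_close X p : X \subset V -> peeling (subgraph X) p ->
  ratio_close (r ^+ #|X|) (divide_Phi t (subgraph X) p 1) (nis L X)%:R.
Proof.
elim: p X => [|K p IH] X XV /=.
  by move/eqP=> ->; rewrite nis0 cards0; apply: ratio_close_refl.
case/and3P=> K0 sK; rewrite gdel_subgraph => pp.
have XKV : X :\: K \subset V by apply: subset_trans XV; apply: subsetDl.
have cD := IH _ XKV pp; have [Pr1 Pr2] := Phi_r XV sK.
have := sK; rewrite simplicial_subgraph => /and3P[KX bK _].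
have P0 : 0 < Phi t (subgraph X) K.
  by have /andP[+ _] := Phi_bounds t XV sK; apply: lt_le_trans; lra.
have cX : #|X| = (#|K| + #|X :\: K|)%N by rewrite -(cardsID K X) (setIidPr KX).
(* A nonempty block is charged [r ^+ #|K|], which makes the total exponent the number of vertices,
   whatever the peeling. *)
have rK : r <= r ^+ #|K|.
  by rewrite -[leLHS]expr1 ler_weXn2l // card_gt0.
rewrite divide_PhiE cX.
have -> : (nis L X)%:R = (prob X K)^-1 * (nis L (X :\: K))%:R :> rat.
  by rewrite /prob invf_div divfK // gt_eqF ?nisR_gt0.
have p0 : 0 < prob X K by apply: lt_le_trans (prob_ge KX bK); lra.
apply: ratio_closeM => //; rewrite ?invr_gt0 ?nisR_gt0 //.
apply: (@ratio_close_leq r r1 1); rewrite ?card_gt0 // ?invr_gt0 // expr1 div1r.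
split; rewrite -[leRHS]mulrC ler_pdivlMl // ler_pdivrMr //.
Qed.

Lemma increment_close F X v z : F = subgraph X -> X \subset V -> v \in X ->
  increment_run t F v z ->
  ratio_close (r ^+ #|X|) z (nis L (X :\: (v |: nbr F v)))%:R.
Proof.
move=> -> XV vX [zc run ->].
set Y := X :\: _; rewrite gdel_subgraph -/Y in run *.
have YX : Y \subset X by apply: subsetDl.
rewrite nis_components natr_prod.
apply: (@ratio_close_leq r r1 #|Y|); first exact: subset_leq_card.
  by apply: prodr_gt0 => C _; apply: nisR_gt0.
rewrite -(sum_card_components L Y).
case: (@ratio_close_prod r r1 _ (components (subgraph Y)) (fun C => #|C|) zc (fun C =>
    (nis L C)%:R)) => // C CP.
split; first exact: nisR_gt0.
have [u [uv K0 [p pp ->]]] := run C CP.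
have CY := component_sub CP.
have CX := subset_trans CY YX.
move: pp; rewrite !(induced_subgraph L CY) => pp.
apply: peeling_close; first exact: subset_trans CX XV.
rewrite /= K0 pp andbT andTb.
by rewrite nbr_subgraphI (setIidPr CX); apply: component_simplicial XV vX CY uv.
Qed.

Lemma nis_vertex X v : v \in X ->
  nis L X = (nis L (X :\ v) + nis L (X :\: (v |: nbr (subgraph X) v)))%N.
Proof.
move=> vX; have bv : block_set L [set v].
  by apply: (block_set_two_cliques (Q1 := [set v]) (Q2 := [set v])); rewrite ?setUid //;
    split; rewrite ?cards1 // => x y; rewrite !inE => /eqP-> /eqP->; rewrite eqxx.
have := @nis_split T L X [set v]; rewrite sub1set => /(_ vX bv).
rewrite big_set1 big1 => [|u /and3P[]]; last by rewrite inE => /eqP->; rewrite eqxx.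
rewrite mulr0 addr0 -natrD => /eqP; rewrite eqr_nat => /eqP ->.
congr (_ + nis L _)%N; apply/setP=> x; rewrite !inE.
by case: (x == v); case: (x \in X); case: gadj.
Qed.

(** Every nonempty independent set is counted at the first removed vertex that it contains. The
    empty set is the initial value of the accumulator, whence the [- 1]. The exponent [n] stays
    fixed because the increments are summed. *)
Lemma while_close F z y : while_run t F z y -> forall X n, F = subgraph X -> X \subset V ->
  (#|X| <= n)%N -> ratio_close (r ^+ n) (y - z) ((nis L X)%:R - 1).
Proof.
elim=> {F z y} [F z F0|F v z a y vF _ inc _ IH] X n FE XV Xn.
  move: F0; rewrite FE /= => ->; rewrite nis0 !subrr; exact: ratio_close_refl.
have vX : v \in X by rewrite FE in vF.
have FE' : gdel F [set v] = subgraph (X :\ v) by rewrite FE gdel_subgraph.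
have XvV : X :\ v \subset V by apply: subset_trans XV; apply: subsetDl.
have Xvn : (#|X :\ v| <= n)%N by apply: leq_trans Xn; apply: subset_leq_card; apply: subsetDl.
have c1 := IH _ _ FE' XvV Xvn.
have c2 := ratio_close_leq r1 Xn (nisR_gt0 _) (increment_close FE XV vX inc).
have := ratio_closeD c1 c2; rewrite (nis_vertex vX) natrD FE.
by congr ratio_close; ring.
Qed.

Lemma while1_close X y : while_run t (subgraph X) 1 y -> X \subset V ->
  ratio_close (r ^+ #|X|) y (nis L X)%:R.
Proof.
move=> run XV; have c1 := while_close run erefl XV (leqnn _).
have := ratio_closeD c1 (ratio_close_refl r1 #|X| ler01).
by rewrite !subrK.
Qed.

Lemma components_close (yc : {set T} -> rat) :
  (forall C, C \in components (subgraph V) -> while_run t (subgraph C) 1 (yc C)) ->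
  ratio_close (r ^+ #|V|) (\prod_(C in components (subgraph V)) yc C) (nis L V)%:R.
Proof.
move=> run; rewrite nis_components natr_prod -(sum_card_components L V).
case: (@ratio_close_prod r r1 _ (components (subgraph V)) (fun C => #|C|) yc (fun C =>
    (nis L C)%:R)) => // C CP.
split; first exact: nisR_gt0.
by apply: while1_close; [exact: run | exact: component_sub CP].
Qed.
End Run.

End Approximation.

(** * Costs of lists and of rational arithmetic *)

Section RationalSize.
Implicit Types (x y : rat) (b c : nat).

Definition rat_bound b x : bool := (`|numq x| <= 2 ^ b)%N && (`|denq x| <= 2 ^ b)%N.

(** Rationals are kept in lowest terms, so the stored numerator and denominator divide those of any
    representing fraction. This lets the textbook formulas for sums and products bound the sizes. *)
Lemma rat_bound_frac b x (p q : int) : q != 0 -> x = p%:~R / q%:~R ->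
  (`|p| <= 2 ^ b)%N -> (`|q| <= 2 ^ b)%N -> rat_bound b x.
Proof.
move=> q0 xE pb qb.
have E : (`|p| * `|denq x| = `|numq x| * `|q|)%N.
  have : p * denq x = numq x * q.
    have pE : p%:~R = x * q%:~R by rewrite xE divfK ?intr_eq0.
    by apply/eqP; rewrite -(eqr_int rat) !intrM numqE pE mulrAC.
  by move/(congr1 absz); rewrite !abszM.
have cop := coprime_num_den x.
apply/andP; split.
  have [p0|p0] := posnP `|p|%N.
    suff -> : numq x = 0 by [].
    by apply/eqP; rewrite numq_eq0 xE; move/eqP: p0; rewrite absz_eq0 => /eqP->; rewrite mul0r.
  apply: leq_trans pb; apply: dvdn_leq => //.
  by rewrite -(Gauss_dvdl _ cop) E dvdn_mulr.
apply: leq_trans qb; apply: dvdn_leq; first by rewrite absz_gt0.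
by rewrite -(Gauss_dvdr _ (n := `|numq x|%N)) 1?coprime_sym // -E dvdn_mull.
Qed.

Lemma rat_boundW b c x : (b <= c)%N -> rat_bound b x -> rat_bound c x.
Proof.
move=> bc /andP[h1 h2]; have bc2 : (2 ^ b <= 2 ^ c)%N by rewrite leq_exp2l.
by apply/andP; split; [apply: leq_trans bc2 | apply: leq_trans bc2].
Qed.

Lemma rat_bound_nat n : (n <= 1)%N -> rat_bound 0 n%:R.
Proof. by case: n => [|[|]]. Qed.

Lemma rat_boundD b c x y : rat_bound b x -> rat_bound c y -> rat_bound (b + c).+1 (x + y).
Proof.
move=> /andP[nx dx] /andP[ny dy].
apply: (@rat_bound_frac _ _ (numq x * denq y + numq y * denq x) (denq x * denq y)).
- by rewrite mulf_neq0 ?denq_neq0.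
- by rewrite intrD !intrM -addf_div ?intr_eq0 ?denq_neq0 // !divq_num_den.
- have := leq_mul nx dy; have := leq_mul ny dx.
  rewrite -!expnD -!abszM [(c + b)%N]addnC expnS mul2n -addnn; lia.
by rewrite abszM expnS expnD; apply: leq_trans (leq_mul dx dy) _; rewrite leq_pmull.
Qed.

Lemma rat_boundM b c x y : rat_bound b x -> rat_bound c y -> rat_bound (b + c) (x * y).
Proof.
move=> /andP[nx dx] /andP[ny dy].
apply: (@rat_bound_frac _ _ (numq x * numq y) (denq x * denq y)).
- by rewrite mulf_neq0 ?denq_neq0.
- by rewrite !intrM -mulf_div !divq_num_den.
- by rewrite expnD abszM leq_mul.
by rewrite abszM expnD leq_mul.
Qed.

Lemma rat_boundV b x : rat_bound b x -> rat_bound b x^-1.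
Proof.
move=> /andP[nx dx]; have [->|x0] := eqVneq x 0.
  by rewrite invr0; apply: (@rat_boundW 0); last exact: (@rat_bound_nat 0).
apply: (@rat_bound_frac _ _ (denq x) (numq x)) => //; first by rewrite numq_eq0.
by rewrite -invf_div divq_num_den.
Qed.

Lemma rat_bitlen_bound b x : rat_bound b x -> (rat_bitlen x <= 2 * b.+1)%N.
Proof.
have bl m : (m <= 2 ^ b)%N -> (bitlen m <= b.+1)%N.
  by move=> mb; rewrite ltnS -[leqRHS](@trunc_expnK 2) // leq_trunc_log.
by case/andP=> /bl n1 /bl d1; rewrite mul2n -addnn leq_add.
Qed.

End RationalSize.

(** * Composition rules for operation counts and bit costs *)

Section CostRules.
Variable W : nat.

(* W bounds the bit cost of a step that involves no rational. *)
Definition spec A (m : costed A) (a : A) (n : nat) : Prop :=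
  [/\ result m = a, (ops m <= n)%N & (bitops m <= W * ops m)%N].

(** Operands bounded by [2 ^ b1] and [2 ^ b2] have binary length at most [2 * (b1 + 1)] and
    [2 * (b2 + 1)]; with [b = b1 + b2] these add up to [2 * b + 4]. *)
Definition rat_cost (b : nat) : nat := ((2 * b + 4) ^ 2)%N.

(* b bounds the total binary length of the rationals that m has received; an arithmetic
   operation adds at most two bits to it. *)
Definition rspec (b : nat) (m : costed rat) (x : rat) (n : nat) : Prop :=
  [/\ result m = x, (ops m <= n)%N, rat_bound (b + 2 * ops m) x
    & (bitops m <= ops m * (W + rat_cost (b + 2 * ops m)))%N].

Lemma rat_cost_le b c : (b <= c)%N -> (rat_cost b <= rat_cost c)%N.
Proof. by move=> bc; rewrite leq_sqr leq_add2r leq_mul2l. Qed.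

Section Spec.
Variables A B : Type.
Implicit Types (m : costed A) (n : nat).

Lemma spec_le m a n n' : (n <= n')%N -> spec m a n -> spec m a n'.
Proof. by move=> nn [e o b]; split=> //; apply: leq_trans nn. Qed.

Lemma spec_ret (a : A) : spec (ret a) a 0.
Proof. by []. Qed.

Lemma spec_step m a n : (0 < W)%N -> spec m a n -> spec (step m) a n.+1.
Proof. by move=> W0 [e o b]; split=> //=; rewrite mulnS -addn1 addnC leq_add. Qed.

Lemma spec_bind m (k : A -> costed B) a b n n' :
  spec m a n -> spec (k a) b n' -> spec (bind m k) b (n + n').
Proof.
move=> [<- o c] [e o' c']; split=> //=; first exact: leq_add.
by rewrite mulnDr leq_add.
Qed.

Lemma spec_bind0 m (k : A -> costed B) a b n :
  spec m a n -> spec (k a) b 0 -> spec (bind m k) b n.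
Proof. by rewrite -{2}[n]addn0; apply: spec_bind. Qed.

Lemma rspec_bind (m : costed A) (k : A -> costed rat) a b x n n' :
  spec m a n -> rspec b (k a) x n' -> rspec b (bind m k) x (n + n').
Proof.
move=> [<- o c] [e o' r' c']; split=> //=; first exact: leq_add.
  by apply: rat_boundW r'; rewrite leq_add2l leq_mul2l leq_addl.
have cc : (rat_cost (b + 2 * ops (k (result m))) <=
           rat_cost (b + 2 * (ops m + ops (k (result m)))))%N.
  by apply: rat_cost_le; lia.
rewrite mulnDl leq_add //; first by apply: leq_trans c _; rewrite mulnC leq_mul2l leq_addr orbT.
by apply: leq_trans c' _; rewrite leq_mul2l leq_add2l cc orbT.
Qed.
End Spec.

Lemma rspec_le b m x n n' : (n <= n')%N -> rspec b m x n -> rspec b m x n'.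
Proof. by move=> nn [e o r c]; split=> //; apply: leq_trans nn. Qed.

Lemma rspec_ret b x : rat_bound b x -> rspec b (ret x) x 0.
Proof. by move=> bx; split=> //=; rewrite addn0. Qed.

Lemma rspec_step b m x n : (0 < W)%N -> rspec b m x n -> rspec b (step m) x n.+1.
Proof.
move=> W0 [e o r c]; split=> //=; first by apply: rat_boundW r; lia.
have cc : (rat_cost (b + 2 * ops m) <= rat_cost (b + 2 * (ops m).+1))%N.
  by apply: rat_cost_le; lia.
rewrite mulSn -addn1 addnC; apply: leq_add; first by lia.
by apply: leq_trans c _; rewrite leq_mul2l leq_add2l cc orbT.
Qed.

(** The continuation receives [y] with a size governed by the number [o] of operations actually
    performed, and [b'] accounts for the other rationals in scope. Sizes thus stay linear in the
    true operation count. *)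
Lemma rspec_bindR b b' m (k : rat -> costed rat) y x n n' :
  rspec b m y n ->
  (forall o, (o <= n)%N -> rat_bound (b + 2 * o) y -> rspec (b' + (b + 2 * o)) (k y) x n') ->
  rspec (b' + b) (bind m k) x (n + n').
Proof.
move=> [<- o r c] /(_ _ o r)[e o' r' c']; split=> //=; first exact: leq_add.
  by apply: rat_boundW r'; lia.
rewrite mulnDl leq_add //.
  apply: leq_trans c _; rewrite leq_mul2l leq_add2l rat_cost_le ?orbT //; lia.
apply: leq_trans c' _; rewrite leq_mul2l leq_add2l rat_cost_le ?orbT //; lia.
Qed.

Lemma arith_rspec (op : rat -> rat -> rat) b c x y :
  rat_bound b x -> rat_bound c y -> rat_bound (b + c).+2 (op x y) ->
  rspec (b + c) (arith op x y) (op x y) 1.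
Proof.
move=> bx cy bop; split=> //=; first by apply: rat_boundW bop; lia.
have := rat_bitlen_bound bx; have := rat_bitlen_bound cy => h h'.
rewrite mul1n; apply: leq_trans (leq_addl _ _); rewrite leq_sqr; lia.
Qed.

Lemma radd_rspec b c x y :
  rat_bound b x -> rat_bound c y -> rspec (b + c) (radd x y) (x + y) 1.
Proof.
by move=> bx cy; apply: arith_rspec => //; apply: rat_boundW (rat_boundD bx cy).
Qed.

Lemma radd1_rspec b y : rat_bound b y -> rspec b (radd 1 y) (1 + y) 1.
Proof. exact: (@radd_rspec 0 b 1). Qed.

Lemma rmul_rspec b c x y :
  rat_bound b x -> rat_bound c y -> rspec (b + c) (rmul x y) (x * y) 1.
Proof.
by move=> bx cy; apply: arith_rspec => //; apply: rat_boundW (rat_boundM bx cy); lia.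
Qed.

Lemma rdiv_rspec b c x y :
  rat_bound b x -> rat_bound c y -> rspec (b + c) (rdiv x y) (x / y) 1.
Proof.
move=> bx cy; apply: (arith_rspec (op := fun x y => x / y)) => //.
by apply: rat_boundW (rat_boundM bx (rat_boundV cy)); lia.
Qed.

(** The bit of the constant [2] is covered by the two bits that any operation may add, so [b] does
    not grow. *)
Lemma half_rspec b x : rat_bound b x -> rspec b (rdiv x 2%:R) (x / 2%:R) 1.
Proof.
move=> bx; have b2 : rat_bound 1 2%:R by [].
split=> //=; first by apply: rat_boundW (rat_boundM bx (rat_boundV b2)); lia.
have := rat_bitlen_bound bx; have := rat_bitlen_bound b2 => h h'.
rewrite mul1n; apply: leq_trans (leq_addl _ _); rewrite leq_sqr; lia.
Qed.

Section Fold.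
Variables (A : Type) (B : eqType) (h : B -> A) (op : rat -> rat -> rat) (z : rat).
Hypothesis W_gt0 : (0 < W)%N.
Hypothesis z0 : rat_bound 0 z.
Hypothesis bop : forall b c x y, rat_bound b x -> rat_bound c y ->
    rat_bound (b + c).+2 (op x y).

Lemma foldM_rspec (f : A -> costed rat) (g : B -> rat) n (s : seq B) :
  (forall a, a \in s -> rspec 0 (f (h a)) (g a) n) ->
  rspec 0 (foldM (arith op) z f (map h s)) (foldr (fun a y => op (g a) y) z s)
    ((n + 2) * size s + 1).
Proof.
elim: s => [_|a s IH fg].
  by apply: rspec_le (rspec_step W_gt0 (rspec_ret z0)); rewrite addn1.
apply: (@rspec_le _ _ _ (n + (((n + 2) * size s + 1) + 1)).+1); first by rewrite /=; lia.
apply: rspec_step => //; apply: (rspec_bindR (b' := 0)) => [|o _ bo]; first by apply: fg;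
    rewrite inE eqxx.
rewrite add0n -[(0 + 2 * o)%N]addn0; apply: (rspec_bindR (b := 0)) => [|o' _ bo'].
  by apply: IH => a' a's; apply: fg; rewrite inE a's orbT.
by apply: arith_rspec => //; apply: bop.
Qed.
End Fold.

Lemma sumM_rspec (A : Type) (B : eqType) (h : B -> A) (f : A -> costed rat) (g : B ->
    rat) n (s : seq B) :
  (0 < W)%N -> (forall a, a \in s -> rspec 0 (f (h a)) (g a) n) ->
  rspec 0 (sumM f (map h s)) (\sum_(a <- s) g a) ((n + 2) * size s + 1).
Proof.
move=> W_gt0 fg; have -> : \sum_(a <- s) g a = foldr (fun a y => g a + y) 0 s.
  by elim: s {fg} => [|a s IH]; rewrite ?big_nil ?big_cons //= IH.
apply: foldM_rspec => //.
by move=> b c x y bx cy; apply: rat_boundW (rat_boundD bx cy).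
Qed.

Lemma prodM_rspec (A : Type) (B : eqType) (h : B -> A) (f : A -> costed rat) (g : B ->
    rat) n (s : seq B) :
  (0 < W)%N -> (forall a, a \in s -> rspec 0 (f (h a)) (g a) n) ->
  rspec 0 (prodM f (map h s)) (\prod_(a <- s) g a) ((n + 2) * size s + 1).
Proof.
move=> W_gt0 fg; have -> : \prod_(a <- s) g a = foldr (fun a y => g a * y) 1 s.
  by elim: s {fg} => [|a s IH]; rewrite ?big_nil ?big_cons //= IH.
apply: foldM_rspec => //.
by move=> b c x y bx cy; apply: rat_boundW (rat_boundM bx cy); lia.
Qed.

End CostRules.

(** * Correctness and cost of the program *)

Section Search.
Variable W : nat.
Hypothesis W_gt0 : (0 < W)%N.
Local Notation spec := (spec W).

Lemma lengthM_spec (A : Type) (s : seq A) : spec (lengthM s) (size s) (size s).+1.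
Proof.
elim: s => [|x s IH] /=; apply: spec_step => //.
by apply: spec_bind0 IH _; apply: spec_ret.
Qed.

Lemma appendM_spec (A : Type) (s1 s2 : seq A) : spec (appendM s1 s2) (s1 ++ s2) (size s1).+1.
Proof.
elim: s1 => [|x s IH] /=; apply: spec_step => //.
by apply: spec_bind0 IH _; apply: spec_ret.
Qed.

Section Lists.
Variables (B : eqType) (A : Type) (h : B -> A) (p : A -> costed bool) (b : pred B) (c :
    nat) (F : seq B).
Hypothesis pb : forall v, v \in F -> spec (p (h v)) (b v) c.

Lemma filterM_spec : spec (filterM p (map h F)) (map h (filter b F)) ((c + 1) * size F + 1).
Proof.
elim: F pb => [|v F' IH] pF /=; first by rewrite addn1 muln0; apply: spec_step.
apply: (@spec_le _ _ _ _ (c + (((c + 1) * size F' + 1) + 0)).+1); first by lia.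
apply: spec_step => //; apply: spec_bind (pF v (mem_head _ _)) _.
apply: spec_bind (IH _) _; first by move=> u uF; apply: pF; rewrite inE uF orbT.
by case: (b v); apply: spec_ret.
Qed.

Lemma findM_spec :
  spec (findM p (map h F)) (omap h (ohead (filter b F))) ((c + 1) * size F + 1).
Proof.
elim: F pb => [|v F' IH] pF /=; first by rewrite addn1 muln0; apply: spec_step.
apply: (@spec_le _ _ _ _ (c + ((c + 1) * size F' + 1)).+1); first by lia.
apply: spec_step => //; apply: spec_bind (pF v (mem_head _ _)) _.
case: (b v) => /=; first by apply: spec_le (spec_ret _ _).
by apply: IH => u uF; apply: pF; rewrite inE uF orbT.
Qed.

Lemma existsM_spec : spec (existsM p (map h F)) (has b F) ((c + 1) * size F + 2).
Proof.
rewrite [(_ + 2)%N]addnS; apply: spec_step => //; apply: spec_bind0 findM_spec _;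
    rewrite has_filter; case: (filter b F) => *; exact: spec_ret.
Qed.
End Lists.

Lemma notM_spec (A : Type) (p : A -> costed bool) x b c :
  spec (p x) b c -> spec (notM p x) (~~ b) c.+1.
Proof.
move=> px; apply: spec_step => //; apply: spec_bind0 px _; exact: spec_ret.
Qed.

Lemma andM_spec (A : Type) (p q : A -> costed bool) x b b' c c' :
  spec (p x) b c -> spec (q x) b' c' -> spec (andM p q x) (b && b') (c + c').+1.
Proof.
move=> px qx; apply: spec_step => //; apply: spec_bind px _.
by case: b => //; apply: spec_le (spec_ret _ _).
Qed.

End Search.

(** * Evaluation of [Phi] on lists of encoded edges *)

Section Program.
Variables (T : finType) (L : graph T) (cd : T -> hedge) (a W : nat).
Local Notation V := (vset L).
Local Notation subgraph := (subgraph L).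
Hypothesis L2 : locally_two_cliques L.
Hypothesis W_gt0 : (0 < W)%N.
Local Notation spec := (spec W).
Local Notation rspec := (rspec W).
Hypothesis same_spec : {in V &, forall e f, spec (same (cd e) (cd f)) (e == f) a}.
Hypothesis adjacent_spec : {in V &, forall e f, spec (adjacent (cd e) (cd f)) (gadj L e f) a}.
Implicit Types (F G K R S U : seq T) (u v : T).

(* cd e is the list of labels of the edge e; a bounds the cost of comparing two edges. *)
Definition inV F := {subset F <= V}.
Definition gof F : graph T := subgraph [set v in F].

Definition nbrs F v := [seq u <- F | gadj L v u].
Definition minus F K := [seq u <- F | u \notin K].

Lemma nbrsM_spec F v : inV F -> v \in V ->
  spec (nbrsM (map cd F) (cd v)) (map cd (nbrs F v)) ((a + 1) * size F + 2).
Proof.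
move=> FV vV; rewrite [(_ + 2)%N]addnS; apply: spec_step => //; apply: filterM_spec => // u uF.
by apply: adjacent_spec => //; apply: FV.
Qed.

Lemma has_same_spec K v : inV K -> v \in V ->
  spec (existsM (same (cd v)) (map cd K)) (v \in K) ((a + 1) * size K + 2).
Proof.
move=> KV vV; rewrite -has_pred1 -(eq_has (a1 := eq_op v)); last by move=> u; rewrite /= eq_sym.
by apply: existsM_spec => // u uK; apply: same_spec => //; apply: KV.
Qed.

Lemma has_adjacent_spec K v : inV K -> v \in V ->
  spec (existsM (adjacent (cd v)) (map cd K)) (has (gadj L v) K) ((a + 1) * size K + 2).
Proof. by move=> KV vV; apply: existsM_spec => // u uK; apply: adjacent_spec => //; apply: KV.
    Qed.

Lemma minusM_spec F K : inV F -> inV K ->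
  spec (minusM (map cd F) (map cd K)) (map cd (minus F K)) (((a + 1) * size K + 4) * size F +
      2).
Proof.
move=> FV KV; rewrite [(_ + 2)%N]addnS; apply: spec_step => //.
have := @filterM_spec W W_gt0 _ _ cd (notM (fun w : hedge =>
    existsM (same w) (map cd K))) (fun v => v \notin K) _ F.
move/(_ ((a + 1) * size K + 3)%N); rewrite -addnA; apply=> v vF.
rewrite [(_ + 3)%N]addnS; apply: (notM_spec W_gt0 (p := fun w : hedge =>
    existsM (same w) (map cd K))).
by apply: has_same_spec => //; apply: FV.
Qed.

Lemma inV_filter (p : pred T) F : inV F -> inV (filter p F).
Proof. by move=> FV v; rewrite mem_filter => /andP[_ /FV]. Qed.

Lemma set_nbrs F v : [set u in nbrs F v] = nbr (gof F) v.
Proof. by apply/setP=> u; rewrite !inE mem_filter andbC. Qed.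

Lemma set_minus F K : [set u in minus F K] = [set u in F] :\: [set u in K].
Proof. by apply/setP=> u; rewrite !inE mem_filter. Qed.

Lemma gdel_gof F K : gdel (gof F) [set u in K] = gof (minus F K).
Proof. by rewrite gdel_subgraph -set_minus. Qed.

Lemma set_sub F : inV F -> [set u in F] \subset V.
Proof. by move=> FV; apply/subsetP=> u; rewrite inE => /FV. Qed.

Lemma sum_list_set (R : nmodType) F (p : pred T) (f : T -> R) : uniq F ->
  \sum_(v <- F | p v) f v = \sum_(v in [set v in F] | p v) f v.
Proof.
move=> uF; rewrite -big_filter [RHS](eq_bigl (fun v => v \in filter p F)); last first.
  by move=> v; rewrite mem_filter inE andbC.
by rewrite big_uniq // filter_uniq.
Qed.

Lemma sum_list_all (R : nmodType) F (f : T -> R) : uniq F ->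
  \sum_(v <- F) f v = \sum_(v in [set v in F]) f v.
Proof. by move=> uF; rewrite sum_list_set //; apply: eq_bigl => v; rewrite andbT. Qed.

(** The factor [(4 * a + 10) * N] bounds one list operation of a call, the second list having at
    most four entries. The base [6] exceeds the positive root of [x ^ 2 = 4 * x + 8]. *)
Definition phi_cost N t := (60 * (4 * a + 10) * N * 6 ^ t)%N.

Lemma card_set_seq F : uniq F -> #|[set v in F]| = size F.
Proof. by rewrite cardsE; apply: card_uniqP. Qed.

(** Stated apart so that one level can be exposed while the recursive calls stay folded. *)
Lemma PhiM_unfold t (G K : seq hedge) (k : hedge) :
  PhiM t.+2 G (k :: K) = step
    (let* G1 := minusM G (k :: K) in
    let* S := sumM (fun v : hedge =>
      let* Kv := nbrsM G1 v in
      let* G2 := minusM G1 Kv in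
      let* U := filterM (andM (notM (same v)) (notM (adjacent v))) (k :: K) in
      let* I := sumM (fun u : hedge => let* Kuv := nbrsM G2 u in PhiM t G2 Kuv) U in
      let* h := rdiv I 2%:R in
      let* w := radd 1 h in
      let* x := PhiM t.+1 G1 Kv in
      rmul x w) (k :: K) in
    let* d := radd 1 S in
    rdiv 1 d).
Proof. by []. Qed.

Lemma body_cost c p q s : (0 < c)%N -> (s <= 2)%N ->
  (c + (c + (2 * c + ((c + p + 2) * s + 1 + (1 + (1 + (q + 1)))))) <= 14 * c + 2 * p + q)%N.
Proof.
move=> c0 s2; have : ((c + p + 2) * s <= (c + p + 2) * 2)%N by rewrite leq_mul2l s2 orbT.
lia.
Qed.

(** With [p = phi_cost N t], the recursive calls take [4 * (2 * p + 6 * p) = 32 * p] out of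
    [36 * p]. The remaining [4 * p] pays for the local work of about [57 * c], because
    [60 * c <= p]. *)
Lemma phi_cost_step N t k c : (0 < N)%N -> (k <= 4)%N -> c = ((4 * a + 10) * N)%N ->
  ((c + (((14 * c + 2 * phi_cost N t + phi_cost N t.+1 + 2) * k + 1) + (1 + 1))).+1
     <= phi_cost N t.+2)%N.
Proof.
move=> N0 k4 cE.
have c1 : (1 <= c)%N by rewrite cE muln_gt0 N0 addn_gt0 orbT.
have pE : phi_cost N t = (60 * c * 6 ^ t)%N by rewrite /phi_cost cE mulnA.
have pc : (60 * c <= phi_cost N t)%N by rewrite pE leq_pmulr ?expn_gt0.
have -> : phi_cost N t.+1 = (6 * phi_cost N t)%N by rewrite /phi_cost expnS mulnCA.
have -> : phi_cost N t.+2 = (36 * phi_cost N t)%N by rewrite /phi_cost !expnS; lia.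
move: c1 pc {cE}; move: (phi_cost N t) c {pE} => p c c1 pc.
have : ((14 * c + 2 * p + 6 * p + 2) * k <= (14 * c + 2 * p + 6 * p + 2) * 4)%N.
  by rewrite leq_mul2l k4 orbT.
lia.
Qed.

(** Simpliciality passes to all recursive calls and bounds their number: it keeps every block at
    four vertices and every list of non-neighbours at two. *)
Lemma PhiM_spec N t G K : inV G -> uniq G -> (size G < N)%N -> uniq K ->
  simplicial_block (gof G) [set v in K] ->
  rspec 0 (PhiM t (map cd G) (map cd K)) (Phi t (gof G) [set v in K]) (phi_cost N t).
Proof.
move=> + + + + sK; elim/ltn_ind: t G K sK => t IH G K sK GV uG GN uK.
have N0 : (0 < N)%N by lia.
have cost1 : (1 <= phi_cost N t)%N by rewrite !muln_gt0 N0 expn_gt0 addn_gt0 orbT.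
have one : rspec 0 (step (ret 1)) 1 1.
  by apply: rspec_step => //; apply: rspec_ret; apply: (@rat_bound_nat 1).
case: t IH cost1 => [|[|t]] IH cost1; [by apply: rspec_le one | by apply: rspec_le one |].
case: K sK uK => [|k K']; first by rewrite (_ : [set v in [::]] = set0) /= ?eqxx // => _ _;
    apply: rspec_le one.
move=> sK uK; set K := k :: K' in sK uK *.
have := sK; rewrite simplicial_subgraph => /and3P[/subsetP KG bK _].
have KV : inV K by move=> v vK; apply: GV; have := KG v; rewrite !inE; apply.
have K4 : (size K <= 4)%N by case/and3P: bK => _; rewrite card_set_seq.
have G1V : inV (minus G K) by apply: inV_filter.
have sG1 : (size (minus G K) <= size G)%N by rewrite size_filter count_size.
have uG1 : uniq (minus G K) by rewrite filter_uniq.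
have KE v : [set u in nbrs (minus G K) v] = nbr (gof G) v :\: [set u in K].
  by rewrite set_nbrs /gof set_minus -nbr_subgraphD.
have minus_cost G' Q : inV G' -> inV Q -> (size G' <= size G)%N -> (size Q <= 4)%N ->
    spec (minusM (map cd G') (map cd Q)) (map cd (minus G' Q)) ((4 * a + 10) * N).
  move=> G'V QV G'G Q4; apply: spec_le (minusM_spec G'V QV).
  have q4 : ((a + 1) * size Q <= (a + 1) * 4)%N by rewrite leq_mul2l Q4 orbT.
  have : (((a + 1) * size Q + 4) * size G' <= ((a + 1) * 4 + 4) * size G)%N.
    by apply: leq_mul => //; lia.
  have : ((4 * a + 10) * (size G).+1 <= (4 * a + 10) * N)%N by rewrite leq_mul2l GN orbT.
  lia.
have nbrs_cost G' v : inV G' -> v \in V -> (size G' <= size G)%N ->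
    spec (nbrsM (map cd G') (cd v)) (map cd (nbrs G' v)) ((4 * a + 10) * N).
  move=> G'V vV G'G; apply: spec_le (nbrsM_spec G'V vV).
  have : ((a + 1) * size G' <= (a + 1) * size G)%N by rewrite leq_mul2l G'G orbT.
  have : ((4 * a + 10) * (size G).+1 <= (4 * a + 10) * N)%N by rewrite leq_mul2l GN orbT.
  lia.
have size4 F' : uniq F' -> block_set L [set u in F'] -> (size F' <= 4)%N.
  by move=> uF' /and3P[_]; rewrite card_set_seq.
set c := ((4 * a + 10) * N)%N in minus_cost nbrs_cost.
have c10 : (4 * a + 10 <= c)%N by rewrite -[leqLHS]muln1 leq_mul2l N0 orbT.
have KVn v : v \in K -> v \in V by apply: KV.
pose U v := [seq u <- K | (v != u) && ~~ gadj L v u].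
have US v : {subset U v <= K} by move=> u; rewrite mem_filter => /andP[].
have U2 v : v \in K -> (size (U v) <= 2)%N.
  move=> vK; have := block_set_non_nbr bK (v := v); rewrite inE vK => /(_ isT).
  rewrite -card_set_seq ?filter_uniq //; apply: leq_trans; rewrite leq_eqVlt; apply/orP; left.
  by apply/eqP/eq_card => u; rewrite !inE mem_filter andbC eq_sym.
rewrite Phi_rec /avoid.
have body v : v \in K -> rspec 0
   (let* Kv := nbrsM (map cd (minus G K)) (cd v) in
    let* G2 := minusM (map cd (minus G K)) Kv in
    let* U := filterM (andM (notM (same (cd v))) (notM (adjacent (cd v)))) (map cd K) in
    let* I := sumM (fun u : hedge => let* Kuv := nbrsM G2 u in PhiM t G2 Kuv) U in
    let* h := rdiv I 2%:R in
    let* w := radd 1 h in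
    let* x := PhiM t.+1 (map cd (minus G K)) Kv in
    rmul x w)
   (branch L [set u in K] (fun v => Phi t.+1 (subgraph ([set u in G] :\:
       [set u in K])) (nbr (gof G) v :\: [set u in K]))
      (fun v u => Phi t (subgraph ([set u in G] :\: [set u in K] :\: (nbr (gof G) v :\:
          [set u in K])))
                     (nbr (gof G) u :\: (nbr (gof G) v :|: [set u in K]))) v)
   (14 * c + 2 * phi_cost N t + phi_cost N t.+1).
  move=> vK; have vV := KVn v vK.
  have vK' : v \in [set u in K] by rewrite inE.
  have sKv := simplicial_nbr L2 (set_sub GV) sK vK'.
  rewrite -KE -set_minus in sKv.
  set Kv := nbrs (minus G K) v in sKv.
  have uKv : uniq Kv by rewrite filter_uniq.
  have KvV : inV Kv by apply: inV_filter.
  have Kv4 : (size Kv <= 4)%N.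
    by apply: size4 => //; move: sKv; rewrite simplicial_subgraph => /and3P[].
  set G2 := minus (minus G K) Kv.
  have G2V : inV G2 by apply: inV_filter.
  have uG2 : uniq G2 by rewrite filter_uniq.
  have sG2 : (size G2 <= size G)%N by apply: leq_trans sG1; rewrite size_filter count_size.
  apply: (@rspec_le _ _ _ _ (c + (c + (2 * c + ((c + phi_cost N t + 2) * size (U v) + 1 + (1 +
      (1 + (phi_cost N t.+1 + 1)))))))).
    by apply: body_cost; [rewrite muln_gt0 N0 addn_gt0 orbT | apply: U2].
  apply: rspec_bind (nbrs_cost _ _ G1V vV sG1) _; rewrite -/Kv.
  apply: rspec_bind (minus_cost _ _ G1V KvV sG1 Kv4) _; rewrite -/G2.
  apply: (rspec_bind (a := map cd (U v))).
    have h : spec (filterM (andM (notM (same (cd v))) (notM (adjacent (cd v)))) (map cd K))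
        (map cd (U v)) ((2 * a + 3 + 1) * size K + 1).
      apply: filterM_spec => // u uK'.
      apply: spec_le (andM_spec W_gt0 (notM_spec W_gt0 (same_spec vV (KVn u uK'))) (notM_spec
          W_gt0 (adjacent_spec vV (KVn u uK')))).
      by clear; lia.
    apply: spec_le h; have : ((2 * a + 3 + 1) * size K <= (2 * a + 3 + 1) * 4)%N by rewrite
        leq_mul2l K4 orbT.
    by move: c10; clear; lia.
  have -> : branch L [set u in K]
      (fun v => Phi t.+1 (subgraph ([set u in G] :\: [set u in K])) (nbr (gof G) v :\:
          [set u in K]))
      (fun v u => Phi t (subgraph ([set u in G] :\: [set u in K] :\: (nbr (gof G) v :\:
          [set u in K])))
                     (nbr (gof G) u :\: (nbr (gof G) v :|: [set u in K]))) v =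
    Phi t.+1 (gof (minus G K)) [set u in Kv]
      * (1 + (\sum_(u <- U v) Phi t (gof G2) [set w in nbrs G2 u]) / 2%:R).
    rewrite /branch /U big_filter (sum_list_set (F := K)) // /gof /G2 /Kv !set_minus -KE [_ /
        2%:R]mulrC.
    congr (_ * (1 + _ * _)); apply: eq_big => u; first by rewrite eq_sym.
    move=> _; congr Phi; rewrite set_nbrs; apply/setP=> w.
    rewrite !(inE, mem_filter) /=.
    by case: (w \in G); case: ((w == k) || (w \in K')); case: (gadj L u w); case: (gadj L v w).
  apply: (@rspec_bindR _ 0 0) => [|o _ bo].
    apply: sumM_rspec => // u uU; have uK' := US v u uU.
    have sKuv : simplicial_block (gof G2) [set w in nbrs G2 u].
      have uK0 : u \in [set u in K] by rewrite inE.
      have := simplicial_nbr2 L2 (set_sub GV) sK vK' uK0.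
      rewrite /gof -KE -!set_minus; congr simplicial_block.
      apply/setP=> w; rewrite !(inE, mem_filter) /=.
      by case: (w \in G); case: ((w == k) || (w \in K')); case: (gadj L u w); case:
          (gadj L v w).
    apply: rspec_bind (nbrs_cost _ _ G2V (KVn u uK') sG2) _.
    apply: IH => //; [exact: leq_ltn_trans sG2 GN | by rewrite filter_uniq].
  apply: (@rspec_bindR _ _ 0) (half_rspec _ bo) _ => o' _ bo'.
  apply: (@rspec_bindR _ _ 0) (radd1_rspec _ bo') _ => o2 _ bo2.
  rewrite add0n -[(_ + 2 * o2)%N]addn0; apply: rspec_bindR => [|o3 _ bo3].
    apply: IH => //; exact: leq_ltn_trans sG1 GN.
  by rewrite addnC; apply: rmul_rspec.
have KE' : map cd K = cd k :: map cd K' by [].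
rewrite KE' PhiM_unfold -KE'.
apply: (@rspec_le _ _ _ _ (c + (((14 * c + 2 * phi_cost N t + phi_cost N t.+1 + 2) * size K + 1)
    + (1 + 1))).+1).
  exact: phi_cost_step.
apply: rspec_step => //; apply: rspec_bind (minus_cost _ _ GV KV (leqnn _) K4) _.
rewrite -sum_list_all //; apply: (@rspec_bindR _ 0 0); first exact: sumM_rspec body.
move=> o _ bo; apply: (@rspec_bindR _ _ 0) (radd1_rspec _ bo) _ => o' _ bo'.
by rewrite -div1r; apply: rdiv_rspec bo'; apply: (@rat_bound_nat 1).
Qed.

End Program.

Lemma list_costs a N n k : (n < N)%N -> (k < N)%N ->
  ((a + 1) * n + 2 <= (a + 10) * N)%N /\ (((a + 1) * k + 4) * n + 2 <= (a + 10) * N ^ 2)%N /\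
  (((a + 10) * N + 1) * n + 1 <= 2 * ((a + 10) * N ^ 2))%N /\ (0 < N)%N /\
      ((a + 10) * N <= (a + 10) * N ^ 2)%N /\ (N <= (a + 10) * N)%N.
Proof.
case: N => // M; rewrite !ltnS => nM kM.
have h1 : ((a + 1) * n <= (a + 1) * M)%N by rewrite leq_mul2l nM orbT.
have h2 : (((a + 1) * k + 4) * n <= ((a + 1) * M + 4) * M)%N.
  by apply: leq_mul => //; rewrite leq_add2r leq_mul2l kM orbT.
have h3 : (((a + 10) * M.+1 + 1) * n <= ((a + 10) * M.+1 + 1) * M)%N by rewrite leq_mul2l nM
    orbT.
by repeat split; nia.
Qed.

(** * Construction of a peeling, and [CountIS] *)

Section Peeling.
Variables (T : finType) (L : graph T) (cd : T -> hedge) (a W : nat).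
Local Notation V := (vset L).
Local Notation subgraph := (subgraph L).
Hypothesis L2 : locally_two_cliques L.
Hypothesis W_gt0 : (0 < W)%N.
Local Notation spec := (spec W).
Local Notation rspec := (rspec W).
Local Notation gof := (gof L).
Local Notation inV := (inV L).
Local Notation nbrs := (nbrs L).
Hypothesis same_spec : {in V &, forall e f, spec (same (cd e) (cd f)) (e == f) a}.
Hypothesis adjacent_spec : {in V &, forall e f, spec (adjacent (cd e) (cd f)) (gadj L e f) a}.
Implicit Types (F G K R S U : seq T) (u v : T) (X Z : {set T}) (p : seq (seq T)).

Lemma closed_reachable Z X x y : X \subset Z ->
  {in X & Z :\: X, forall u v, ~~ gadj L u v} -> reachable (subgraph Z) x y ->
  x \in X -> y \in X.
Proof.
move=> XZ noX xy; rewrite (@closed_connect _ _ (mem X) _ _ _ xy) // => u v /and3P[/= uZ vZ uv].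
apply/idP/idP => h; apply: contraTT uv => h'.
  by apply: noX; rewrite ?inE ?h'.
by rewrite gadjC; apply: noX; rewrite ?inE ?h'.
Qed.

Lemma connected_edge Z X x y : gconnected (subgraph Z) -> X \subset Z -> x \in X ->
  y \in Z :\: X -> exists2 u, u \in X & exists2 v, v \in Z :\: X & gadj L u v.
Proof.
move=> conZ XZ xX yZX; have [yX yZ] : y \notin X /\ y \in Z by move: yZX; rewrite inE =>
    /andP[].
case: (boolP [exists u in X, [exists v in Z :\: X, gadj L u v]]).
  by case/exists_inP=> u uX /exists_inP[v vZX uv]; exists u => //; exists v.
move=> no; case/negP: yX; apply: closed_reachable XZ _ (conZ _ _ (subsetP XZ _ xX) yZ) xX.
move=> u v uX vZX; apply: contra no => uv.
by apply/exists_inP; exists u => //; apply/exists_inP; exists v.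
Qed.

Section Bounds.
Variable N : nat.
Local Notation b := (a + 10)%N.

Lemma nbrsM_bound F v : inV F -> v \in V -> (size F < N)%N ->
  spec (nbrsM (map cd F) (cd v)) (map cd (nbrs F v)) (b * N).
Proof.
move=> FV vV FN; apply: spec_le (nbrsM_spec W_gt0 adjacent_spec FV vV).
by case: (list_costs a FN FN).
Qed.

Lemma has_adjacent_bound K v : inV K -> v \in V -> (size K < N)%N ->
  spec (existsM (adjacent (cd v)) (map cd K)) (has (gadj L v) K) (b * N).
Proof.
move=> KV vV KN; apply: spec_le (has_adjacent_spec W_gt0 adjacent_spec KV vV).
by case: (list_costs a KN KN).
Qed.

Lemma minusM_bound F K : inV F -> inV K -> (size F < N)%N -> (size K < N)%N ->
  spec (minusM (map cd F) (map cd K)) (map cd (minus F K)) (b * N ^ 2).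
Proof.
move=> FV KV FN KN; apply: spec_le (minusM_spec W_gt0 same_spec FV KV).
by case: (list_costs a FN KN) => _ [].
Qed.

Lemma bound_gt0 n : (n < N)%N -> (0 < b * N ^ 2)%N.
Proof. by move=> nN; rewrite muln_gt0 expn_gt0 addn_gt0 (leq_trans _ nN) ?orbT. Qed.

Lemma minus_nbrs R v : minus R (nbrs R v) = [seq u <- R | ~~ gadj L v u].
Proof. by apply: eq_in_filter => u uR; rewrite mem_filter uR andbT. Qed.

Lemma size_nbrs_minus R v : (size (nbrs R v) + size (minus R (nbrs R v)) = size R)%N.
Proof. by rewrite minus_nbrs !size_filter count_predC. Qed.

(** Two invariants drive the loop. Connectivity of the union of [U] and [R] yields an edge between
    them, so the search succeeds and removes a nonempty set; and each vertex of [U] has a block as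
    neighbourhood in [R], so the removed set is a block, simplicial by [link_simplicial]. *)
Lemma peelM_spec m U R : inV U -> inV R -> uniq R -> (size R <= m)%N ->
  (size U + size R < N)%N -> U != [::] -> {in U, forall v, v \notin R} ->
  gconnected (subgraph ([set v in U] :|: [set v in R])) ->
  {in U, forall v, block_set L (nbr (gof R) v)} ->
  exists p, [/\ spec (peelM m (map cd U) (map cd R)) (map (map cd) p) (7 * (b * N ^ 2) * m.+1),
    peeling (gof R) (map (fun K => [set v in K]) p) & {in p, forall K, uniq K /\ inV K}].
Proof.
have set_nil : [set v in [::]] = set0 :> {set T} by apply/setP=> v; rewrite !inE.
elim: m U R => [|m IH] U R UV RV uR Rm UN U0 UR conn bU.
  move: Rm; rewrite leqn0 => /nilP R0; exists [::]; rewrite R0 /= set_nil eqxx; split=> //.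
  apply: (@spec_le _ _ _ _ 1); last exact: spec_step (spec_ret _ _).
  by have := bound_gt0 UN; lia.
case: R RV uR Rm UN UR conn bU => [|r R'] RV uR Rm UN UR conn bU.
  exists [::]; rewrite /= set_nil eqxx; split=> //.
  apply: (@spec_le _ _ _ _ 1); last exact: spec_step (spec_ret _ _).
  by have := bound_gt0 UN; lia.
set R := r :: R' in RV uR Rm UN UR conn bU *.
have [v0 [v0U /hasP[w0 w0R vw0] findE]] : exists v, [/\ v \in U, has (gadj L v) R &
    ohead (filter (fun v => has (gadj L v) R) U) = Some v].
  case E: (filter _ U) => [|v s]; last first.
    have : v \in filter (fun v => has (gadj L v) R) U by rewrite E mem_head.
    by rewrite mem_filter => /andP[h vU]; exists v.
  have [y yU] : exists y, y \in U by case: (U) U0 => // y U' _; exists y; rewrite mem_head.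
  have [|||u uR' [v vU uv]] := connected_edge (X := [set v in R]) (x := r) (y := y) conn.
  - exact: subsetUr.
  - by rewrite !inE eqxx.
  - by move: (UR _ yU); rewrite !inE yU => ->.
  have {}vU : v \in U by move: vU; rewrite !inE; case: (_ || _) => //=; rewrite orbF.
  have : v \in filter (fun v => has (gadj L v) R) U.
    rewrite mem_filter vU andbT; apply/hasP; exists u; last by rewrite gadjC.
    by move: uR'; rewrite inE.
  by rewrite E.
have v0V := UV _ v0U.
set K := nbrs R v0; set R1 := minus R K.
have KV : inV K by apply: inV_filter.
have R1V : inV R1 by apply: inV_filter.
have szKR : (size K + size R1 = size R)%N by apply: size_nbrs_minus.
have K1 : (0 < size K)%N.
  by rewrite /K /nbrs size_filter -has_count; apply/hasP; exists w0.
have v0R1 : v0 \notin R1 by rewrite mem_filter negb_and (UR _ v0U) orbT.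
(* Thanks to this, [link_block] restores the second invariant for the vertices that move from [R] to
   [U]; for the old ones the neighbourhood only shrinks. *)
have v0nbr : nbr (gof R1) v0 = set0.
  by apply/setP=> u; rewrite -set_nbrs !inE mem_filter /R1 minus_nbrs mem_filter; case: gadj.
have bK : block_set L (nbr (gof R) v0) by apply: bU.
have [] := IH (U ++ K) R1.
- by move=> v; rewrite mem_cat => /orP[/UV|/KV].
- exact: R1V.
- exact: filter_uniq.
- by rewrite -ltnS (leq_trans _ Rm) // -szKR -[ltnLHS]add0n ltn_add2r.
- by rewrite size_cat -addnA szKR.
- by case: (U) U0.
- move=> v; rewrite mem_cat => /orP[vU|vK]; rewrite mem_filter negb_and.
    by rewrite (UR _ vU) orbT.
  by rewrite vK.
- congr (gconnected (subgraph _)): conn; apply/setP=> u.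
  rewrite !in_setU !in_set mem_cat !mem_filter.
  by case: (u \in U); case: (u \in R); case: gadj.
- move=> v; rewrite mem_cat => /orP[vU|].
    apply: block_set_sub (bU v vU); rewrite /gof set_minus -nbr_subgraphD; exact: subsetDl.
  rewrite mem_filter => /andP[v0v vR].
  by apply: (link_block L2 (v := v0)) => //; rewrite ?inE //; [apply: set_sub | apply: RV].
move=> p [sp pp up]; exists (K :: p); split.
- apply: (@spec_le _ _ _ _ ((2 * (b * N ^ 2)) + (b * N + (b * N ^ 2 + ((size U).+1 + 7 * (b * N
    ^ 2) * m.+1)))).+1).
    have UN' : (size U < N)%N by apply: leq_ltn_trans UN; apply: leq_addr.
    have [_ [_ [_ [_ [h h']]]]] := list_costs a UN UN.
    rewrite (mulnS (7 * (b * N ^ 2)) m.+1); have := bound_gt0 UN; move: UN' h h'.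
    move: (7 * (b * N ^ 2) * m.+1)%N => q.
    by move: (b * N ^ 2)%N (b * N)%N (size U); clear; lia.
  apply: spec_step => //.
  have UN' : (size U < N)%N by apply: leq_ltn_trans UN; apply: leq_addr.
  have RN : (size R < N)%N by apply: leq_ltn_trans UN; apply: leq_addl.
  have [_ [_ [c2 _]]] := list_costs a UN' UN'.
  apply: spec_bind.
    apply: spec_le c2 _; apply: findM_spec => // v vU.
    by apply: has_adjacent_bound => //; apply: UV.
  rewrite findE /=; apply: spec_bind (nbrsM_bound RV v0V RN) _; rewrite -/K.
  have KN : (size K < N)%N by apply: leq_ltn_trans RN; rewrite -szKR leq_addr.
  apply: spec_bind (minusM_bound RV KV RN KN) _.
  apply: spec_bind; first by rewrite -[size U](size_map cd); apply: appendM_spec.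
  by rewrite -map_cat; apply: spec_bind0 sp _; apply: spec_ret.
- rewrite /= gdel_gof pp andbT; apply/andP; split.
    by apply/set0Pn; exists w0; rewrite inE mem_filter vw0.
  rewrite set_nbrs; apply: (link_simplicial L2 (v := v0)) => //; first exact: set_sub.
  by rewrite inE; apply: UR.
move=> K'; rewrite inE => /predU1P[->|/up //]; split=> //; exact: filter_uniq.
Qed.

Lemma divide_PhiM_spec t p G z zb : inV G -> uniq G -> (size G < N)%N ->
  {in p, forall K, uniq K /\ inV K} -> {in p, forall K, (size K < N)%N} ->
  peeling (gof G) (map (fun K => [set v in K]) p) -> rat_bound zb z ->
  rspec zb (divide_PhiM t (map cd G) (map (map cd) p) z)
    (divide_Phi t (gof G) (map (fun K => [set v in K]) p) z)
    ((phi_cost a N t + b * N ^ 2 + 2) * size p + 1).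
Proof.
elim: p G z zb => [|K p IH] G z zb GV uG GN up pN.
  move=> _ bz; rewrite muln0 add0n; apply: rspec_step => //; exact: rspec_ret.
have [uK KV] := up K (mem_head _ _); have KN := pN K (mem_head _ _).
rewrite /= => /and3P[K0 sK pp] bz.
have gE := gdel_gof L G K; rewrite gE in pp *.
apply: (@rspec_le _ _ _ _ (phi_cost a N t + (1 + (b * N ^ 2 + ((phi_cost a N t + b * N ^ 2 + 2)
    * size p + 1)))).+1).
  by rewrite mulnS; lia.
apply: rspec_step => //; rewrite -[zb in rspec zb]addn0; apply: rspec_bindR.
  by apply: PhiM_spec sK.
move=> o _ bo; rewrite -[(zb + _)%N]add0n; apply: rspec_bindR; first exact: rdiv_rspec bz bo.
move=> o' _ bo'; apply: rspec_bind (minusM_bound GV KV GN KN) _.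
rewrite add0n; apply: IH => //.
- by apply: inV_filter.
- exact: filter_uniq.
- by apply: leq_ltn_trans GN; rewrite size_filter count_size.
- by move=> K' K'p; apply: up; rewrite inE K'p orbT.
by move=> K' K'p; apply: pN; rewrite inE K'p orbT.
Qed.

Definition countIS_cost t := (2 * (phi_cost a N t * N) + 14 * (b * N ^ 3))%N.

Lemma countIS_cost_le t (r p n : nat) : (r < N)%N -> (p <= n)%N -> (n < N)%N ->
  (((b * N ^ 2 + r.+1) + (7 * (b * N ^ 2) * r.+1 + ((phi_cost a N t + b * N ^ 2 + 2) * p +
      1))).+1
   <= countIS_cost t)%N.
Proof.
move=> rN pn nN; have h := bound_gt0 nN; have pN := leq_ltn_trans pn nN.
have h' : (N <= b * N ^ 2)%N by have [_ [_ [_ [_ [h1 h2]]]]] := list_costs a nN nN; apply: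
    leq_trans h2 h1.
have -> : countIS_cost t = (2 * (phi_cost a N t * N) + 14 * (b * N ^ 2 * N))%N.
  by rewrite /countIS_cost -mulnA -expnSr.
move: (phi_cost a N t) => c; move: (b * N ^ 2)%N h h' => B h h'.
have h1 : (7 * B * r.+1 <= 7 * B * N)%N by rewrite leq_mul2l rN orbT.
have h2 : ((c + B + 2) * p <= (c + B + 2) * N)%N by rewrite leq_mul2l (ltnW pN) orbT.
have h3 : (B * 1 <= B * N)%N by rewrite leq_mul2l; apply/orP; right; apply: leq_ltn_trans pN.
have h4 : (1 * N <= B * N)%N by rewrite leq_mul2r h orbT.
lia.
Qed.

Lemma CountIS_spec t G K : inV G -> uniq G -> (size G < N)%N -> uniq K -> K != [::] ->
  {subset K <= G} -> simplicial_block (gof G) [set v in K] -> gconnected (gof G) ->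
  exists q : seq {set T}, peeling (gdel (gof G) [set v in K]) q /\
    rspec 0 (CountIS (map cd G) (map cd K) t) (divide_Phi t (gof G) ([set v in K] :: q) 1)
      (countIS_cost t).
Proof.
move=> GV uG GN uK K0 KG sK conn.
have KV : inV K by move=> v /KG /GV.
have cKR : (size K + size (minus G K) = size G)%N.
  rewrite size_filter -(count_predC (mem K) G); congr (_ + _)%N.
  rewrite -size_filter; apply/perm_size/uniq_perm; rewrite ?filter_uniq // => v.
  by rewrite mem_filter; apply/idP/andP => [vK|[]//]; split=> //; apply: KG.
have KN : (size K < N)%N by apply: leq_ltn_trans GN; rewrite -cKR leq_addr.
have RN : (size (minus G K) < N)%N by apply: leq_ltn_trans GN; rewrite -cKR leq_addl.
have RV : inV (minus G K) by apply: inV_filter.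
have := sK; rewrite simplicial_subgraph => /and3P[_ bK /forall_inP bn].
have [] := @peelM_spec (size (minus G K)) K (minus G K) KV RV.
- exact: filter_uniq.
- by [].
- by rewrite cKR.
- by [].
- by move=> v vK; rewrite mem_filter vK.
- congr (gconnected (subgraph _)): conn; apply/setP=> v.
  rewrite !in_setU !in_set mem_filter; case vK: (v \in K) => //=; exact: KG.
- move=> v vK; have := bn v; rewrite inE vK nbr_subgraphD /gof set_minus; exact.
move=> p [sp pp up]; exists (map (fun K => [set v in K]) p).
rewrite gdel_gof; split=> //.
have peelK : peeling (gof G) (map (fun K => [set v in K]) (K :: p)).
  rewrite /= gdel_gof pp sK !andbT; case: (K) K0 => // k K' _.
  by apply/set0Pn; exists k; rewrite inE mem_head.
(* The blocks of a peeling are disjoint and nonempty, so neither their number nor their sizes exceed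
   the number of vertices; this bounds the calls of [PhiM]. *)
have peel_size q F : inV F -> uniq F -> peeling (gof F) (map (fun K => [set v in K]) q) ->
    {in q, forall K, uniq K /\ inV K} ->
    (size q <= size F)%N /\ {in q, forall K, (size K <= size F)%N}.
  elim: q F => [|Q q IH] F FV uF //= /and3P[Q0 sQ]; rewrite gdel_gof => pq uq.
  have [uQ QV] := uq Q (mem_head _ _).
  have uR : uniq (minus F Q) by rewrite filter_uniq.
  have RV' : inV (minus F Q) by apply: inV_filter.
  have uq' : {in q, forall K, uniq K /\ inV K}.
    by move=> Q' Q'q; apply: uq; rewrite inE Q'q orbT.
  have [IH1 IH2] := IH _ RV' uR pq uq'.
  move: sQ; rewrite simplicial_subgraph => /and3P[QF _ _].
  have cF : (#|[set v in Q]| + size (minus F Q) = size F)%N.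
    by rewrite -!card_set_seq // set_minus -(cardsID [set v in Q] [set v in F]) (setIidPr QF).
  have Q1 : (0 < #|[set v in Q]|)%N by rewrite card_gt0.
  split; first by rewrite -cF -add1n leq_add.
  move=> Q'; rewrite inE => /predU1P[->|/IH2 h].
    by rewrite -card_set_seq // -cF leq_addr.
  by apply: leq_trans h _; rewrite -cF leq_addl.
have upK : {in K :: p, forall K, uniq K /\ inV K}.
  by move=> Q; rewrite inE => /predU1P[->|/up].
have [szp szQ] := peel_size _ _ GV uG peelK upK.
have pN : {in K :: p, forall K, (size K < N)%N}.
  by move=> Q /szQ h; apply: leq_ltn_trans h GN.
have one : rat_bound 0 1 by apply: (@rat_bound_nat 1).
have dv := divide_PhiM_spec t GV uG GN upK pN peelK one.
apply: (@rspec_le _ _ _ _ ((b * N ^ 2 + (size (minus G K)).+1) + (7 * (b * N ^ 2) * (size (minus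
    G K)).+1 + ((phi_cost a N t + b * N ^ 2 + 2) * size (K :: p) + 1))).+1).
  exact: countIS_cost_le RN szp GN.
apply: rspec_step => //; rewrite -addnA; apply: rspec_bind (minusM_bound GV KV GN KN) _.
apply: rspec_bind; first by rewrite -[size (minus G K)](size_map cd); apply: lengthM_spec.
rewrite size_map; apply: rspec_bind sp _.
exact: dv.
Qed.
End Bounds.

End Peeling.

(** * Non-cut vertices, and components given as lists *)

Section Connectivity.
Variables (T : finType) (L : graph T).
Local Notation V := (vset L).
Local Notation subgraph := (subgraph L).
Local Notation gof := (gof L).
Implicit Types (F C S : seq T) (cs : seq (seq T)) (u v x y : T) (X Y Z : {set T}).

Definition connected_set X := [forall x in X, forall y in X, reachable (subgraph X) x y].

Lemma connectedP X : reflect (gconnected (subgraph X)) (connected_set X).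
Proof.
apply: (iffP forall_inP) => [h x y xX yX|h x xX]; first by move/forall_inP: (h x xX); apply.
by apply/forall_inP=> y yX; apply: h.
Qed.

Lemma reachable_sym X x y : reachable (subgraph X) x y = reachable (subgraph X) y x.
Proof. by apply: sym_connect_sym => u v /=; rewrite gadjC andbCA. Qed.

Lemma reachable_sub X Y x y : X \subset Y ->
  reachable (subgraph X) x y -> reachable (subgraph Y) x y.
Proof.
move=> XY; apply: connect_sub => u v /and3P[uX vX uv].
by apply: reachable_edge => //; apply: (subsetP XY).
Qed.

Lemma connected_root X x : {in X, forall y, reachable (subgraph X) x y} ->
    gconnected (subgraph X).
Proof.
move=> h y z yX zX; apply: connect_trans (h z zX).
by rewrite -/(reachable _ _ _) reachable_sym; apply: h.
Qed.

Lemma connected_setU1 X u v : gconnected (subgraph X) -> u \in X -> gadj L u v ->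
  gconnected (subgraph (v |: X)).
Proof.
move=> conn uX uv; apply: (@connected_root _ u) => y; rewrite !inE => /predU1P[->|yX].
  by apply: reachable_edge; rewrite ?inE ?uX ?eqxx ?orbT.
by apply: reachable_sub (conn _ _ uX yX); apply: subsetUr.
Qed.

(** Take a largest connected proper subset [S] and a vertex [w] adjacent to it. Then [w |: S] is
    connected, hence equal to [X] by maximality, and [w] is the vertex to remove. If [S] is empty,
    any vertex serves. *)
Lemma noncut_vertex X : gconnected (subgraph X) -> X != set0 ->
  exists2 v, v \in X & gconnected (subgraph (X :\ v)).
Proof.
move=> conn X0; pose P (S : {set T}) := (S \proper X) && connected_set S; have P0 : P set0.
  by rewrite /P proper0 X0; apply/connectedP => x y; rewrite inE.
case: (@arg_maxnP _ _ P (fun S : {set T} => #|S|) P0) => S /andP[SX /connectedP cS] maxS.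
have maxS' w : w \in X -> w \notin S -> gconnected (subgraph (w |: S)) -> w |: S = X.
  move=> wX wS cwS; apply/eqP; rewrite eqEsubset subUset sub1set wX (proper_sub SX) /=.
  apply: contraT => nXS; have := maxS (w |: S);
      rewrite /P properE subUset sub1set wX (proper_sub SX) nXS.
  by move/connectedP: cwS => -> /(_ isT); rewrite /= cardsU1 wS add1n ltnn.
have [w [wX wS cwS]] : exists w, [/\ w \in X, w \notin S & gconnected (subgraph (w |: S))].
  have /properP[_ [y yX yS]] := SX.
  have [S0|[x xS]] := set_0Vmem S.
    exists y; split=> //; rewrite S0 setU0 => u v; rewrite !inE => /eqP-> /eqP->; exact:
        connect0.
  have yXS : y \in X :\: S by rewrite inE yS.
  have [u uS [v vXS uv]] := connected_edge conn (proper_sub SX) xS yXS.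
  by move: vXS; rewrite inE => /andP[vS vX]; exists v; split=> //; apply: connected_setU1 uv.
exists w => //; rewrite -(maxS' w) // setU1K //.
Qed.

(* The lists in cs are the connected components of the list F. *)
Definition component_lists F cs : Prop :=
  [/\ perm_eq (flatten cs) F,
      {in cs, forall C, C != [::] /\ gconnected (gof C)}
    & {in cs, forall C, {in C & F, forall x y, gadj L x y -> y \in C}}].

Definition as_set F : {set T} := [set v in F].

Lemma uniq_as_set cs : uniq (flatten cs) -> {in cs, forall C, C != [::]} ->
    uniq (map as_set cs).
Proof.
elim: cs => //= C cs IH; rewrite cat_uniq => /and3P[_ /hasPn dis uf] ne.
rewrite IH // ?andbT => [|C' C'cs]; last by apply: ne; rewrite inE C'cs orbT.
apply/mapP=> -[C' C'cs E]; have := ne C (mem_head _ _).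
case: C E {dis ne} (dis) => // x C E dis _.
have /dis : x \in flatten cs.
  by apply/flattenP; exists C' => //; move/setP/(_ x): E; rewrite !inE eqxx /= => <-.
by rewrite /= mem_head.
Qed.

(** A connected set that no edge leaves is the reachability class of each of its elements. *)
Lemma components_lists F cs : uniq F -> component_lists F cs ->
  uniq (map as_set cs) /\ components (gof F) =i map as_set cs.
Proof.
move=> uF [pF ne cl]; split.
  by apply: uniq_as_set => [|C /ne[]//]; rewrite (perm_uniq pF).
have part := components_partition L (as_set F); have /and3P[/eqP cov tiP P0] := part.
have sub C : C \in cs -> {subset C <= F}.
  by move=> Ccs x xC; rewrite -(perm_mem pF); apply/flattenP; exists C.
have block C x : C \in cs -> x \in C -> pblock (components (gof F)) x = as_set C.
  move=> Ccs xC; have [_ conn] := ne C Ccs.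
  have xF : x \in as_set F by rewrite inE; apply: sub xC.
  have CF : as_set C \subset as_set F.
    by apply/subsetP=> y; rewrite !inE; apply: sub.
  apply/setP=> y; apply/idP/idP => h.
    have yF : y \in as_set F.
      by rewrite -cov; apply/bigcupP; exists (pblock (components (gof F)) x) => //;
        apply: pblock_mem; rewrite cov.
    move: h; rewrite (pblock_equivalence_partition (@reachable_equivalence _ L (as_set F))) //
        => xy.
    apply: closed_reachable CF _ xy _; last by rewrite inE.
    move=> u v; rewrite !inE => uC /andP[vC vF]; apply: contra vC.
    exact: (cl C Ccs).
  have yF : y \in as_set F by apply: (subsetP CF).
  rewrite (pblock_equivalence_partition (@reachable_equivalence _ L (as_set F))) //.
  by apply: reachable_sub CF _; apply: conn; rewrite ?inE //; move: h; rewrite inE.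
move=> A; apply/idP/mapP => [AP|[C Ccs ->]].
  have [A0|[x xA]] := set_0Vmem A; first by rewrite -A0 AP in P0.
  have xF : x \in as_set F by rewrite -cov; apply/bigcupP; exists A.
  have /flattenP[C Ccs xC] : x \in flatten cs by rewrite (perm_mem pF); move: xF; rewrite inE.
  by exists C => //; rewrite -(block C x) // (def_pblock tiP AP xA).
have [] := ne C Ccs; case E : C => [|x C'] // _ _;
    rewrite -E -(block C x) ?E ?mem_head // -?E //.
apply: pblock_mem; rewrite cov inE; apply: sub Ccs _ _; by rewrite E mem_head.
Qed.

Lemma prod_component_lists F cs (f : {set T} -> rat) : uniq F -> component_lists F cs ->
  \prod_(C in components (gof F)) f C = \prod_(C <- cs) f (as_set C).
Proof.
move=> uF cF; have [ucs mem] := components_lists uF cF.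
by rewrite -(big_map as_set xpredT) big_uniq //; apply: eq_bigl.
Qed.

Lemma uniq_map_inj (A B : eqType) (f : A -> B) (s : seq A) : uniq (map f s) -> {in s &,
    injective f}.
Proof.
elim: s => //= x s IH /andP[nfx us] y z; rewrite !inE => /predU1P[->|ys] /predU1P[->|zs] // E.
- by case/negP: nfx; rewrite E map_f.
- by case/negP: nfx; rewrite -E map_f.
exact: IH.
Qed.

(** The run relation assigns values to components as sets, while the program computes them from
    lists. The transfer works because distinct lists of [cs] have distinct underlying sets. *)
Lemma as_set_choice F cs (g : seq T -> rat) : uniq F -> component_lists F cs ->
  exists f : {set T} -> rat, {in cs, forall C, f (as_set C) = g C}.
Proof.
move=> uF cF; have [/uniq_map_inj inj _] := components_lists uF cF.
exists (fun X => g (nth [::] cs (index X (map as_set cs)))) => C Ccs.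
by rewrite nth_index_map.
Qed.

End Connectivity.

(** * Reachability search and the splitting into components *)

Section Loops.
Variables (T : finType) (L : graph T) (cd : T -> hedge) (a W : nat).
Local Notation V := (vset L).
Local Notation subgraph := (subgraph L).
Hypothesis L2 : locally_two_cliques L.
Hypothesis W_gt0 : (0 < W)%N.
Local Notation spec := (spec W).
Local Notation rspec := (rspec W).
Local Notation gof := (gof L).
Local Notation inV := (inV L).
Local Notation nbrs := (nbrs L).
Hypothesis same_spec : {in V &, forall e f, spec (same (cd e) (cd f)) (e == f) a}.
Hypothesis adjacent_spec : {in V &, forall e f, spec (adjacent (cd e) (cd f)) (gadj L e f) a}.
Implicit Types (F G K R S U C : seq T) (u v : T) (X Z : {set T}) (cs : seq (seq T)).
Variable N : nat.
Local Notation b := (a + 10)%N.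
Local Notation B k := ((a + 10) * N ^ k)%N.

(** Every round but the last moves a vertex out of [R], so [size R] rounds suffice to reach a set
    that no edge leaves. *)
Lemma growM_spec m S R v : inV S -> inV R -> uniq R -> (size R <= m)%N ->
  (size S + size R < N)%N -> v \in S -> {in S, forall x, reachable (gof S) v x} ->
  exists S' R', [/\ spec (growM m (map cd S) (map cd R)) (map cd S',
      map cd R') (5 * B 2 * m.+1),
    perm_eq (S' ++ R') (S ++ R), v \in S', {in S', forall x, reachable (gof S') v x}
    & {in S' & R', forall x y, ~~ gadj L x y}].
Proof.
elim: m S R => [|m IH] S R SV RV uR Rm SRN vS reach.
  move: Rm; rewrite leqn0 => /nilP ->; exists S, [::]; split=> //.
  apply: (@spec_le _ _ _ _ 1); last by apply: spec_step => //; apply: spec_ret.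
  by have := bound_gt0 a SRN; lia.
have SN : (size S < N)%N by apply: leq_ltn_trans SRN; apply: leq_addr.
have RN : (size R < N)%N by apply: leq_ltn_trans SRN; apply: leq_addl.
have [_ [_ [c2 [_ [h1 h2]]]]] := list_costs a RN RN.
set Q := [seq u <- R | has (gadj L u) S].
have filt : spec (filterM (fun u : hedge => existsM (adjacent u) (map cd S)) (map cd R)) (map cd
    Q) (2 * B 2).
  apply: spec_le c2 _; apply: filterM_spec => // u uR'.
  by apply: has_adjacent_bound => //; apply: RV.
have RQ : minus R Q = [seq u <- R | ~~ has (gadj L u) S].
  by apply: eq_in_filter => u uR'; rewrite mem_filter uR' andbT.
have QV : inV Q by apply: inV_filter.
have szQ : (size Q + size (minus R Q) = size R)%N by rewrite RQ !size_filter count_predC.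
have QN : (size Q < N)%N by apply: leq_ltn_trans RN; rewrite -szQ leq_addr.
case QE : Q => [|q Q'].
  exists S, R; split=> //.
    apply: (@spec_le _ _ _ _ (2 * B 2 + 0).+1).
      rewrite addn0 mulnS; have := bound_gt0 a SRN; move: (5 * B 2 * m.+1)%N => q; lia.
    apply: spec_step => //; apply: spec_bind filt _; rewrite QE; exact: spec_ret.
  move=> x y xS yR; apply/negP => xy.
  have : y \in Q by rewrite mem_filter yR andbT; apply/hasP; exists x; rewrite // gadjC.
  by rewrite QE.
have [] := IH (S ++ Q) (minus R Q).
- by move=> x; rewrite mem_cat => /orP[/SV|/QV].
- by apply: inV_filter.
- exact: filter_uniq.
- by rewrite -ltnS (leq_trans _ Rm) // -szQ QE /= addSn ltnS leq_addl.
- by rewrite size_cat -addnA szQ.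
- by rewrite mem_cat vS.
- have mono x y : reachable (gof S) x y -> reachable (gof (S ++ Q)) x y.
    by apply: reachable_sub; apply/subsetP=> z; rewrite !inE mem_cat => ->.
  move=> x; rewrite mem_cat => /orP[xS|]; first by apply/mono/reach.
  rewrite mem_filter => /andP[/hasP[y yS xy] xR].
  apply: connect_trans (mono _ _ (reach _ yS)) _; apply: reachable_edge; last by rewrite gadjC.
    by rewrite inE mem_cat yS.
  by rewrite inE mem_cat mem_filter xR andbT; apply/orP; right; apply/hasP; exists y.
move=> S' [R' [sp pe vS' reach' sep]]; exists S', R'; split=> //; last first.
  apply: perm_trans pe _; rewrite -catA perm_cat2l /Q RQ perm_filterC //.
apply: (@spec_le _ _ _ _ (2 * B 2 + ((size S).+1 + (B 2 + 5 * B 2 * m.+1))).+1).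
  rewrite [leqRHS]mulnS; move: (5 * B 2 * m.+1)%N => r; move: h1 h2 SN.
  move: (B 2) (b * N)%N (size S); clear; lia.
apply: spec_step => //; apply: spec_bind filt _; rewrite QE /=.
rewrite -[cd q :: _]/(map cd (q :: Q')) -QE.
apply: spec_bind; first by rewrite -[size S](size_map cd); apply: appendM_spec.
apply: spec_bind; first exact: (minusM_bound W_gt0 same_spec RV QV RN QN).
by rewrite -map_cat.
Qed.

Lemma cost_bounds n : (n < N)%N -> [/\ (0 < N)%N, (0 < B 2)%N, (N <= B 2)%N, B 3 = (B 2 * N)%N &
    B 4 = (B 3 * N)%N].
Proof.
move=> nN; have [_ [_ [_ [N0 [h1 h2]]]]] := list_costs a nN nN; split=> //.
- exact: bound_gt0 nN.
- exact: leq_trans h1.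
- by rewrite -mulnA -expnSr.
by rewrite -mulnA -expnSr.
Qed.

Lemma growM_cons v R : inV (v :: R) -> uniq (v :: R) -> (size (v :: R) < N)%N -> forall m,
    (size R <= m)%N ->
  exists S' R', [/\ spec (growM m [:: cd v] (map cd R)) (map cd S', map cd R') (5 * B 2 * m.+1),
    perm_eq (S' ++ R') (v :: R), v \in S', {in S', forall x, reachable (gof S') v x}
    & {in S' & R', forall x y, ~~ gadj L x y}].
Proof.
move=> FV /andP[vR uR] FN m Rm.
have RV : inV R by move=> x xR; apply: FV; rewrite inE xR orbT.
have vV : inV [:: v] by move=> x; rewrite inE => /eqP->; apply: FV; rewrite mem_head.
apply: (growM_spec vV RV uR Rm FN) => [|x]; first by rewrite mem_head.
by rewrite inE => /eqP->; apply: connect0.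
Qed.

Lemma connectedM_spec F : inV F -> uniq F -> (size F < N)%N ->
  spec (connectedM (map cd F)) (connected_set L [set v in F]) (7 * B 3).
Proof.
move=> FV uF FN; have [N0 B0 NB -> _] := cost_bounds FN.
case: F FV uF FN => [|v R] FV uF FN.
  have -> : connected_set L [set v in [::]] by apply/connectedP=> x y; rewrite inE.
  apply: (@spec_le _ _ _ _ 1); last by apply: spec_step => //; apply: spec_ret.
  by rewrite !muln_gt0 addn_gt0 ?expn_gt0 N0 !orbT.
have [S' [R' [sp pe vS reach sep]]] := growM_cons FV uF FN (leqnn _).
apply: (@spec_le _ _ _ _ ((size R).+1 + 5 * B 2 * (size R).+1).+1).
  have : (5 * B 2 * (size R).+1 <= 5 * B 2 * N)%N by rewrite leq_mul2l (ltnW FN) orbT.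
  have : (N <= B 2 * N)%N by rewrite leq_pmull.
  move: FN; rewrite /= -!mulnA; move: (B 2 * N)%N (5 * _)%N; clear; lia.
apply: spec_step => //.
apply: spec_bind; first by rewrite -[size R](size_map cd); apply: lengthM_spec.
rewrite size_map; apply: spec_bind0 sp _ => /=.
suff -> : connected_set L [set x in v :: R] = (if map cd R' is [::] then true else false) by
    apply: spec_ret.
case: R' pe sep => [|r R'] pe sep.
  apply/connectedP; rewrite cats0 in pe.
  have -> : [set x in v :: R] = [set x in S'] by apply/setP=> x; rewrite !in_set (perm_mem pe).
  by apply: (@connected_root _ _ _ v) => y; rewrite inE; apply: reach.
apply/negP=> /connectedP conn.
have mem x : (x \in [set x in v :: R]) = (x \in S') || (x \in r :: R').
  by rewrite in_set -(perm_mem pe) mem_cat.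
have uSR : uniq (S' ++ r :: R') by rewrite (perm_uniq pe).
have rS : r \notin S'.
  by move: uSR; rewrite cat_uniq => /and3P[_ /hasPn/(_ r) + _]; apply; rewrite mem_head.
case/negP: rS; suff : r \in [set x in S'] by rewrite inE.
apply: (@closed_reachable _ L [set x in v :: R] _ v r).
- by apply/subsetP=> x; rewrite mem inE => ->.
- move=> x y; rewrite inE in_setD mem inE => xS /andP[yS]; rewrite (negPf yS) /=.
  exact: sep.
- by apply: conn; rewrite mem ?vS // mem_head orbT.
by rewrite inE.
Qed.

(** A component of the remainder [R'] is also closed in [F], since no edge joins [R'] to the part
    [S'] split off before. *)
Lemma splitM_spec m F : inV F -> uniq F -> (size F <= m)%N -> (size F < N)%N -> (m < N)%N ->
  exists cs, spec (splitM m (map cd F)) (map (map cd) cs) (6 * B 3 * m + 1) /\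
      component_lists L F cs.
Proof.
elim: m F => [|m IH] F FV uF Fm FN mN.
  move: Fm; rewrite leqn0 => /nilP ->; exists [::]; split=> //.
  by rewrite muln0; apply: spec_step => //; apply: spec_ret.
case: F FV uF Fm FN => [|v R] FV uF Fm FN.
  exists [::]; split=> //; apply: (@spec_le _ _ _ _ 1); first by rewrite addn1.
  by apply: spec_step => //; apply: spec_ret.
have [S' [R' [sp pe vS reach sep]]] := growM_cons FV uF FN Fm.
have mem x : (x \in v :: R) = (x \in S') || (x \in R') by rewrite -(perm_mem pe) mem_cat.
have uSR : uniq (S' ++ R') by rewrite (perm_uniq pe).
have [uS /hasPn dis uR'] := and3P (etrans (esym (cat_uniq _ _)) uSR).
have RV' : inV R' by move=> x xR; apply: FV; rewrite mem xR orbT.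
have szR : (size S' + size R' = (size R).+1)%N by rewrite -size_cat (perm_size pe).
have S1 : (0 < size S')%N by case: (S') vS.
have Rm : (size R' <= m)%N by move: Fm; rewrite /= -szR; move: S1; clear; lia.
have RN : (size R' < N)%N by apply: leq_ltn_trans FN; rewrite /= -szR leq_addl.
have [cs [sp' [pf ne cl]]] := IH R' RV' uR' Rm RN (ltnW mN).
exists (S' :: cs); split; last split.
- have [N0 B0 NB B3 _] := cost_bounds FN.
  apply: (@spec_le _ _ _ _ (5 * B 2 * m.+1 + (6 * B 3 * m + 1)).+1).
    have h : (5 * B 2 * m.+1 <= 5 * B 2 * N)%N by rewrite leq_mul2l (ltnW mN) orbT.
    have B1 : (0 < B 2 * N)%N by rewrite muln_gt0 B0 N0.
    rewrite B3 [in ltnRHS]mulnS; rewrite -mulnA in h; move: h B1.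
    rewrite -!mulnA; move: (B 2 * N)%N (5 * (B 2 * m.+1))%N (6 * _)%N; clear; lia.
  apply: spec_step => //; apply: spec_bind sp _ => /=.
  by apply: spec_bind0 sp' _; apply: spec_ret.
- by rewrite /=; apply: perm_trans pe; rewrite perm_cat2l.
- move=> C; rewrite inE => /predU1P[->|/ne //]; split; first by case: (S') vS.
  by apply: (@connected_root _ _ _ v) => y; rewrite inE; apply: reach.
move=> C; rewrite inE => /predU1P[->|Ccs] x y xC.
  by rewrite mem => /orP[//|yR xy]; case/negP: (sep _ _ xC yR).
have CR : {subset C <= R'} by move=> z zC; rewrite -(perm_mem pf); apply/flattenP; exists C.
rewrite mem => /orP[yS xy|]; last exact: cl.
by case/negP: (sep _ _ yS (CR _ xC)); rewrite gadjC.
Qed.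

Lemma componentsM_spec F : inV F -> uniq F -> (size F < N)%N ->
  exists cs, spec (componentsM (map cd F)) (map (map cd) cs) (10 * B 4) /\
      component_lists L F cs.
Proof.
move=> FV uF FN; have [cs [sp cF]] := splitM_spec FV uF (leqnn _) FN FN; exists cs; split=> //.
have [N0 B0 NB B3 ->] := cost_bounds FN.
have h1 : (6 * B 3 * size F <= 6 * B 3 * N)%N by rewrite leq_mul2l (ltnW FN) orbT.
have B30 : (0 < B 3)%N by rewrite muln_gt0 addn_gt0 ?expn_gt0 N0 !orbT.
have h2 : (N <= B 3 * N)%N by rewrite leq_pmull.
apply: (@spec_le _ _ _ _ ((size F).+1 + (6 * B 3 * size F + 1)).+1).
  move: FN h1 h2; rewrite -!mulnA; move: (B 3 * N)%N (6 * (B 3 * size F))%N (size F); clear;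
      lia.
apply: spec_step => //.
apply: spec_bind; first by rewrite -[size F](size_map cd); apply: lengthM_spec.
by rewrite size_map.
Qed.

End Loops.

(** * The increment, the main loop and the whole program *)

Section Counting.
Variables (T : finType) (L : graph T) (cd : T -> hedge) (a W : nat).
Local Notation V := (vset L).
Local Notation subgraph := (subgraph L).
Hypothesis L2 : locally_two_cliques L.
Hypothesis W_gt0 : (0 < W)%N.
Local Notation spec := (spec W).
Local Notation rspec := (rspec W).
Local Notation gof := (gof L).
Local Notation inV := (inV L).
Local Notation nbrs := (nbrs L).
Hypothesis same_spec : {in V &, forall e f, spec (same (cd e) (cd f)) (e == f) a}.
Hypothesis adjacent_spec : {in V &, forall e f, spec (adjacent (cd e) (cd f)) (gadj L e f) a}.
Implicit Types (F G K R S U C : seq T) (u v : T) (X Z : {set T}) (cs : seq (seq T)).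
Variable N : nat.
Local Notation b := (a + 10)%N.
Local Notation B k := ((a + 10) * N ^ k)%N.
Lemma set_cons_nbrs F v : [set u in v :: nbrs F v] = v |: nbr (gof F) v.
Proof. by apply/setP=> u; rewrite !inE mem_filter [(u \in F) && _]andbC. Qed.

Definition increment_cost t := (2 * (phi_cost a N t * N ^ 2) + 40 * B 4)%N.

Lemma increment_cost_le t k n : (k <= N)%N -> (n < N)%N ->
  (((a + 10) * N + (B 2 + (10 * B 4 +
     ((2 * B 2 + (a + 10) * N + countIS_cost a N t + 2) * k + 1)))).+1 <= increment_cost t)%N.
Proof.
move=> kN nN; have [N0 B0 NB B3 B4] := cost_bounds a nN.
have [_ [_ [_ [_ [h1 h2]]]]] := list_costs a nN nN.
rewrite /increment_cost /countIS_cost.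
have h3 : ((2 * B 2 + (a + 10) * N + (2 * (phi_cost a N t * N) + 14 * B 3) + 2) * k <=
   (2 * B 2 + (a + 10) * N + (2 * (phi_cost a N t * N) + 14 * B 3) + 2) * N)%N.
  by rewrite leq_mul2l kN orbT.
have h4 : ((a + 10) * N * N <= B 2 * N)%N by rewrite leq_mul2r h1 orbT.
have h5 : (N <= B 2 * N)%N by rewrite leq_pmull.
have h6 : (B 2 * N <= B 2 * N * N)%N by rewrite leq_pmulr.
have h7 : (B 2 <= B 2 * N)%N by rewrite leq_pmulr.
have B4' : B 4 = (B 2 * N * N)%N by rewrite B4 B3.
have -> : (phi_cost a N t * N ^ 2)%N = (phi_cost a N t * N * N)%N by rewrite -mulnA mulnn.
rewrite B4' B3 in h3 *; move: h1 h2 h3 h4 h5 h6 h7 NB B0 N0 {B3 B4 B4'}.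
move: (phi_cost a N t) (B 2) ((a + 10) * N)%N => p B2 bN.
move=> h1 h2 h3 h4 h5 h6 h7 NB B0 N0; nia.
Qed.

Lemma size_component_lists cs : {in cs, forall C, C != [::]} ->
    (size cs <= size (flatten cs))%N.
Proof.
elim: cs => //= C cs IH ne; rewrite size_cat -add1n leq_add ?IH //.
  by have := ne C (mem_head _ _); case: C {ne}.
by move=> D Dcs; apply: ne; rewrite inE Dcs orbT.
Qed.

(** Connectedness of [F] guarantees that each component of what remains is adjacent to a neighbour
    of [v], so the search for [u] never fails. *)
Lemma incrementM_spec t F v : inV F -> uniq F -> (size F < N)%N -> v \in F ->
    gconnected (gof F) ->
  increment_run t (gof F) v (result (incrementM t (map cd F) (cd v))) /\
  rspec 0 (incrementM t (map cd F) (cd v)) (result (incrementM t (map cd F) (cd v)))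
      (increment_cost t).
Proof.
move=> FV uF FN vF conn; have vV := FV _ vF.
set Q := nbrs F v; set G := minus F (v :: Q).
have QF : {subset Q <= F} by move=> x; rewrite mem_filter => /andP[].
have QV : inV Q by move=> x /QF /FV.
have vQ : v \notin Q by rewrite mem_filter gadj_irr.
have QN : (size Q < N)%N by apply: leq_ltn_trans FN; rewrite size_filter count_size.
have vQN : (size (v :: Q) < N)%N.
  apply: leq_ltn_trans FN; apply: uniq_leq_size; first by rewrite /= vQ filter_uniq.
  by move=> x; rewrite inE => /predU1P[->|/QF].
have vQV : inV (v :: Q) by move=> x; rewrite inE => /predU1P[->|/QV].
have GV : inV G by apply: inV_filter.
have uG : uniq G by rewrite filter_uniq.
have GN : (size G < N)%N by apply: leq_ltn_trans FN; rewrite size_filter count_size.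
have [cs [sc cG]] := componentsM_spec W_gt0 same_spec adjacent_spec GV uG GN.
have [pG ne cl] := cG.
have CG C : C \in cs -> {subset C <= G}.
  by move=> Ccs x xC; rewrite -(perm_mem pG); apply/flattenP; exists C.
have uC C : C \in cs -> uniq C.
  move=> Ccs; have : uniq (flatten cs) by rewrite (perm_uniq pG).
  elim: (cs) Ccs => // D ds IH; rewrite inE /= cat_uniq => CD /and3P[uD _ uds].
  by case/predU1P: CD => [-> //|/IH]; apply.
pose body (C : seq hedge) : costed rat :=
   (let* o := findM (fun u : hedge => existsM (adjacent u) C) (map cd Q) in
     match o with
     | Some u => let* K := nbrsM C u in CountIS C K t
     | None => ret 1
     end).
have bodyP C : C \in cs ->
  (exists u, [/\ u \in nbr (gof F) v, nbr (gof F) u :&: as_set C != set0 &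
    CountIS_run (gof C) (nbr (gof F) u :&: as_set C) t (result (body (map cd C)))]) /\
  rspec 0 (body (map cd C)) (result (body (map cd C))) (2 * B 2 + (a + 10) * N + countIS_cost a
      N t).
  move=> Ccs; have [C0 connC] := ne C Ccs.
  have CV : inV C by move=> x /(CG _ Ccs) /GV.
  have CN : (size C < N)%N.
    by apply: leq_ltn_trans GN; apply: uniq_leq_size; [exact: uC | exact: CG].
  have CF : {subset C <= F} by move=> x /(CG _ Ccs); rewrite mem_filter => /andP[].
  have CQ x : x \in C -> x \notin v :: Q by move/(CG _ Ccs); rewrite mem_filter => /andP[].
  have [_ [_ [c2 _]]] := list_costs a QN QN.
  have find : spec (findM (fun u : hedge => existsM (adjacent u) (map cd C)) (map cd Q))
      (omap cd (ohead [seq u <- Q | has (gadj L u) C])) (2 * B 2).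
    apply: spec_le c2 _; apply: findM_spec => // u uQ.
    by apply: has_adjacent_bound => //; apply: QV.
  have [u uQ [hasu findu]] : exists2 u, u \in Q & has (gadj L u) C /\
     ohead [seq u <- Q | has (gadj L u) C] = Some u.
    case E : [seq u <- Q | has (gadj L u) C] => [|u Q']; last first.
      have : u \in [seq u <- Q | has (gadj L u) C] by rewrite E mem_head.
      by rewrite mem_filter => /andP[hu uQ]; exists u.
    have [x xC] : exists x, x \in C by case: (C) C0 => // x C' _; exists x; rewrite mem_head.
    have CsF : as_set C \subset as_set F by apply/subsetP=> y; rewrite !inE; apply: CF.
    have vFC : v \in as_set F :\: as_set C.
      by rewrite !inE vF andbT; apply/negP=> /CQ; rewrite mem_head.
    have xC' : x \in as_set C by rewrite inE.
    (* An edge from [C] to the rest of [F] ends in [v :: Q], because [C] is closed within [G]; and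
       it does not end in [v], because [y] is not a neighbour of [v]. *)
    have [y yC [w wFC yw]] := connected_edge conn CsF xC' vFC.
    rewrite !inE in yC wFC; case/andP: wFC => wC wF.
    have wvQ : w \in v :: Q.
      apply: contraR wC => wvQ; apply: (cl C Ccs y w yC) => //.
      by rewrite mem_filter wvQ.
    have wQ : w \in Q.
      move: wvQ; rewrite inE => /predU1P[wv|//]; have := CQ _ yC.
      by rewrite inE negb_or mem_filter (CF _ yC) -wv gadjC yw andbF.
    have : w \in [seq u <- Q | has (gadj L u) C].
      by rewrite mem_filter wQ andbT; apply/hasP; exists y; rewrite // gadjC.
    by rewrite E.
  rewrite findu in find; have uV := QV _ uQ.
  have uN : u \in nbr (gof F) v by rewrite -set_nbrs inE.
  have KE : nbr (gof F) u :&: as_set C = [set w in nbrs C u].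
    apply/setP=> w; rewrite !inE mem_filter /=; case wC: (w \in C); rewrite ?andbF //.
    by rewrite CF // !andbT.
  have CX : as_set C \subset [set w in F] :\: (v |: nbr (gof F) v).
    rewrite -set_cons_nbrs -set_minus; apply/subsetP=> x; rewrite !inE; exact: CG.
  have vX : v \in [set w in F] by rewrite inE.
  have sK : simplicial_block (gof C) [set w in nbrs C u].
    have h := component_simplicial L2 (set_sub FV) vX CX uN; rewrite set_nbrs; exact h.
  have K0 : nbrs C u != [::].
    case/hasP: hasu => x xC ux; have xK : x \in nbrs C u by rewrite mem_filter ux.
    by apply/eqP=> E; rewrite E in xK.
  have uK : uniq (nbrs C u) by rewrite filter_uniq // uC.
  have KC : {subset nbrs C u <= C} by move=> x; rewrite mem_filter => /andP[].
  have [p [pp rs]] := CountIS_spec L2 W_gt0 same_spec adjacent_spec t CV (uC _ Ccs) CN uK K0 KC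
      sK connC.
  have nb := nbrsM_bound W_gt0 adjacent_spec CV uV CN.
  have rb : rspec 0 (body (map cd C)) (divide_Phi t (gof C) ([set w in nbrs C u] :: p) 1)
     (2 * B 2 + ((a + 10) * N + countIS_cost a N t)).
    by apply: rspec_bind find _; rewrite /=; apply: rspec_bind nb _.
  have rE : result (body (map cd C)) = divide_Phi t (gof C) ([set w in nbrs C u] ::
      p) 1 by case: rb.
  rewrite rE -addnA; split=> //; exists u; split=> //.
    rewrite KE; case: (nbrs C u) K0 => // x s _.
    by apply/set0Pn; exists x; rewrite inE mem_head.
  by rewrite KE; exists p.
pose g C := result (body (map cd C)).
have [zc zcE] := as_set_choice g uG cG.
have rs : rspec 0 (incrementM t (map cd F) (cd v)) (\prod_(C <- cs) g C) (increment_cost t).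
  have szcs : (size cs <= N)%N.
    apply: leq_trans (ltnW GN); rewrite -(perm_size pG).
    by apply: size_component_lists => C /ne[].
  apply: (rspec_le (increment_cost_le t szcs GN)); apply: rspec_step => //.
  apply: rspec_bind (nbrsM_bound W_gt0 adjacent_spec FV vV FN) _.
  apply: rspec_bind (minusM_bound W_gt0 same_spec FV vQV FN vQN) _.
  apply: rspec_bind sc _; apply: prodM_rspec => // C Ccs.
  by case: (bodyP C Ccs).
have rE : result (incrementM t (map cd F) (cd v)) = \prod_(C <- cs) g C by case: rs.
rewrite rE; split=> //; rewrite /increment_run -set_cons_nbrs gdel_gof -/G.
exists zc; last first.
  rewrite (prod_component_lists _ uG cG) big_seq [RHS]big_seq; apply: eq_bigr => C Ccs.
  by rewrite zcE.
move=> X XG; have [_ mem] := components_lists uG cG.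
move: XG; rewrite mem => /mapP[C Ccs ->]; rewrite zcE // induced_subgraph; first by case:
    (bodyP C Ccs).
by apply/subsetP=> x; rewrite !inE; apply: CG.
Qed.

Lemma while_cost_le t n m : (n < N)%N ->
  (((B 2 + 7 * B 3 + 1) * n + 1) + (increment_cost t + (1 + (B 2 + ((increment_cost t + 20 * B
      4) * m + 1)))) < (increment_cost t + 20 * B 4) * m.+1 + 1)%N.
Proof.
move=> nN; have [N0 B0 NB B3 B4] := cost_bounds a nN.
have h1 : ((B 2 + 7 * B 3 + 1) * n <= (B 2 + 7 * B 3 + 1) * N)%N by rewrite leq_mul2l (ltnW nN)
    orbT.
have B30 : (0 < B 3)%N by rewrite !muln_gt0 addn_gt0 ?expn_gt0 N0 !orbT.
have h2 : (B 3 <= B 4)%N by rewrite B4 leq_pmulr.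
have h3 : (B 2 <= B 3)%N by rewrite B3 leq_pmulr.
have h4 : ((B 2 + 7 * B 3 + 1) * N = B 3 + 7 * B 4 + N)%N by rewrite B4 [X in _ = (X + _ +
    _)%N]B3; move: (B 2) (B 3); clear; nia.
have key (x y z i p q : nat) : (0 < x)%N -> (x <= y)%N -> (y <= z)%N -> (N <= x)%N ->
    (p <= y + 7 * z + N)%N -> (p + 1 + (i + (1 + (x + (q + 1)))) < (i + 20 * z) + q + 1)%N.
  by clear; lia.
by rewrite mulnS; apply: key h3 h2 NB _; rewrite -?h4.
Qed.

Lemma matchings_cost_le t k n : (k <= N)%N -> (n < N)%N ->
  (10 * B 4 + ((N + ((increment_cost t + 20 * B 4) * N + 1) + 2) * k + 1) <
     2 * (phi_cost a N t * N ^ 4) + 100 * B 6)%N.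
Proof.
move=> kN nN; have [N0 B0 NB B3 B4] := cost_bounds a nN.
set I := (N + _ + 2)%N; have h : (I * k <= I * N)%N by rewrite leq_mul2l kN orbT.
have E : (I * N = 2 * (phi_cost a N t * N ^ 4) + 60 * B 6 + N ^ 2 + 3 * N)%N.
  rewrite /I /increment_cost (_ : B 6 = B 4 * N * N)%N; last first.
    by rewrite (expnSr N 5) (expnSr N 4) !mulnA.
  move: (B 4) => b4; rewrite (_ : N ^ 4 = N ^ 2 * N * N)%N; last first.
    by rewrite (expnSr N 3) (expnSr N 2).
  by rewrite -!mulnn; move: (phi_cost a N t) => p; clear; nia.
have B6 : (B 4 <= B 6)%N by rewrite leq_mul2l leq_pexp2l ?orbT.
have h1 : (N ^ 2 <= B 6)%N.
  by apply: leq_trans (leq_pmull _ _); rewrite ?addn_gt0 ?orbT // leq_pexp2l.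
have h2 : (N <= N ^ 2)%N by rewrite -{1}[N]expn1 leq_pexp2l.
have key (x y z p q : nat) : (q <= p + 60 * z + y + 3 * N)%N -> (N <= y)%N -> (y <= z)%N ->
    (x <= z)%N -> (10 * x + (q + 1) < p + 100 * z)%N.
  by move: N0; clear; lia.
by apply: key h2 h1 B6; rewrite -E.
Qed.


Lemma set_rem F v : [set w in minus F [:: v]] = [set w in F] :\ v.
Proof. by rewrite set_minus; congr (_ :\: _); apply/setP=> w; rewrite !inE. Qed.

(** The output [y] is fixed before the size bound [zb]: in the recursive call the size of the
    accumulator depends on how many operations were actually performed. *)
Lemma whileM_spec t m F z : inV F -> uniq F -> (size F <= m)%N -> (m < N)%N ->
    gconnected (gof F) ->
  exists y, while_run t (gof F) z y /\ forall zb, rat_bound zb z ->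
    rspec zb (whileM m t (map cd F) z) y ((increment_cost t + 20 * B 4) * m + 1).
Proof.
have set_nil : [set v in [::]] = set0 :> {set T} by apply/setP=> v; rewrite !inE.
elim: m F z => [|m IH] F z FV uF Fm mN conn.
  move: Fm; rewrite leqn0 => /nilP ->; exists z; split=> [|zb bz]; first by apply: while_stop;
      apply: set_nil.
  by rewrite muln0; apply: rspec_step => //; apply: rspec_ret.
have FN := leq_ltn_trans Fm mN.
case: F FV uF Fm FN conn => [|f F'] FV uF Fm FN conn.
  exists z; split=> [|zb bz]; first by apply: while_stop; apply: set_nil.
  by apply: (@rspec_le _ _ _ _ 1); [rewrite addn1 | apply: rspec_step => //; apply: rspec_ret].
set F := f :: F' in FV uF Fm FN conn *.
have [N0 B0 NB B3 B4] := cost_bounds a FN.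
have N1 : (1 < N)%N by apply: leq_ltn_trans FN.
have minus1 v : v \in F -> spec (minusM (map cd F) [:: cd v]) (map cd (minus F [:: v])) (B 2).
  move=> vF; apply: (minusM_bound W_gt0 same_spec (K := [:: v])) => //.
  by move=> x; rewrite inE => /eqP->; apply: FV.
have F1V v : inV (minus F [:: v]) by apply: inV_filter.
have uF1 v : uniq (minus F [:: v]) by rewrite filter_uniq.
have sF1 v : (size (minus F [:: v]) <= size F)%N by rewrite size_filter count_size.
pose c v := connected_set L ([set w in F] :\ v).
have find : spec (findM (fun v : hedge => let* F1 := minusM (map cd F) [::
    v] in connectedM F1) (map cd F))
    (omap cd (ohead [seq v <- F | c v])) ((B 2 + 7 * B 3 + 1) * size F + 1).
  apply: findM_spec => // v vF; apply: spec_bind (minus1 v vF) _; rewrite /c -set_rem.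
  by apply: connectedM_spec => //; apply: leq_ltn_trans FN.
have [v vF [cv findv]] : exists2 v, v \in F & c v /\ ohead [seq v <- F | c v] = Some v.
  have F0 : [set w in F] != set0 by apply/set0Pn; exists f; rewrite inE mem_head.
  have [w wF cw] := noncut_vertex conn F0.
  case E : [seq v <- F | c v] => [|v Q]; last first.
    have : v \in [seq v <- F | c v] by rewrite E mem_head.
    by rewrite mem_filter => /andP[cv vF]; exists v.
  have : w \in [seq v <- F | c v] by rewrite mem_filter; apply/andP; split; [apply/connectedP |
      rewrite inE in wF].
  by rewrite E.
rewrite findv /= in find.
have [inc rinc] := incrementM_spec t FV uF FN vF conn.
move: inc rinc; set z1 := result _ => inc rinc.
have conn1 : gconnected (gof (minus F [:: v])) by rewrite /gof set_rem; apply/connectedP.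
have Fm1 : (size (minus F [:: v]) <= m)%N.
  rewrite -ltnS; apply: leq_trans Fm; rewrite -!card_set_seq // set_rem.
  by rewrite [ltnRHS](cardsD1 v) inE vF.
have [y [wr ry]] := IH _ (z + z1) (F1V v) (uF1 v) Fm1 (ltnW mN) conn1.
have gE : gdel (gof F) [set v] = gof (minus F [:: v]) by rewrite gdel_subgraph /gof set_rem.
exists y; split=> [|zb bz]; first by apply: while_step inc _; rewrite ?inE ?gE.
have B40 : (0 < B 4)%N by rewrite !muln_gt0 addn_gt0 ?expn_gt0 N0 !orbT.
apply: (@rspec_le _ _ _ _ (((B 2 + 7 * B 3 + 1) * size F + 1) + (increment_cost t + (1 + (B 2 +
    ((increment_cost t + 20 * B 4) * m + 1))))).+1).
  exact: while_cost_le.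
apply: rspec_step => //; apply: rspec_bind find _.
rewrite -[zb in rspec zb]addn0; apply: rspec_bindR => [|o _ bo]; first exact: rinc.
rewrite -[(zb + _)%N]add0n; apply: rspec_bindR => [|o' _ bo']; first exact: radd_rspec bz bo.
by rewrite add0n; apply: rspec_bind (minus1 v vF) _; apply: ry.
Qed.

(** Each factor [N] next to [phi_cost] bounds one nesting: blocks of a peeling, components after
    deleting a closed neighbourhood, iterations of the loop, components of the input. *)
Definition matchings_cost t := (2 * (phi_cost a N t * N ^ 4) + 100 * B 6)%N.

Lemma CountMatchings_spec t F : inV F -> uniq F -> (size F < N)%N ->
  exists yc : {set T} -> rat,
    [/\ forall X, X \in components (gof F) -> while_run t (subgraph X) 1 (yc X),
      result (CountMatchings (map cd F) t) = \prod_(X in components (gof F)) yc X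
    & rspec 0 (CountMatchings (map cd F) t) (result (CountMatchings (map cd F) t))
        (matchings_cost t)].
Proof.
move=> FV uF FN; have [N0 B0 NB B3 B4] := cost_bounds a FN.
have [cs [sc cF]] := componentsM_spec W_gt0 same_spec adjacent_spec FV uF FN.
have [pF ne cl] := cF.
have CF C : C \in cs -> {subset C <= F}.
  by move=> Ccs x xC; rewrite -(perm_mem pF); apply/flattenP; exists C.
have uC C : C \in cs -> uniq C.
  move=> Ccs; have : uniq (flatten cs) by rewrite (perm_uniq pF).
  elim: (cs) Ccs => // D ds IH; rewrite inE /= cat_uniq => CD /and3P[uD _ uds].
  by case/predU1P: CD => [-> //|/IH]; apply.
pose body (C : seq hedge) : costed rat := (let* m := lengthM C in whileM m t C 1).
pose g C := result (body (map cd C)).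
have bodyP C : C \in cs -> while_run t (gof C) 1 (g C) /\
    rspec 0 (body (map cd C)) (g C) (N + ((increment_cost t + 20 * B 4) * N + 1)).
  move=> Ccs; have [_ conn] := ne C Ccs.
  have CV : inV C by move=> x /(CF _ Ccs) /FV.
  have CN : (size C < N)%N.
    by apply: leq_ltn_trans FN; apply: uniq_leq_size; [exact: uC | exact: CF].
  have [y [wr ry]] := whileM_spec t 1 CV (uC _ Ccs) (leqnn _) CN conn.
  have rb : rspec 0 (body (map cd C)) y (N + ((increment_cost t + 20 * B 4) * N + 1)).
    have one : rat_bound 0 1 by apply: (@rat_bound_nat 1).
    have := ry 0 one; rewrite -{1}[size C](size_map cd) => {}ry.
    have len : spec (lengthM (map cd C)) (size (map cd C)) N.
      by apply: spec_le (lengthM_spec W_gt0 _); rewrite size_map.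
    apply: rspec_bind len _; apply: rspec_le ry.
    by rewrite leq_add2r leq_mul2l (ltnW CN) orbT.
  by have -> : g C = y by case: rb.
have [zc zcE] := as_set_choice g uF cF.
have [_ mem] := components_lists uF cF.
have rs : rspec 0 (CountMatchings (map cd F) t) (\prod_(C <- cs) g C) (matchings_cost t).
  have szcs : (size cs <= N)%N.
    apply: leq_trans (ltnW FN); rewrite -(perm_size pF).
    by apply: size_component_lists => C /ne[].
  apply: (@rspec_le _ _ _ _ (10 * B 4 + ((N + ((increment_cost t + 20 * B 4) * N + 1) + 2) *
      size cs + 1)).+1).
    exact: matchings_cost_le szcs FN.
  apply: rspec_step => //; apply: rspec_bind sc _; apply: prodM_rspec => // C Ccs.
  by case: (bodyP C Ccs).
have rE : result (CountMatchings (map cd F) t) = \prod_(C <- cs) g C by case: rs.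
exists zc; rewrite rE; split=> //.
  by move=> X; rewrite mem => /mapP[C Ccs ->]; rewrite zcE //; case: (bodyP C Ccs).
rewrite (prod_component_lists _ uF cF) big_seq [RHS]big_seq; apply: eq_bigr => C Ccs.
by rewrite zcE.
Qed.

End Counting.

(** * Intersection graphs of (3,3)-graphs *)

Section LabelLists.
Variable W : nat.
Hypothesis W_gt0 : (0 < W)%N.
Definition short (e : hedge) : Prop := {in e, forall v, (2 * bitlen v <= W)%N}.

Lemma lab_eq_spec v w : (2 * bitlen v <= W)%N -> (2 * bitlen w <= W)%N ->
  spec W (lab_eq v w) (v == w) 1.
Proof. by move=> hv hw; split=> //=; rewrite muln1; lia. Qed.

Lemma same_short e f : short e -> short f -> spec W (same e f) (e == f) (2 * size e + 1).
Proof.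
elim: e f => [|v e IH] f se sf /=.
  by case: f sf => [|w f] sf; rewrite muln0; apply: spec_step => //; apply: spec_ret.
case: f sf => [|w f] sf.
  by apply: (@spec_le _ _ _ _ 1); [rewrite addn1 | apply: spec_step => //; apply: spec_ret].
apply: (@spec_le _ _ _ _ (1 + (2 * size e + 1)).+1); first by lia.
apply: spec_step => //; apply: spec_bind.
  by apply: lab_eq_spec; [apply: se | apply: sf]; rewrite mem_head.
rewrite eqseq_cons; case: (v == w) => /=; last exact: spec_le (spec_ret _ _).
by apply: IH => u ue; [apply: se | apply: sf]; rewrite inE ue orbT.
Qed.

Lemma meets_short e f : short e -> short f ->
  spec W (meets e f) (has (mem f) e) ((2 * size f + 3) * size e + 3).
Proof.
move=> se sf; rewrite [(_ + 3)%N]addnS; apply: spec_step => //.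
have ex v : v \in e -> spec W (existsM (lab_eq v) f) (v \in f) ((1 + 1) * size f + 2).
  move=> ve; rewrite -has_pred1 (eq_has (a2 := eq_op v)); last by move=> w; rewrite /= eq_sym.
  have := @existsM_spec W W_gt0 _ _ id (lab_eq v) (eq_op v) 1 f; rewrite map_id; apply=> w wf.
  by apply: lab_eq_spec; [apply: se | apply: sf].
have := @existsM_spec W W_gt0 _ _ id (fun v => existsM (lab_eq v) f) (mem f) _ e ex.
by rewrite map_id -addnA.
Qed.

(** For edges of size three [same] costs at most [7] and [meets] at most [30]; negation and
    conjunction add one step each. *)
Lemma adjacent_short e f : short e -> short f -> size e = 3 -> size f = 3 ->
  spec W (adjacent e f) ((e != f) && has (mem f) e) 39.
Proof.
move=> se sf e3 f3; have s := same_short se sf; have m := meets_short se sf.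
rewrite e3 f3 in s m.
exact: spec_le (andM_spec W_gt0 (notM_spec W_gt0 s) m).
Qed.
End LabelLists.

Section ThreeThree.
Variable H : hypergraph.
Hypothesis H33 : kr_graph 3 3 H.
Local Notation L := (intersection_graph H).

(** Of the at most three edges through [z] one is [w] itself. *)
Lemma star_clique (w : {set vertex H}) z : w \in edges H -> z \in w ->
  small_clique L [set e in edges H | (z \in e) && (e != w)].
Proof.
move=> wE zw; split; last first.
  move=> e f; rewrite !inE => /and3P[_ ze _] /and3P[_ zf _] ef.
  by rewrite /= /meet_adj ef /=; apply/set0Pn; exists z; rewrite inE ze.
have [_ deg] := H33.
have : (degree z <= 3)%N.
  by apply: leq_trans deg; rewrite /max_degree (bigD1 z) //= leq_maxl.
rewrite /degree (cardsD1 w) inE wE zw /= add1n ltnS; apply: leq_trans.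
by apply: subset_leq_card; apply/subsetP=> e; rewrite !inE => /and3P[-> -> ->].
Qed.

Lemma intersection_graph_two_cliques : locally_two_cliques L.
Proof.
move=> w v wE; rewrite inE => /andP[vE /=]; rewrite /meet_adj => /andP[wv /set0Pn[p]].
rewrite inE => /andP[pw pv].
have [unif _] := H33; have w3 := unif _ wE.
have /cards2P[q [r [qr qrE]]] : #|w :\ p| == 2%N by move: w3; rewrite (cardsD1 p) pw add1n =>
    -[->].
have mem z : z \in w -> [|| z == p, z == q | z == r].
  by move=> zw; have := in_setD1 z w p; rewrite qrE zw andbT !inE => ->; rewrite orbN.
have [qw rw] : q \in w /\ r \in w.
  by split; apply: (subsetP (subsetDl w [set p])); rewrite qrE !inE eqxx ?orbT.
exists [set e in edges H | (q \in e) && (e != w)], [set e in edges H | (r \in e) && (e != w)].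
split; [exact: star_clique | exact: star_clique |].
apply/subsetP=> e; rewrite !inE /= /meet_adj => /and3P[eE we /set0Pn[z]].
rewrite inE eE => /andP[/mem zpqr ze]; rewrite [e == w]eq_sym we /= !andbT.
case/or3P: zpqr ze => /eqP-> ze; rewrite ?ze ?orbT //.
case: eqP => //= ev; rewrite eq_sym; have -> : e != v by apply/eqP.
by apply/orP; left; apply/set0Pn; exists p; rewrite inE pv.
Qed.

Lemma Z_M_nis : Z_M H = nis L (vset L).
Proof.
rewrite /Z_M /nis; congr #|pred_of_set _|; apply/setP=> A; rewrite inE.
apply/andP/indep_setsP => -[AE h]; split=> //.
  move=> u v uA vA; rewrite /= /meet_adj; case: eqP => //= /eqP uv.
  by rewrite setI_eq0 (trivIsetP h).
apply/trivIsetP => u v uA vA uv; rewrite -setI_eq0.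
by have := h u v uA vA; rewrite /= /meet_adj uv /= negbK.
Qed.

Lemma run_close t r y : 1 <= r ->
  (forall X K : {set {set vertex H}}, X \subset vset L -> simplicial_block (subgraph L X) K ->
     ratio_close r (prob L X K) (Phi t (subgraph L X) K)) ->
  CountMatchings_run H t y -> ratio_close (r ^+ #|edges H|) y (Z_M H)%:R.
Proof.
move=> r1 Phi_r [yc run ->]; rewrite Z_M_nis.
apply: (components_close intersection_graph_two_cliques r1 Phi_r) => C CP.
have := run C CP; rewrite (@induced_subgraph _ L (edges H)) //.
exact: component_sub CP.
Qed.

Lemma sum_ge_mem (A : eqType) (s : seq A) (f : A -> nat) v : v \in s ->
    (f v <= \sum_(w <- s) f w)%N.
Proof. by move=> vs; rewrite (big_rem v vs) /= leq_addr. Qed.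

Lemma bitlen_input_size (x : seq hedge) (e : hedge) (v : nat) : e \in x -> v \in e ->
    (bitlen v <= input_size x)%N.
Proof.
move=> ex ve; apply: leq_trans (sum_ge_mem (fun e : hedge =>
    1 + \sum_(v <- e) (1 + bitlen v))%N ex).
apply: leq_trans (leq_addl 1 _).
exact: leq_trans (leq_addl 1 _) (sum_ge_mem (fun v => 1 + bitlen v)%N ve).
Qed.

Lemma CountMatchings_encoded x t : encodes x H ->
  CountMatchings_run H t (result (CountMatchings x t)) /\
  rspec (2 * input_size x).+1 0 (CountMatchings x t) (result (CountMatchings x t))
    (matchings_cost 39 #|edges H|.+1 t).
Proof.
case=> lab [Ls [injlab xE /allP uLs pE]].
set F := [seq [set v in l] | l <- Ls] in pE.
have uF : uniq F by rewrite (perm_uniq pE) enum_uniq.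
have memF e : (e \in F) = (e \in edges H) by rewrite (perm_mem pE) mem_enum.
(* The code of an edge is the list at its position in the input; [F] has no repetitions, so the
   position is well defined. *)
pose cd e := map lab (nth [::] Ls (index e F)).
have cdE l : l \in Ls -> cd [set v in l] = map lab l.
  by move=> lL; rewrite /cd (nth_index_map _ (uniq_map_inj uF)).
have xF : x = map cd F by rewrite xE -map_comp; apply/eq_in_map => l lL /=; rewrite cdE.
have edgeP e : e \in edges H -> exists l, [/\ l \in Ls, e = [set v in l], cd e = map lab l &
    size l = 3].
  move=> eE; have := eE; rewrite -memF => /mapP[l lL el]; exists l; split=> //.
    by rewrite el cdE.
  by have [unif _] := H33; have := unif _ eE; rewrite {1}el (card_set_seq (uLs _ lL)).
set W := (2 * input_size x).+1.
have W_gt0 : (0 < W)%N by [].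
have sh e : e \in edges H -> short W (cd e) /\ size (cd e) = 3.
  move=> eE; have [l [lL el cl l3]] := edgeP e eE; split; last by rewrite cl size_map.
  move=> v ve; apply: leqW; rewrite leq_mul2l /=; apply: bitlen_input_size ve.
  by rewrite xF; apply: map_f; rewrite memF.
have same_spec : {in vset L &, forall e f, spec W (same (cd e) (cd f)) (e == f) 39}.
  move=> e f eE fE; have [se e3] := sh e eE; have [sf f3] := sh f fE.
  have := same_short W_gt0 se sf; rewrite e3 (_ : (cd e == cd f) = (e == f)); first exact:
      spec_le.
  apply/eqP/eqP => [|-> //].
  have [l [_ -> -> _]] := edgeP e eE; have [l' [_ -> -> _]] := edgeP f fE.
  by move/(inj_map injlab) => ->.
have adj_spec : {in vset L &, forall e f, spec W (adjacent (cd e) (cd f)) (gadj L e f) 39}.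
  move=> e f eE fE; have [se e3] := sh e eE; have [sf f3] := sh f fE.
  have := adjacent_short W_gt0 se sf e3 f3; congr spec; rewrite /= /meet_adj.
  have [l [_ el cl _]] := edgeP e eE; have [l' [_ fl' cl' _]] := edgeP f fE; congr (~~ _ && _).
    apply/eqP/eqP => [|-> //]; rewrite cl cl' el fl'.
    by move/(inj_map injlab) => ->.
  rewrite cl cl' el fl'; apply/hasP/set0Pn => [[v /mapP[u ul ->] /=]|[u]].
    by rewrite mem_map // => ul'; exists u; rewrite !inE ul.
  by rewrite !inE => /andP[ul ul']; exists (lab u); apply: map_f.
have FV : inV L F by move=> e; rewrite memF.
have FN : (size F < #|edges H|.+1)%N by rewrite (perm_size pE) -cardE.
have FE : gof L F = L.
  rewrite /gof (_ : [set e in F] = edges H) //.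
  by apply/setP=> e; rewrite in_set memF.
have [yc [run rE rs]] := CountMatchings_spec intersection_graph_two_cliques W_gt0 same_spec
    adj_spec t FV uF FN.
rewrite -xF in rE rs; split=> //; rewrite FE in run rE; exists yc => // C CL.
have := run C CL; rewrite (@induced_subgraph _ L (edges H)) //.
exact: component_sub CL.
Qed.

End ThreeThree.

(** * Depth, precision and running time *)

Section Depth.
Variable R : realType.
Implicit Types (eps x y : R) (n k : nat).

Local Notation base := (50%:R / 49%:R : R).
Local Notation expo := (log_base base 144%:R).

Lemma powR_expR x y : 0 < x -> x `^ y = sequences.expR (ln x * y).
Proof. by move=> x0; rewrite expRM lnK. Qed.

Lemma ln_base_gt0 : 0 < ln base.
Proof. by apply: ln_gt0; lra. Qed.

(** Both sides are the exponential of [ln x * ln y / ln base]. This turns [144] to a logarithmic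
    depth into a power of [n / eps]. *)
Lemma powR_log_base x y : 0 < x -> 0 < y -> y `^ log_base base x = x `^ log_base base y.
Proof.
move=> x0 y0; rewrite !powR_expR // /log_base; congr sequences.expR.
by have := lt0r_neq0 ln_base_gt0; move: (ln base) => l l0; field.
Qed.

(** Since [18 * n / eps > 1], the ceiling is positive and can be written [k.+1]; the depth
    [2 * k + 2] then matches [Phi_close]. The ceiling exceeds the logarithm by less than one, which
    costs the single factor [144]. *)
Lemma depthP n eps : (1 <= n)%N -> 0 < eps -> eps <= 1 ->
  exists k, [/\ depth n eps = (2 * k.+1)%N, 18%:R * n%:R / eps <= base ^+ k.+1
    & 144%:R ^+ k.+1 <= 144%:R * 18%:R `^ expo * (n%:R / eps) `^ expo].
Proof.
move=> n1 e0 e1; set y := 18%:R * n%:R / eps; pose D := log_base base y.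
have nR : 1 <= n%:R :> R by rewrite ler1n.
have y1 : 1 < y.
  rewrite /y ltr_pdivlMr // mul1r; apply: le_lt_trans e1 _; lra.
have y0 : 0 < y by apply: lt_trans y1.
have D0 : 0 < D by apply: divr_gt0; [apply: ln_gt0 | apply: ln_base_gt0].
rewrite /depth -/y -/D.
have := ceil_ge D; have := ceilB1_lt D; have : 0 < Num.ceil D by rewrite ceil_gt0.
case: (Num.ceil D) => [[//|k]|//] _ kD Dk; exists k; split=> //.
  have -> : y = base `^ D.
    rewrite powR_log_base // ?divr_gt0 // /log_base divff ?powRr1 ?ltW //.
    by rewrite lt0r_neq0 // ln_base_gt0.
  rewrite -powR_mulrn ?divr_ge0 //; apply: ler_powR; first by lra.
  exact: Dk.
have -> : 144%:R * 18%:R `^ expo * (n%:R / eps) `^ expo = 144%:R `^ (1 + D).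
  rewrite powRD; last by rewrite pnatr_eq0 implybT.
  rewrite powRr1 // -mulrA; congr (_ * _).
  rewrite -powRM ?divr_ge0 // ?ltW // mulrA -/y powR_log_base //.
rewrite -powR_mulrn //; apply: ler_powR; first by rewrite ler1n.
by move: kD; rewrite intrB -[(Posz k.+1)%:~R]/(k.+1%:R : R); lra.
Qed.

Lemma expr_le_linear (e : R) (m : nat) : 0 <= e -> 2 * (m%:R * e) <= 1 ->
  (1 + e) ^+ m <= 1 + 2 * (m%:R * e).
Proof.
move=> e0; elim: m => [|m IH] me; first by rewrite expr0 mul0r mulr0 addr0.
have me0 : 0 <= m%:R * e by rewrite mulr_ge0.
have mS : m.+1%:R * e = m%:R * e + e by rewrite -natr1 mulrDl mul1r.
rewrite mS in me *; have {}IH : (1 + e) ^+ m <= 1 + 2 * (m%:R * e) by apply: IH; lra.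
rewrite exprSr; apply: (@le_trans _ _ ((1 + 2 * (m%:R * e)) * (1 + e))).
  by rewrite ler_wpM2r //; lra.
move: (m%:R * e) me me0 IH => q me me0 _; nra.
Qed.

Lemma close_error (s : rat) (y Z : rat) (e : R) : 1 <= s -> 0 <= Z ->
  (ratr s : R) <= 1 + e -> ratio_close s y Z -> `|ratr y - ratr Z| <= e * ratr Z.
Proof.
move=> s1 Z0 se [yZ Zy].
have y0 : 0 <= y.
  by have := le_trans Z0 Zy; rewrite pmulr_rge0 // (lt_le_trans ltr01).
have {}s1 : 1 <= ratr s :> R by rewrite -[X in X <= _](ratr_nat R 1) ler_rat.
have {}Z0 : 0 <= ratr Z :> R by rewrite ler0q.
have {}y0 : 0 <= ratr y :> R by rewrite ler0q.
have {}yZ : ratr y <= ratr s * ratr Z :> R by rewrite -rmorphM ler_rat.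
have {}Zy : ratr Z <= ratr s * ratr y :> R by rewrite -rmorphM ler_rat.
move: (ratr s) (ratr y) (ratr Z) s1 se Z0 y0 yZ Zy => {}s {}y {}Z s1 se Z0 y0 yZ Zy.
have sZ : s * Z <= (1 + e) * Z by rewrite ler_wpM2r.
have sy : s * y <= (1 + e) * y by rewrite ler_wpM2r.
rewrite ler_norml; apply/andP; split; last by lra.
case: (lerP y Z) => yZ'; last by have : 0 <= e * Z; [rewrite mulr_ge0 //; lra | lra].
have : e * y <= e * Z by rewrite ler_wpM2l //; lra.
lra.
Qed.

Lemma run_accuracy eps (H : hypergraph) (y : rat) : 0 < eps -> kr_graph 3 3 H ->
  CountMatchings_run H (run_depth #|edges H| eps) y ->
  `|ratr y - (Z_M H)%:R| <= eps * (Z_M H)%:R.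
Proof.
move=> e0 H33; rewrite /run_depth; set d := Num.min eps 1; set n := #|edges H| => run.
have [d0 d1 de] : [/\ 0 < d, d <= 1 & d <= eps].
  by rewrite /d lt_min e0 ltr01 !ge_min !lexx !orbT.
have Z0 : 0 <= (Z_M H)%:R :> R by [].
apply: (@le_trans _ _ (d * (Z_M H)%:R)); last by rewrite ler_wpM2r.
rewrite -(ratr_nat R (Z_M H)).
(* Without edges the depth formula involves the logarithm of zero; but then the only block is empty,
   [Phi] is [1] at any depth, and the run is exact. *)
have [n0|n1] := posnP n.
  have V0 : vset (intersection_graph H) = set0 by apply: cards0_eq.
  have c : ratio_close (1 ^+ #|edges H|) y (Z_M H)%:R.
    apply: (run_close H33 (lexx 1) _ run) => X K; rewrite V0 subset0 => /eqP-> .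
    rewrite simplicial_subgraph subset0 => /and3P[/eqP-> _ _].
    rewrite /prob setD0 divff ?lt0r_neq0 ?nisR_gt0 //.
    suff -> : Phi (depth n d) (subgraph (intersection_graph H) set0) set0 = 1 by split;
        rewrite mulr1.
    by case: depth => [|[|t]] //=; rewrite eqxx.
  rewrite expr1n in c; apply: (close_error (lexx 1) (ler0n _ _) _ c); rewrite rmorph1; lra.
have [k [tE yk _]] := depthP n1 d0 d1.
have c : ratio_close ((1 + err k) ^+ n) y (Z_M H)%:R.
  apply: (run_close H33 _ _ run); first by rewrite lerDl err_ge0.
  move=> X K XV sK; rewrite tE mulnS add2n.
  apply: (Phi_ratio_close (intersection_graph_two_cliques H33)) => //.
  by rewrite mul2n.
have r1 : 1 <= 1 + err k by rewrite lerDl err_ge0.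
apply: (close_error (exprn_ege1 n r1) (ler0n _ _) _ c).
have errE : ratr (err k) = 8 * (49%:R / 50%:R) ^+ k :> R.
  by rewrite /err rmorphM rmorphXn /= fmorph_div /= !ratr_nat.
rewrite rmorphXn rmorphD rmorph1 /= errE.
set q := (49%:R / 50%:R : R) ^+ k.
have q0 : 0 < q by rewrite exprn_gt0 // divr_gt0.
have nR : 0 < n%:R :> R by rewrite ltr0n.
(* Only [k] of the [k.+1] factors contract, so the left side is at most [16 / 18 * 50 / 49 * d],
   still below [d]: this is what the constant [18] leaves room for. *)
have nq : 2 * (n%:R * (8 * q)) <= d.
  have qE : base ^+ k.+1 = base / q.
    by rewrite exprS /q -exprVn invf_div.
  move: yk; rewrite qE ler_pdivlMr // mulrAC ler_pdivrMr //; lra.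
apply: le_trans (expr_le_linear _ _) _; lra.
Qed.

Definition cost_constant a : nat := (2 * (60 * (4 * a + 10)) + 100 * (a + 10))%N.

Lemma matchings_cost_bound a N t : (0 < N)%N ->
  (matchings_cost a N t <= cost_constant a * (N ^ 6 * 6 ^ t))%N.
Proof.
move=> N0; rewrite /matchings_cost /phi_cost /cost_constant.
have h1 : (N * 6 ^ t * N ^ 4 <= N ^ 6 * 6 ^ t)%N.
  by rewrite mulnAC -expnS leq_mul2r leq_pexp2l ?orbT.
have h2 : (N ^ 6 <= N ^ 6 * 6 ^ t)%N by rewrite leq_pmulr // expn_gt0.
rewrite [leqRHS]mulnDl leq_add //; last by rewrite mulnA leq_mul.
rewrite -(mulnA 2) leq_mul2l /=; set c := (60 * _)%N.
by rewrite -!(mulnA c) leq_mul.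
Qed.

Definition time_constant : R := (cost_constant 39)%:R * 64%:R * (144%:R * 18%:R `^ expo).

Lemma matchings_cost_time n eps : (1 <= n)%N -> 0 < eps -> eps <= 1 ->
  (matchings_cost 39 n.+1 (depth n eps))%:R <=
    time_constant * (n%:R ^+ 2 * (n%:R / eps) `^ expo).
Proof.
move=> n1 e0 e1; have [k [-> yk k144]] := depthP n1 e0 e1.
have nR : 1 <= n%:R :> R by rewrite ler1n.
apply: (@le_trans _ _ ((cost_constant 39)%:R * (n.+1%:R ^+ 6 * 6%:R ^+ (2 * k.+1)))).
  by rewrite -!natrX -!natrM ler_nat matchings_cost_bound.
rewrite /time_constant -[leRHS]mulrA -[leRHS]mulrA ler_wpM2l //.
have nb : n%:R <= base ^+ k.+1.
  apply: le_trans yk; rewrite ler_pdivlMr //.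
  have : n%:R * eps <= n%:R * 1 by rewrite ler_wpM2l //; lra.
  lra.
(* Four of the six powers of [n] are traded for the depth, using [(50 / 49) ^ 4 <= 4]; together with
   [6 ^ 2 = 36] this makes [144]. The factor [64] below comes from [n + 1 <= 2 * n]. *)
have n4 : n%:R ^+ 4 <= 4%:R ^+ k.+1 :> R.
  apply: (@le_trans _ _ ((base ^+ k.+1) ^+ 4)).
    by rewrite lerXn2r // ?nnegrE //; apply: exprn_ge0; rewrite divr_ge0.
  rewrite -exprM mulnC exprM lerXn2r // ?nnegrE ?exprn_ge0 ?divr_ge0 //.
  lra.
have n6 : n.+1%:R ^+ 6 <= 64%:R * (n%:R ^+ 2 * n%:R ^+ 4) :> R.
  rewrite -exprD; have -> : 64%:R = 2%:R ^+ 6 :> R by rewrite -natrX.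
  by rewrite -exprMn lerXn2r // ?nnegrE ?mulr_ge0 // -natr1; lra.
have s6 : 6%:R ^+ (2 * k.+1) = 36%:R ^+ k.+1 :> R by rewrite exprM -natrX.
have k36 : 0 <= 36%:R ^+ k.+1 :> R by rewrite exprn_ge0.
rewrite s6; apply: (@le_trans _ _ (64%:R * (n%:R ^+ 2 * n%:R ^+ 4) * 36%:R ^+ k.+1)).
  by rewrite ler_wpM2r.
have h : n%:R ^+ 4 * 36%:R ^+ k.+1 <= 144%:R * 18%:R `^ expo * (n%:R / eps) `^ expo.
  apply: le_trans k144; have -> : 144%:R = 4%:R * 36%:R :> R by rewrite -natrM.
  by rewrite exprMn ler_wpM2r.
have n2 : 0 <= 64%:R * n%:R ^+ 2 :> R by rewrite mulr_ge0 // exprn_ge0.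
have := ler_wpM2l n2 h; clear.
move: (n%:R ^+ 2) (n%:R ^+ 4) (36%:R ^+ k.+1) (18%:R `^ expo) ((n%:R / eps) `^ expo) =>
    a b c d e; lra.
Qed.

Lemma size_encoded (x : seq hedge) (H : hypergraph) : encodes x H -> size x = #|edges H|.
Proof. by case=> lab [Ls [_ -> _ pE]]; rewrite size_map cardE -(perm_size pE) size_map. Qed.

Lemma size_input (x : seq hedge) : (size x <= input_size x)%N.
Proof.
rewrite /input_size -sum1_size; apply: leq_sum => e _; exact: leq_addr.
Qed.

Lemma expo_ge0 : 0 <= expo.
Proof. by rewrite /log_base divr_ge0 ?ln_ge0 //; lra. Qed.

Lemma bit_polynomial (m s C X Y : R) : 0 <= m -> m <= C * Y -> 0 <= s -> s <= X -> 1 <= C ->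
  1 <= X -> 1 <= Y ->
  m * (2 * s + 1 + (4 * m + 4) ^+ 2) <= C * (3 + (4 * C + 4) ^+ 2) * (Y * Y * Y * X).
Proof.
move=> m0 mY s0 sX C1 X1 Y1.
have sq : (4 * m + 4) ^+ 2 <= (4 * C + 4) ^+ 2 * (Y * Y).
  have h : 4 * m + 4 <= (4 * C + 4) * Y by lra.
  rewrite -expr2 -exprMn lerXn2r // nnegrE; first by lra.
  by apply: le_trans h; lra.
have YY : 1 <= Y * Y by rewrite -[leLHS]mulr1 ler_pM.
have XY : X <= Y * Y * X by rewrite ler_peMl //; lra.
have YX : Y * Y <= Y * Y * X by rewrite ler_peMr //; lra.
have A0 : 0 <= (4 * C + 4) ^+ 2 by apply: sqr_ge0.
have h : 2 * s + 1 + (4 * m + 4) ^+ 2 <= (3 + (4 * C + 4) ^+ 2) * (Y * Y * X).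
  rewrite [leRHS]mulrDl; apply: lerD; first by lra.
  by apply: le_trans sq _; rewrite ler_wpM2l.
apply: le_trans (ler_pM m0 _ mY h) _.
  by apply: addr_ge0; [lra | apply: sqr_ge0].
by rewrite le_eqVlt; apply/orP; left; apply/eqP; ring.
Qed.

(** The real exponent is rounded up to [p], and [n / d <= X ^ 2], so the operation count is at most
    [C * X ^ q] with [q = 2 + 2 * p]. Arithmetic on numbers of that length makes the bit cost cubic
    in this count, and comparing labels contributes one more factor [X]. *)
Lemma bitops_bound : exists (c : R) (d : nat), forall (eps : R) (x : seq hedge) (H :
    hypergraph),
  0 < eps -> kr_graph 3 3 H -> encodes x H ->
  (bitops (CountMatchings x (run_depth (size x) eps)))%:R
    <= c * (1 + (input_size x)%:R + eps^-1) ^+ d.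
Proof.
pose p := Num.bound expo; pose q := (2 + p + p)%N.
have [K KE] : exists K : R, K = (matchings_cost 39 1 0)%:R by eexists.
have [C CE] : exists C : R, C = time_constant + K by eexists.
have tc0 : 0 <= time_constant by rewrite !mulr_ge0 // ?powR_ge0.
have K1 : 1 <= K.
  by rewrite KE ler1n /matchings_cost addn_gt0 orbC !muln_gt0 expn_gt0 addn_gt0.
have C1 : 1 <= C by rewrite CE; lra.
have [tC KC] : time_constant <= C /\ K <= C by rewrite CE; split; lra.
clear CE.
exists (C * (3 + (4 * C + 4) ^+ 2)), (q + q + q + 1)%N => eps x H e0 H33 enc.
set s := (input_size x)%:R; set X := 1 + s + eps^-1.
have s0 : 0 <= s by [].
have ei : 0 < eps^-1 by rewrite invr_gt0.
have X1 : 1 <= X by rewrite /X; lra.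
have sX : s <= X by rewrite /X; lra.
set t := run_depth _ _; set n := #|edges H|.
set M := matchings_cost 39 n.+1 t.
have szx := size_encoded enc.
have nX : n%:R <= X.
  have : n%:R <= s by rewrite /s ler_nat /n -szx size_input.
  by rewrite /X; lra.
have MX : M%:R <= C * X ^+ q.
  (* For [n = 0] the convention that [ln] vanishes at zero gives depth [0], and the cost is the
     constant [K]. *)
  have [n0|n1] := posnP n.
    have t0 : t = 0%N.
      by rewrite /t szx -/n n0 /run_depth /depth mulr0 mul0r /log_base ln0 // mul0r ceil0.
    rewrite /M n0 t0 -KE; apply: le_trans KC _.
    by rewrite ler_peMr ?exprn_ege1 // (le_trans ler01 C1).
  set d := Num.min eps 1.
  have [d0 d1] : 0 < d /\ d <= 1 by rewrite /d lt_min e0 ltr01 ge_min lexx orbT.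
  have dX : d^-1 <= X.
    by rewrite /d /X; case: (lerP eps 1) => _; rewrite ?invr1; lra.
  have := matchings_cost_time n1 d0 d1; rewrite -/t /M /t szx -/n => h.
  apply: le_trans h _; apply: ler_pM => //.
  - by rewrite mulr_ge0 ?exprn_ge0 ?powR_ge0.
  have ndX : n%:R / d <= X * X by apply: ler_pM; rewrite // invr_ge0 ltW.
  have XX : 1 <= X * X by rewrite -[leLHS]mulr1 ler_pM.
  rewrite /q -addnA exprD; apply: ler_pM; rewrite ?exprn_ge0 ?powR_ge0 //.
    by rewrite lerXn2r ?nnegrE // (le_trans ler01 X1).
  apply: (@le_trans _ _ ((X * X) `^ expo)).
    apply: ge0_ler_powR => //; rewrite ?nnegrE ?expo_ge0 ?divr_ge0 ?(ltW d0) //; lra.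
  apply: (@le_trans _ _ ((X * X) `^ p%:R)).
    by apply: ler_powR => //; rewrite ltW // archi_boundP // expo_ge0.
  by rewrite powR_mulrn ?exprMn -?exprD //; lra.
have [_ rs] := CountMatchings_encoded H33 t enc.
case: rs => _ opsM _ bit.
have bitM : (bitops (CountMatchings x t) <= M * ((2 * input_size x).+1 + (4 * M + 4) ^ 2))%N.
  apply: leq_trans bit _; apply: leq_mul => //; rewrite leq_add2l add0n /rat_cost.
  by rewrite leq_sqr mulnA leq_add2r leq_mul2l opsM.
apply: (@le_trans _ _ (M * ((2 * input_size x).+1 + (4 * M + 4) ^ 2))%:R);
    first by rewrite ler_nat.
have := bit_polynomial (ler0n R M) MX s0 sX C1 X1 (exprn_ege1 q X1).
have -> : X ^+ q * X ^+ q * X ^+ q * X = X ^+ (q + q + q + 1) by rewrite -!exprD -exprSr addn1.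
move=> h; apply: le_trans h.
by rewrite natrM natrD -natr1 natrM natrX natrD natrM.
Qed.

End Depth.

Theorem theorem2 (R : realType) :
  (* the program is an implementation of the algorithm *)
  (forall (H : hypergraph) (x : seq hedge) (t : nat),
     kr_graph 3 3 H -> encodes x H ->
     CountMatchings_run H t (result (CountMatchings x t))) /\
  (* it is an FPTAS for #M(3,3) *)
  is_fptas_for_M 3 3
    (fun (eps : R) (x : seq hedge) => CountMatchings x (run_depth (size x) eps)) /\
  (* whose accuracy does not depend on how the choices are resolved *)
  (forall (eps : R) (H : hypergraph) (y : rat),
     0 < eps -> kr_graph 3 3 H ->
     CountMatchings_run H (run_depth #|edges H| eps) y ->
     `|ratr y - (Z_M H)%:R| <= eps * (Z_M H)%:R) /\
  (* and its running time is O(n^2 (n/eps)^(log_(50/49) 144)) *)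
  (exists c : R, forall (eps : R) (H : hypergraph) (x : seq hedge),
     let n := #|edges H| in
     0 < eps -> eps <= 1 -> (1 <= n)%N ->
     kr_graph 3 3 H -> encodes x H ->
     (ops (CountMatchings x (depth n eps)))%:R <=
       c * (n%:R ^+ 2 * (n%:R / eps) `^ log_base (50%:R / 49%:R) 144%:R)).
Proof.
split; first by move=> H x t H33 /(CountMatchings_encoded H33 t)[].
split.
  have [c [d bits]] := bitops_bound R; exists c, d => eps x H e0 [H33 enc]; split.
    have [run _] := CountMatchings_encoded H33 (run_depth (size x) eps) enc.
    by rewrite (size_encoded enc) in run *; apply: run_accuracy.
  exact: bits e0 H33 enc.
split; first by move=> eps H y; apply: run_accuracy.
exists (time_constant R) => eps H x n e0 e1 n1 H33 enc.
have [_ [_ le_ops _ _]] := CountMatchings_encoded H33 (depth n eps) enc.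
apply: le_trans (matchings_cost_time n1 e0 e1).
by rewrite ler_nat.
Qed.
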